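(* Let $b>-1$, $\delta>-1$, and let $V^2=\pi^{-4}\sum_{i,j\ge1}\big((i+b)(j+\delta)\big)^{-2}\xi_{ij}^2$, where $\{\xi_{ij}\}_{i,j\ge 1}$ are independent standard normal random variables. With $\bar s=\bar s(r)$ and $p_m(\bar s)$ as defined in the context, for any integer $k\ge2$, as $r\to0$ ($r>0$), $$\frac{8\pi^2 r}{\ln^2 r}\,\big|\log\mathbf P(V^2<r)\big|=1+\sum_{m=1}^k p_m(\bar s)\,|\ln r|^{-m}+O\big((\ln|\ln r|)^k/|\ln r|^{k+1}\big).$$ In particular, $$\frac{8\pi^2 r}{\ln^2 r}\,\big|\log\mathbf P(V^2<r)\big|=1+2(\bar s-1)|\ln r|^{-1}+\bar s^2|\ln r|^{-2}+O\big((\ln|\ln r|)^2/|\ln r|^3\big).$$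
   Context: $\Psi=\Gamma'/\Gamma$ is the logarithmic derivative of the gamma function; $\log$ and $\ln$ both denote the natural logarithm. Polynomials $\pi_k=\pi_k(s)$, $k\ge0$, are defined by $\pi_0=1$, $\pi_1=s$ and $$\pi_{k+1}=\pi_k-\frac{k-1}{2k}\sum_{l=1}^k\pi_l\,\pi_{k+1-l},\qquad k\ge1$$ (so $\pi_2=s$, $\pi_3=s-s^2/2$, $\pi_4=s-3s^2/2+s^3/3$). (The number $\pi=3.14\ldots$ carries no index.) For $r\in(0,1)$ put $$\bar s=\ln|\ln r|-\Psi(1+b)-\Psi(1+\delta)-\ln(2\pi^3),\qquad \bar\pi_m=\pi_m(\bar s),\ m\ge0,$$ $$p_1(\bar s)=2\bar s-2,\quad p_2(\bar s)=\bar s^2,\quad p_m(\bar s)=-\frac{2}{m-2}(\bar\pi_m-\bar\pi_{m-1}),\ m\ge3.$$ *)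

(* Defs.v *)
From mathcomp Require Export all_boot all_order all_algebra finmap.
From mathcomp Require Export all_classical all_reals all_analysis.

Set Implicit Arguments.
Unset Strict Implicit.
Unset Printing Implicit Defensive.

Import Order.TTheory GRing.Theory Num.Theory.
Import numFieldNormedType.Exports.

Local Open Scope classical_set_scope.
Local Open Scope ring_scope.

Definition Gamma {R : realType} (x : R) : R :=
  \int[lebesgue_measure]_(t in `]0, +oo[) (t `^ (x - 1) * expR (- t)).

Definition Psi {R : realType} (x : R) : R := Gamma^`()%classic x / Gamma x.

(* [:: pi_0; ...; pi_k] is extended by pi_(k.+1), where k.+1 = size s *)
Definition pis_step {R : realType} (s : seq {poly R}) : seq {poly R} :=
  let k := (size s).-1 in
  rcons s (s`_k - ((k%:R - 1) / (2 * k%:R)) *: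
                  \sum_(1 <= l < k.+1) s`_l * s`_(k.+1 - l)).

Definition pis {R : realType} (k : nat) : {poly R} :=
  (iter k pis_step [:: 1; 'X])`_k.

Lemma size_pis_step {R : realType} (k : nat) :
  size (iter k (@pis_step R) [:: 1; 'X]) = k.+2.
Proof. by elim: k => //= k IHk; rewrite size_rcons IHk. Qed.

Lemma nth_pis_step {R : realType} (k l : nat) : (l <= k.+1)%N ->
  (iter k (@pis_step R) [:: 1; 'X])`_l = pis l.
Proof.
have step n i : (i < n.+2)%N ->
    (iter n.+1 (@pis_step R) [:: 1; 'X])`_i =
    (iter n (@pis_step R) [:: 1; 'X])`_i.
  by move=> ltin; rewrite iterS nth_rcons size_pis_step ltin.
have le m : (iter (m + l) (@pis_step R) [:: 1; 'X])`_l = pis l.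
  elim: m => // m IHm; rewrite addSn step ?IHm//.
  by rewrite ltnS leqW// leq_addl.
rewrite leq_eqVlt ltnS => /orP[/eqP lk|lk]; last by rewrite -(subnK lk) le.
by rewrite lk /pis step.
Qed.

Lemma pis0 {R : realType} : pis 0 = 1 :> {poly R}. Proof. by []. Qed.

Lemma pis1 {R : realType} : pis 1 = 'X :> {poly R}. Proof. by []. Qed.

Lemma pisS {R : realType} (k : nat) : (1 <= k)%N ->
  pis k.+1 = pis k - ((k%:R - 1) / (2 * k%:R)) *:
    \sum_(1 <= l < k.+1) pis l * pis (k.+1 - l) :> {poly R}.
Proof.
case: k => // k _.
rewrite -(@nth_pis_step R k.+1 k.+2)// iterS nth_rcons size_pis_step ltnn eqxx.
rewrite [k.+2.-1]/= nth_pis_step//; congr (_ - _ *: _).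
apply: eq_big_nat => l /andP[l0 lk].
by rewrite !nth_pis_step// leq_subLR; case: l l0 lk => // l _ _; rewrite addSn ltnS leq_addl.
Qed.

(* p_coef 0 is a junk value *)
Definition p_coef {R : realType} (m : nat) (s : R) : R :=
  if m == 1%N then 2 * s - 2
  else if m == 2%N then s ^+ 2
  else - (2 / (m%:R - 2)) * ((pis m).[s] - (pis m.-1).[s]).

Definition sbar {R : realType} (b delta r : R) : R :=
  ln `|ln r| - Psi (1 + b) - Psi (1 + delta) - ln (2 * pi ^+ 3).

Definition mutually_independent {R : realType} {d : measure_display}
    {T : measurableType d} {P : probability T R} {I : choiceType} (D : set I)
    (X : I -> {RV P >-> R}) : Prop :=
  forall (J : {fset I}) (B : I -> set R),
    [set` J] `<=` D -> (forall i, measurable (B i)) ->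
    P (\bigcap_(i in [set` J]) (X i @^-1` B i)) =
    (\prod_(i <- J) P (X i @^-1` B i))%E.

(* the equality of laws is required on Borel sets only, since set functions
   such as normal_prob also take values on nonmeasurable sets *)
Definition standard_normal {R : realType} {d : measure_display}
    {T : measurableType d} {P : probability T R} (X : {RV P >-> R}) : Prop :=
  forall A : set R, measurable A -> distribution P X A = normal_prob 0 1 A.

Definition pos_pairs : set (nat * nat) :=
  [set ij | (1 <= ij.1)%N /\ (1 <= ij.2)%N].

Definition V2 {R : realType} {d : measure_display} {T : measurableType d}
    {P : probability T R} (b delta : R) (xi : nat * nat -> {RV P >-> R})
    (w : T) : \bar R :=
  ((pi ^- 4)%:E *
   \esum_(ij in pos_pairs)
     (((ij.1%:R + b) * (ij.2%:R + delta)) ^- 2 * xi ij w ^+ 2)%:E)%E.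

(* Main.v *)
Require Import Defs.
From mathcomp Require Import ring lra zify measurable_realfun.
Import Order.TTheory GRing.Theory Num.Theory.
Import numFieldNormedType.Exports.
Set Implicit Arguments.
Unset Strict Implicit.
Unset Printing Implicit Defensive.
Local Open Scope classical_set_scope.
Local Open Scope ring_scope.

(** Write [a_i = i + b], [c_j = j + delta] and let [V_N] be the sum that defines
    [V2], restricted to [1 <= i, j <= N]. The proof is a small ball estimate by
    Laplace transforms, followed by the inversion of an implicit equation.

    Laplace transform. By independence and the Gaussian formula
    [E exp (- c xi^2) = (1 + 2 c) ^ (-1/2)], the transform of [V_N] at
    [u = pi^4 x^2 / 2] is [exp (- G_N x / 2)] with
    [G_N x = \sum_(i, j <= N) ln (1 + (x / (a_i c_j))^2)] ([laplace_VN]).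

    Asymptotics of the exponent. For [N] large in terms of [x],
    [G_N x = pi x (ln x - Psi (1 + b) - Psi (1 + delta) - 1) + O (x^(3/4))]
    ([laplace_exponent_asymp]). Since [\int_0^oo ln (1 + v^-2) dv = pi], a full row
    [i] contributes about [pi x / a_i], but only rows with [a_i] up to order
    [sqrt x] may be summed in this way. The hyperbola method treats the first
    [n ~ sqrt x] rows and columns separately from the remaining corner. The
    truncated columns and the corner are sums of two functions whose primitives,
    which involve the inverse tangent integral [Ti2 v = \int_0^v atan t / t dt],
    add up to [pi ln v]; so they cancel up to an explicit logarithm, and the
    inversion formula [Ti2 v = Ti2 (1 / v) + (pi / 2) ln v] supplies the remaining
    constant. The two harmonic sums that are left produce [Psi], which
    is reached through the log-convexity of [Gamma] ([Psi_approx]).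

    Small balls. The exponential Markov inequality bounds [P (V2 < r)] from above,
    and an exponential change of measure that concentrates [V_N] just below [r]
    bounds it from below. With [x] chosen as the saddle point,
    [r = y / (2 pi^3 x)] and [y = ln x - Psi (1 + b) - Psi (1 + delta)], both give
    [8 pi^2 r |ln P (V2 < r)| = y (y - 2)] up to a power of [1 / x]
    ([small_ball]).

    Inversion. Put [l = |ln r|], [e = 1 / l] and [w = y / l]. Eliminating [x], the
    two relations say [w = 1 + e (s + ln w)] with [s = sbar], and the quantity of
    the theorem becomes [w^2 - 2 e w] up to an error smaller than every power of
    [e]. Differentiating in [e], a formal solution
    [W = 1 + e Q], [Q = s + ln W], satisfies [Q' W = W'], which is exactly the
    recursion of the polynomials [pis]: hence [W = \sum_m pis m e^m], and [p_coef m]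
    is the coefficient of [e^m] in [W^2 - 2 e W] ([Rpoly_coef]). As [s] grows
    like [ln l], the truncation error is controlled by [s e] rather than by [e]
    ([root_expansion]); the degree of [pis m] is at most [m - 1] for [m >= 2],
    which is why the error carries [(ln l)^k] and not [(ln l)^(k+1)]. *)

(** * The gamma function and its logarithmic derivative *)

Section calculus.
Context {R : realType}.
Implicit Types (f : R -> R).

Lemma derivable1_continuous f x : derivable f x 1 -> {for x, continuous f}.
Proof. by move=> ?; apply/differentiable_continuous/derivable1_diffP. Qed.

Lemma derivable_cc_LRcontinuous f a b :
  (forall x, a <= x <= b -> derivable f x 1) -> a <= b -> derivable_oo_LRcontinuous f a b.
Proof.
move=> df ab; split.
- by move=> x; rewrite in_itv/= => /andP[ax xb]; apply: df; rewrite !ltW.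
- by apply: cvg_at_right_filter; apply: derivable1_continuous; apply: df; rewrite lexx.
- by apply: cvg_at_left_filter; apply: derivable1_continuous; apply: df; rewrite lexx ab.
Qed.

End calculus.

Section gamma.
Context {R : realType}.
Implicit Types (x y t : R).
Local Notation mu := (@lebesgue_measure R).

Definition gammaf x t : R := t `^ (x - 1) * expR (- t).
(** The integral is taken in the extended reals, so that the functional equation
    can be proved first and finiteness deduced from it. *)
Definition egamma x : \bar R := (\int[mu]_(t in `]0%R, +oo[) (gammaf x t)%:E)%E.

Lemma gammaf_ge0 x t : 0 <= gammaf x t.
Proof. by rewrite mulr_ge0 ?powR_ge0 ?expR_ge0. Qed.

Lemma measurable_gammaf D x : measurable_fun D (gammaf x).
Proof.
apply: measurable_funTS; apply: measurable_funM; first exact: measurable_powR.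
by apply: measurableT_comp => //; exact: measurableT_comp.
Qed.

Lemma derivable_gammaf x t : 0 < t -> derivable (gammaf x) t 1.
Proof.
move=> t0; apply: derivableM.
  by apply: (@ex_derive _ _ _ _ _ _ _ (is_derive1_powR _ t0)).
apply: ex_derive.
Qed.

Lemma gamma_by_parts x a c : 0 < a -> a < c ->
  (\int[mu]_(t in `[a, c]) (gammaf (x + 1) t)%:E =
   (a `^ x * expR (- a) - c `^ x * expR (- c))%:E +
   \int[mu]_(t in `[a, c]) (x * gammaf x t)%:E)%E.
Proof.
move=> a0 ac.
have pos t : a <= t <= c -> 0 < t by move=> /andP[+ _]; exact: lt_le_trans.
have := @integration_by_parts R (fun t => t `^ x) (fun t => - expR (- t))
   (fun t => x * t `^ (x - 1)) (fun t => expR (- t)) a c ac.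
have -> : (\int[mu]_(t in `[a, c]) (t `^ x * expR (- t))%:E =
           \int[mu]_(t in `[a, c]) (gammaf (x + 1) t)%:E)%E.
  by apply: eq_integral => t _; rewrite /gammaf addrK.
have -> : (\int[mu]_(t in `[a, c]) (x * t `^ (x - 1) * - expR (- t))%:E =
   \int[mu]_(t in `[a, c]) (- (x * gammaf x t)%:E))%E.
  by apply: eq_integral => t _; rewrite /gammaf mulrN mulrA EFinN.
move=> ->.
- rewrite integralN/=; last first.
    rewrite fin_num_adde_defr//.
    have : (mu.-integrable `[a, c] (fun t => (x * gammaf x t)%:E)).
      apply: continuous_compact_integrable; first exact: segment_compact.
      apply: derivable_within_continuous => t; rewrite in_itv/= => /pos t0.
      by apply: derivableM => //; exact: derivable_gammaf.
    move=> /integrable_pos_fin_num; apply.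
    by [].
  by rewrite oppeK; congr (_%:E + _)%E; lra.
- apply: derivable_within_continuous => t; rewrite in_itv/= => /pos t0.
  by apply: derivableM => //; apply: (@ex_derive _ _ _ _ _ _ _ (is_derive1_powR _ t0)).
- apply: derivable_cc_LRcontinuous => [t /pos t0|]; last exact: ltW.
  by apply: (@ex_derive _ _ _ _ _ _ _ (is_derive1_powR _ t0)).
- move=> t; rewrite in_itv/= => /andP[at_ tc].
  have t0 : 0 < t by lra.
  by rewrite derive1E; apply: derive_val; exact: (is_derive1_powR _ t0).
- by apply: derivable_within_continuous => t _; exact: ex_derive.
- by apply: derivable_cc_LRcontinuous => [t _|]; [exact: ex_derive|exact: ltW].
- move=> t _; rewrite derive1E derive_val.
  by rewrite -[LHS]/(- (expR (- t) * -1)) mulrN1 opprK.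
Qed.

Lemma powR_expRN_bound x : 0 <= x ->
  exists2 C : R, 0 < C & forall c, 1 <= c -> c `^ x * expR (- c) <= C / c.
Proof.
move=> x0; pose m := Num.bound x.
have xm : x <= m%:R by apply/ltW/archi_boundP.
exists (m.+1`!%:R); first by rewrite ltr0n fact_gt0.
move=> c c1; have c0 : 0 < c by lra.
rewrite expRN ler_pdivrMr ?expR_gt0//.
have h1 : c `^ x <= c ^+ m by rewrite -powR_mulrn ?(ltW c0)// ler_powR.
apply: (le_trans h1).
have h2 := @expR_ge1Dxn R c m (ltW c0).
have F0 : 0 < (m.+1`!%:R : R) by rewrite ltr0n fact_gt0.
rewrite mulrAC ler_pdivlMr// -exprSr -ler_pdivrMl// mulrC.
by apply: le_trans h2; lra.
Qed.

(** Integration by parts on [[1/n, n]]: the boundary terms vanish in the limit,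
    and monotone convergence handles both integrals whether or not they are finite. *)
Lemma egammaS x : 0 < x -> egamma (x + 1) = (x%:E * egamma x)%E.
Proof.
move=> x0.
pose F n : set R := `[n.+2%:R^-1, n.+2%:R]%classic.
have FU : \bigcup_n F n = `]0, +oo[%classic :> set R.
  apply/seteqP; split => t /=.
    by move=> [n _]; rewrite /F /= !in_itv/= andbT => /andP[+ _]; apply: lt_le_trans.
  rewrite in_itv/= andbT => t0.
  pose n := maxn (Num.bound t) (Num.bound t^-1).
  exists n => //; rewrite /F /= in_itv/=; apply/andP; split.
    rewrite invf_ple ?posrE//.
    apply: (le_trans (ltW (archi_boundP _))); first by rewrite invr_ge0 ltW.
    by rewrite ler_nat (leq_trans (leq_maxr (Num.bound t) _))// leqW.
  apply: (le_trans (ltW (archi_boundP (ltW t0)))).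
  by rewrite ler_nat (leq_trans (leq_maxl _ (Num.bound t^-1)))// leqW.
have cvF y : (\int[mu]_(t in F n) (gammaf y t)%:E)%E @[n --> \oo] --> egamma y.
  rewrite /egamma -FU; apply: ge0_nondecreasing_set_cvg_integral.
  - move=> n m nm; rewrite subsetEset /F; apply: subset_itv; rewrite bnd_simp.
      by rewrite lef_pV2 ?posrE// ler_nat !ltnS.
    by rewrite ler_nat !ltnS.
  - by move=> n; exact: measurable_itv.
  - by move=> n; apply/measurable_EFinP; exact: measurable_gammaf.
  - by move=> n t _; rewrite lee_fin gammaf_ge0.
have b1 : (n.+2%:R^-1 : R) `^ x * expR (- n.+2%:R^-1) @[n --> \oo] --> (0 : R).
  apply: (@squeeze_cvgr _ _ _ _ (cst 0) (fun n => (n.+2%:R^-1 : R) `^ x)).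
  - near=> n; rewrite mulr_ge0 ?powR_ge0 ?expR_ge0//=.
    by rewrite ler_piMr ?powR_ge0// expR_le1 oppr_le0.
  - exact: cvg_cst.
  - have /cvg_at_rightP := powR_cvg0 x0; apply; split => [n|]; first by rewrite invr_gt0.
    by have := @cvg_harmonic R; rewrite -(cvg_shiftS _).
have b2 : (n.+2%:R : R) `^ x * expR (- n.+2%:R) @[n --> \oo] --> (0 : R).
  have [C C0 hC] := powR_expRN_bound (ltW x0).
  apply: (@squeeze_cvgr _ _ _ _ (cst 0) (fun n => C * n.+2%:R^-1)).
  - near=> n; rewrite mulr_ge0 ?powR_ge0 ?expR_ge0//=.
    by apply: hC; rewrite ler1n.
  - exact: cvg_cst.
  - rewrite -[X in _ --> X](mulr0 C); apply: cvgM; first exact: cvg_cst.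
    by have := @cvg_harmonic R; rewrite -(cvg_shiftS _).
have := cvF (x + 1).
have -> : (fun n => (\int[mu]_(t in F n) (gammaf (x + 1) t)%:E)%E) =
   (fun n => ((n.+2%:R^-1 `^ x * expR (- n.+2%:R^-1) - n.+2%:R `^ x * expR (- n.+2%:R))%:E +
     x%:E * \int[mu]_(t in F n) (gammaf x t)%:E)%E).
  apply/funext => n; rewrite gamma_by_parts//; last first.
    by rewrite (@le_lt_trans _ _ 1) ?invf_le1 ?ltr1n// ler1n.
  congr (_ + _)%E; rewrite -ge0_integralZl//=.
  - exact: measurable_itv.
  - by apply/measurable_EFinP; exact: measurable_gammaf.
  - by move=> t _; rewrite lee_fin gammaf_ge0.
  - by rewrite lee_fin ltW.
move=> h1.
have h2 : ((n.+2%:R^-1 `^ x * expR (- n.+2%:R^-1) - n.+2%:R `^ x * expR (- n.+2%:R))%:E +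
     x%:E * \int[mu]_(t in F n) (gammaf x t)%:E)%E @[n --> \oo] -->
     ((0 - 0)%:E + x%:E * egamma x)%E.
  apply: cvgeD.
  - by rewrite subr0 fin_num_adde_defr.
  - by apply: cvg_EFin; [near=> n|apply: cvgB].
  - by apply: cvgeZl.
have := cvg_unique _ h1 h2; rewrite subr0 add0e; apply.
exact: ereal_hausdorff.
Unshelve. all: by end_near. Qed.

Lemma egamma1 : egamma 1 = 1%E.
Proof.
rewrite /egamma integral_itv_obnd_cbnd; last first.
  by apply/measurable_EFinP; exact: measurable_gammaf.
under eq_integral do rewrite /gammaf subrr powRr0 mul1r.
have dE (t : R) : derivable (fun t : R => - expR (- t)) t 1 by exact: ex_derive.
rewrite (@ge0_continuous_FTC2y R _ (fun t => - expR (- t)) 0 0)//.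
- by rewrite oppr0 expR0 EFinN oppeK add0e.
- by apply: derivable_within_continuous => t _; exact: ex_derive.
- by rewrite -[X in _ --> X]oppr0; apply: cvgN; exact: cvgr_expR.
- by apply: cvg_at_right_filter; have := derivable1_continuous (dE 0).
- move=> t _; rewrite derive1E derive_val.
  by rewrite -[LHS]/(- (expR (- t) * -1)) mulrN1 opprK.
Unshelve. all: by end_near. Qed.

Lemma egamma_ge0 x : (0 <= egamma x)%E.
Proof. by apply: integral_ge0 => t _; rewrite lee_fin gammaf_ge0. Qed.

Lemma egamma_gt0 x : (0 < egamma x)%E.
Proof.
pose m := (2 `^ `|x - 1|)^-1 * expR (- 2) : R.
have m0 : 0 < m by rewrite mulr_gt0 ?expR_gt0// invr_gt0 powR_gt0.
have h0 : (0 < m%:E * mu (`[1%R, 2%R]%classic : set R))%E.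
  rewrite lebesgue_measure_itv/= lte_fin ltr1n -EFinB -EFinM lte_fin mulr_gt0//; lra.
apply: (lt_le_trans h0); rewrite -integral_cst//.
apply: (@le_trans _ _ (\int[mu]_(t in `[1%R, 2%R]) (gammaf x t)%:E)%E).
  apply: ge0_le_integral => //=.
  - by move=> t _; rewrite lee_fin ltW.
  - by apply/measurable_EFinP; exact: measurable_gammaf.
  - move=> t; rewrite in_itv/= => /andP[t1 t2]; rewrite lee_fin.
    apply: ler_pM; rewrite ?invr_ge0 ?powR_ge0 ?expR_ge0 ?ler_expR ?lerN2//.
    rewrite -powRN; apply: (@le_trans _ _ (t `^ (- `|x - 1|))).
      by rewrite !powRN lef_pV2 ?posrE ?powR_gt0//; [apply: ge0_ler_powR => //; rewrite nnegrE; lra|lra].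
    by apply: ler_powR => //; rewrite lerNl -normrN ler_norm.
apply: ge0_subset_integral => //=.
- by apply/measurable_EFinP; exact: measurable_gammaf.
- by move=> t _; rewrite lee_fin gammaf_ge0.
- by apply: subset_itv; rewrite bnd_simp.
Qed.

(** For [1 <= y <= 2] the integrand is at most the sum of the integrands at [1]
    and [2], whose integrals are [1]; the functional equation moves this interval
    to the left and to the right. *)
Lemma egamma_fin x : 0 < x -> (egamma x < +oo)%E.
Proof.
have base y : 1 <= y -> y <= 2 -> (egamma y < +oo)%E.
  move=> y1 y2.
  apply: (@le_lt_trans _ _ (egamma 1 + egamma (1 + 1))%E); last first.
    by rewrite egammaS// egamma1 mul1e -EFinD ltry.
  rewrite -ge0_integralD//=.
  - apply: ge0_le_integral => //=.
    + by move=> t _; rewrite lee_fin gammaf_ge0.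
    + by apply/measurable_EFinP; exact: measurable_gammaf.
    + apply/measurable_EFinP; apply: measurable_funD; exact: measurable_gammaf.
    + move=> t; rewrite in_itv/= andbT => t0; rewrite lee_fin /gammaf -mulrDl.
      rewrite ler_pM2r ?expR_gt0// subrr powRr0 addrK powRr1 ?(ltW t0)//.
      have [t1|t1] := leP 1 t.
        have : t `^ (y - 1) <= t `^ 1 by apply: ler_powR => //; lra.
        by rewrite powRr1 ?(ltW t0)//; lra.
      have : t `^ (y - 1) <= t `^ 0 by apply: ger_powR; [rewrite t0 ltW|lra].
      by rewrite powRr0; lra.
  - by move=> t _; rewrite lee_fin gammaf_ge0.
  - by apply/measurable_EFinP; exact: measurable_gammaf.
  - by move=> t _; rewrite lee_fin gammaf_ge0.
  - by apply/measurable_EFinP; exact: measurable_gammaf.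
have up n y : 0 < y -> y <= n.+1%:R -> (egamma y < +oo)%E.
  elim: n y => [|n IH] y y0 yn.
    have : (egamma (y + 1) < +oo)%E by apply: base; lra.
    rewrite egammaS//; case: (egamma y) (egamma_ge0 y) => //= [r _ _|_]; first by rewrite ltry.
    by rewrite gt0_muley ?lte_fin.
  have [yn1|yn1] := leP y n.+1%:R; first exact: IH.
  have y1 : 1 < y by apply: le_lt_trans yn1; rewrite ler1n.
  have -> : y = (y - 1) + 1 by lra.
  rewrite egammaS; last by lra.
  have : (egamma (y - 1) < +oo)%E.
    by apply: IH; [lra|move: yn; rewrite [n.+2%:R]mulrS; lra].
  case: (egamma (y - 1)) (egamma_ge0 (y - 1)) => [r _ _| |] //; first by rewrite -EFinM ltry.
move=> x0; apply: (up (Num.bound x)) => //.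
by apply: (le_trans (ltW (archi_boundP (ltW x0)))); rewrite ler_nat.
Qed.

Lemma egammaE x : 0 < x -> egamma x = (Gamma x)%:E.
Proof.
move=> x0; rewrite /Gamma /Rintegral -/(egamma x) fineK//.
by rewrite ge0_fin_numE ?egamma_fin ?egamma_ge0.
Qed.

Lemma Gamma_gt0 x : 0 < x -> 0 < Gamma x.
Proof. by move=> x0; have := egamma_gt0 x; rewrite egammaE// lte_fin. Qed.

Lemma GammaS x : 0 < x -> Gamma (x + 1) = x * Gamma x.
Proof.
move=> x0; apply: EFin_inj; rewrite EFinM -!egammaE ?egammaS//; lra.
Qed.

(** Tangent line at [c] of the concave function [t `^ h]. *)
Lemma powR_tangent t c h : 0 < t -> 0 < c -> 0 <= h <= 1 ->
  t `^ h <= (1 - h) * c `^ h + h * c `^ (h - 1) * t.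
Proof.
move=> t0 c0 /andP[h0 h1].
have {1}-> : t = c * (t / c) by field; lra.
have tc0 : 0 < t / c by rewrite divr_gt0.
rewrite powRM ?(ltW c0) ?(ltW tc0)//.
have -> : c `^ (h - 1) = c `^ h / c.
  by rewrite powRB ?powRr1 ?(ltW c0)//; apply/implyP => _; rewrite gt_eqF.
have -> : (1 - h) * c `^ h + h * (c `^ h / c) * t = c `^ h * (1 - h + h * (t / c)) by lra.
rewrite ler_pM2l ?powR_gt0//.
have u0 : t / c != 0 by rewrite gt_eqF.
rewrite /powR (negbTE u0).
have hh : (0 <= h)%R && (h <= 1)%R by rewrite h0 h1.
have := @convex_expR R (Itv01 h0 h1) (ln (t / c)) 0.
rewrite !convRE /= expR0 mulr0 addr0 mulr1 lnK ?posrE//.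
by rewrite /unstable.onem; lra.
Qed.

(** Wendel's inequality, an instance of the log-convexity of [Gamma]: integrate the
    tangent bound for [t `^ h] against [t `^ (y - 1) exp (- t)]. The tangent is taken at
    [y] because that is the mean of [t] under this weight. *)
Lemma Gamma_wendel y h : 0 < y -> 0 <= h <= 1 -> Gamma (y + h) <= y `^ h * Gamma y.
Proof.
move=> y0 /[dup] hh /andP[h0 h1].
have mg z : measurable_fun (`]0, +oo[%classic : set R) (fun t : R => (gammaf z t)%:E).
  by apply/measurable_EFinP; exact: measurable_gammaf.
have c1 : 0 <= (1 - h) * y `^ h by rewrite mulr_ge0 ?powR_ge0//; lra.
have c2 : 0 <= h * y `^ (h - 1) by rewrite mulr_ge0 ?powR_ge0.
have : (egamma (y + h) <= ((1 - h) * y `^ h)%:E * egamma y + (h * y `^ (h - 1))%:E * egamma (y + 1))%E.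
  rewrite /egamma -!ge0_integralZl//=; try (by move=> t _; rewrite lee_fin gammaf_ge0).
  rewrite -ge0_integralD//=.
  - apply: ge0_le_integral => //=.
    + by move=> t _; rewrite lee_fin gammaf_ge0.
    + exact: mg.
    + by apply: emeasurable_funD; apply: emeasurable_funM => //; exact: mg.
    + move=> t; rewrite in_itv/= andbT => t0; rewrite -!EFinM -EFinD lee_fin /gammaf.
      rewrite !mulrA -mulrDl ler_pM2r ?expR_gt0//.
      have -> : y + h - 1 = (y - 1) + h by lra.
      have -> : y + 1 - 1 = (y - 1) + 1 by lra.
      have tD u v : t `^ (u + v) = t `^ u * t `^ v by rewrite powRD//; apply/implyP => _; rewrite gt_eqF.
      rewrite (tD _ h) (tD _ 1).
      rewrite powRr1 ?(ltW t0)//.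
      have := powR_tangent t0 y0 hh.
      have : 0 < t `^ (y - 1) by rewrite powR_gt0.
      set a := t `^ (y - 1); set p := t `^ h; set q := y `^ h; set r := y `^ (h - 1).
      by move=> a0 H; have := ler_wpM2l (ltW a0) H; lra.
  - by move=> t _; rewrite -EFinM lee_fin mulr_ge0 ?gammaf_ge0.
  - by apply: emeasurable_funM => //; exact: mg.
  - by move=> t _; rewrite -EFinM lee_fin mulr_ge0 ?gammaf_ge0.
  - by apply: emeasurable_funM => //; exact: mg.
  - exact: mg.
  - exact: mg.
rewrite !egammaE; try lra.
rewrite -!EFinM -EFinD lee_fin GammaS// => /le_trans; apply.
have -> : y `^ (h - 1) = y `^ h / y.
  by rewrite powRB ?powRr1 ?(ltW y0)//; apply/implyP => _; rewrite gt_eqF.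
rewrite le_eqVlt; apply/orP; left; apply/eqP; field; lra.
Qed.

Definition lnGamma x : R := ln (Gamma x).

Lemma lnGammaE x : lnGamma x = ln (Gamma x). Proof. by []. Qed.

Lemma lnGammaK x : 0 < x -> expR (lnGamma x) = Gamma x.
Proof. by move=> x0; apply: lnK; rewrite posrE; exact: Gamma_gt0. Qed.

Lemma lnGammaS x : 0 < x -> lnGamma (x + 1) = ln x + lnGamma x.
Proof. by move=> x0; rewrite !lnGammaE GammaS// lnM// posrE// Gamma_gt0. Qed.

Lemma ln_leD1 x h : 0 < x -> - x < h -> ln (x + h) <= ln x + h / x.
Proof.
move=> x0 hx.
have -> : x + h = x * (1 + h / x) by field; lra.
have h1 : -1 < h / x by rewrite ltr_pdivlMr//; lra.
by rewrite lnM ?posrE//; [rewrite lerD2l le_ln1Dx|lra].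
Qed.

Lemma lnGamma_le y h : 0 < y -> 0 <= h <= 1 -> lnGamma (y + h) - lnGamma y <= h * ln y.
Proof.
move=> y0 hh; have /andP[h0 h1] := hh.
have G0 := Gamma_gt0 y0; have yh0 : 0 < y + h by lra.
have G1 := Gamma_gt0 yh0.
have P0 : 0 < y `^ h by exact: powR_gt0.
have := Gamma_wendel y0 hh.
have P1 : 0 < y `^ h * Gamma y by exact: mulr_gt0.
rewrite -posrE in G0; rewrite -posrE in G1; rewrite -posrE in P0; rewrite -posrE in P1.
rewrite -(ler_ln G1 P1) (lnM P0 G0) ln_powR -!lnGammaE.
by rewrite lerBlDr.
Qed.

(** The upper bound applied to the step from [y + h] to [y + 1]. *)
Lemma lnGamma_ge y h : 0 < y -> 0 <= h <= 1 ->
  h * ln y - h / y <= lnGamma (y + h) - lnGamma y.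
Proof.
move=> y0 hh; have /andP[h0 h1] := hh.
have yh0 : 0 < y + h by lra.
have hy' : - y < h by lra.
have h'01 : 0 <= 1 - h <= 1 by apply/andP; split; lra.
have := lnGamma_le yh0 h'01.
have -> : y + h + (1 - h) = y + 1 by lra.
rewrite lnGammaS// => H.
have hy : 0 <= h / y by rewrite divr_ge0// ltW.
have := ler_wpM2l (_ : 0 <= 1 - h) (ln_leD1 y0 hy'); rewrite subr_ge0 => /(_ h1).
have : 0 <= h * (h / y) by rewrite mulr_ge0.
move: H; move: (lnGamma (y + h)) (lnGamma y) (ln (y + h)) (ln y) => ? ? ? ?; lra.
Qed.

(** For a shift of either sign, [lnGamma] moves like [h ln y] up to [O (h / y)];
    a negative shift is a positive one from the point [y + h >= y / 2]. *)
Lemma lnGamma_diff y h : 0 < y -> `|h| <= 1 -> `|h| <= y / 2 ->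
  `|lnGamma (y + h) - lnGamma y - h * ln y| <= `|h| * (4 / y).
Proof.
move=> y0; have iy0 : 0 < y^-1 by rewrite invr_gt0.
have [h0|h0] := leP 0 h.
  rewrite ger0_norm// => h1 h2.
  have := lnGamma_le y0 (_ : 0 <= h <= 1); rewrite h0 h1 => /(_ isT) A.
  have := lnGamma_ge y0 (_ : 0 <= h <= 1); rewrite h0 h1 => /(_ isT) B.
  move: A B; move: (lnGamma (y + h)) (lnGamma y) (ln y) => ? ? ? A B.
  by rewrite ler_norml; apply/andP; split; nra.
rewrite ltr0_norm// => h1 h2.
have [z zE] : exists z, z = y + h by exists (y + h).
have z0 : 0 < z by rewrite zE; lra.
have zh : - z < - h by rewrite zE; lra.
have zy : z <= y by rewrite zE; lra.
have E : z^-1 <= 2 / y.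
  rewrite -[2]invrK -invfM lef_pV2 ?posrE//; [rewrite zE; lra|apply: mulr_gt0; lra].
have hh : 0 <= - h <= 1 by rewrite h1; lra.
have D : ln z <= ln y by rewrite ler_ln ?posrE.
have A := lnGamma_le z0 hh.
have B := lnGamma_ge z0 hh.
have C := ln_leD1 z0 zh.
have iz0 : 0 < z^-1 by rewrite invr_gt0.
move: A B C D; have -> : z + - h = y by rewrite zE addrK.
rewrite -zE {zE zh hh zy}.
move: (lnGamma y) (lnGamma z) (ln z) (ln y) (z^-1) (y^-1) iz0 iy0 E.
move=> gy gz lz ly iz iy iz0 iy0 E A B C D.
rewrite ler_norml; apply/andP; split; nra.
Qed.

Lemma ln_diff (a h : R) : 0 < a -> `|h| <= a / 2 ->
  `|ln (a + h) - ln a - h / a| <= h ^+ 2 * (2 / a ^+ 2).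
Proof.
move=> a0; rewrite ler_norml => /andP[h1 h2].
have ah0 : 0 < a + h by lra.
have ha : - a < h by lra.
have A := ln_leD1 a0 ha.
have ha' : - (a + h) < - h by lra.
have B := ln_leD1 ah0 ha'.
move: B; rewrite addrK => B.
have C : h / a - h / (a + h) <= h ^+ 2 * (2 / a ^+ 2).
  have -> : h / a - h / (a + h) = h ^+ 2 * (1 / (a * (a + h))) by field; lra.
  apply: ler_wpM2l; first exact: sqr_ge0.
  rewrite ler_pdivrMr ?mulr_gt0// mulrAC ler_pdivlMr ?exprn_gt0//; nra.
have D : 0 <= h ^+ 2 * (2 / a ^+ 2) by rewrite mulr_ge0 ?sqr_ge0// divr_ge0// sqr_ge0.
by rewrite ler_norml; apply/andP; split; lra.
Qed.

Lemma lnGammaD x n : 0 < x ->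
  lnGamma (x + n%:R) = lnGamma x + \sum_(0 <= i < n) ln (x + i%:R).
Proof.
move=> x0; elim: n => [|n IH]; first by rewrite big_geq// !addr0.
have xn0 : 0 < x + n%:R by rewrite ltr_pwDl.
rewrite big_nat_recr//= -natr1 addrA lnGammaS// IH; ring.
Qed.

Lemma sum_inv_sqr_le x n : 0 < x ->
  \sum_(0 <= i < n) (x + i%:R) ^- 2 <= x ^- 2 + x^-1.
Proof.
move=> x0.
have H : \sum_(0 <= i < n.+1) (x + i%:R) ^- 2 <= x ^- 2 + x^-1 - (x + n%:R)^-1.
  elim: n => [|n IH]; first by rewrite big_nat1 addr0 addrK.
  rewrite big_nat_recr//=.
  have xn0 : 0 < x + n%:R by rewrite ltr_pwDl.
  have -> : x + n.+1%:R = x + n%:R + 1 by rewrite -natr1 addrA.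
  move: IH; move: (\sum_(0 <= i < n.+1) _) (x + n%:R) xn0 => S a a0 IH.
  apply: (le_trans (lerD IH (lexx _))).
  have : (a + 1) ^- 2 <= a^-1 - (a + 1)^-1.
    have -> : a^-1 - (a + 1)^-1 = (a * (a + 1))^-1 by field; lra.
    rewrite lef_pV2 ?posrE ?exprn_gt0 ?mulr_gt0//; nra.
  lra.
apply: (@le_trans _ _ (\sum_(0 <= i < n.+1) (x + i%:R) ^- 2)).
  by rewrite big_nat_recr//= lerDl invr_ge0 sqr_ge0.
apply: (le_trans H); rewrite lerBlDr lerDl invr_ge0 addr_ge0 ?(ltW x0)//.
Qed.

(** The partial expressions of Gauss's limit formula for [Psi x]. *)
Definition digamma_seq x n : R := ln (x + n%:R) - \sum_(0 <= i < n) (x + i%:R)^-1.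

(** The functional equation moves the increment at [x] to [x + n], where
    [lnGamma_diff] is precise; the logarithms collected on the way are linearised
    with a quadratic remainder. *)
Lemma lnGamma_quotient x h n : 0 < x -> `|h| <= 1 -> `|h| <= x / 2 ->
  `|lnGamma (x + h) - lnGamma x - h * digamma_seq x n| <=
  `|h| * (4 / (x + n%:R)) + h ^+ 2 * (2 * (x ^- 2 + x^-1)).
Proof.
move=> x0 h1 h2.
have xh0 : 0 < x + h by move: h2; rewrite ler_norml => /andP[]; lra.
have xn0 : 0 < x + n%:R by rewrite ltr_pwDl.
have xnx : x <= x + n%:R by rewrite lerDl.
have A : `|lnGamma (x + n%:R + h) - lnGamma (x + n%:R) - h * ln (x + n%:R)| <= `|h| * (4 / (x + n%:R)).
  by apply: lnGamma_diff => //; lra.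
have eqD : lnGamma (x + h) - lnGamma x - h * digamma_seq x n =
  (lnGamma (x + n%:R + h) - lnGamma (x + n%:R) - h * ln (x + n%:R)) -
  \sum_(0 <= i < n) (ln (x + i%:R + h) - ln (x + i%:R) - h / (x + i%:R)).
  have -> : x + n%:R + h = x + h + n%:R by ring.
  rewrite !lnGammaD// /digamma_seq !sumrB mulrBr mulr_sumr.
  have -> : \sum_(0 <= i < n) ln (x + h + i%:R) = \sum_(0 <= i < n) ln (x + i%:R + h).
    by apply: eq_bigr => i _; rewrite addrAC.
  do 3 (move: (\sum_(0 <= i < n) _) => ?).
  move: (lnGamma (x + h)) (lnGamma x) (ln _) => ? ? ?; ring.
rewrite eqD; apply: (le_trans (ler_normB _ _)); apply: lerD => //.
apply: (le_trans (ler_norm_sum _ _ _)).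
apply: (@le_trans _ _ (\sum_(0 <= i < n) h ^+ 2 * (2 * (x + i%:R) ^- 2))).
  apply: ler_sum => i _; apply: ln_diff; first by rewrite ltr_pwDl.
  by apply: (le_trans h2); rewrite ler_pM2r// lerDl.
rewrite -!mulr_sumr ler_wpM2l ?sqr_ge0// ler_wpM2l//.
exact: sum_inv_sqr_le.
Qed.

(** By [lnGamma_quotient], any two terms of [digamma_seq] approximate the same
    difference quotient of [lnGamma], so letting the increment tend to [0] they
    differ by at most the sum of their error bounds. The common limit then
    satisfies the quotient estimate without the term in [n]. *)
Lemma digamma_lim x : 0 < x -> exists l : R,
  (forall n, `|l - digamma_seq x n| <= 4 / (x + n%:R)) /\
  (forall h, `|h| <= 1 -> `|h| <= x / 2 ->
   `|lnGamma (x + h) - lnGamma x - h * l| <= h ^+ 2 * (2 * (x ^- 2 + x^-1))).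
Proof.
move=> x0.
pose K := 2 * (x ^- 2 + x^-1).
have K0 : 0 < K by rewrite mulr_gt0// addr_gt0// invr_gt0// exprn_gt0.
have en n : 0 < 4 / (x + n%:R) by rewrite divr_gt0// ltr_pwDl.
have cauchy n m : digamma_seq x n - 4 / (x + n%:R) <= digamma_seq x m + 4 / (x + m%:R).
  apply/ler_addgt0Pr => e e0.
  (* the quadratic remainder at this increment is at most [h * (e / 2)] *)
  pose h := Num.min (Num.min 1 (x / 2)) (e / (2 * K)).
  have h0 : 0 < h by rewrite !lt_min ltr01 !divr_gt0// mulr_gt0.
  have h1 : `|h| <= 1 by rewrite gtr0_norm// !ge_min lexx.
  have h2 : `|h| <= x / 2 by rewrite gtr0_norm// !ge_min lexx orbT.
  have h3 : h * (2 * K) <= e.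
    rewrite -ler_pdivlMr; first by rewrite /h ge_min lexx orbT.
    by rewrite mulr_gt0.
  have := lnGamma_quotient n x0 h1 h2; have := lnGamma_quotient m x0 h1 h2.
  rewrite (gtr0_norm h0) -/K !ler_norml => /andP[_ b'] /andP[a _].
  move: (lnGamma _ - _) (digamma_seq x n) (digamma_seq x m) (4 / (x + n%:R)) (4 / (x + m%:R)) a b' => q dn dm an am a b'.
  clearbody h K.
  have h4 := ler_wpM2l (ltW h0) h3.
  rewrite -(ler_pM2l h0); lra.
pose S := [set digamma_seq x n - 4 / (x + n%:R) | n in setT].
have Sub m : ubound S (digamma_seq x m + 4 / (x + m%:R)) by move=> _ [n _ <-].
have S0 : S !=set0 by exists (digamma_seq x 0 - 4 / (x + 0%:R)); exists 0%N.
have hl n : `|sup S - digamma_seq x n| <= 4 / (x + n%:R).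
  have u1 : sup S <= digamma_seq x n + 4 / (x + n%:R) by apply: ge_sup.
  have u2 : digamma_seq x n - 4 / (x + n%:R) <= sup S.
    by apply: ub_le_sup; [exists (digamma_seq x 0 + 4 / (x + 0%:R))|exists n].
  by rewrite ler_norml; apply/andP; split; lra.
exists (sup S); split => // h h1 h2.
apply/ler_addgt0Pr => e e0.
pose n := Num.bound (8 * `|h| / e).
have nb : 8 * `|h| / e < n%:R.
  by apply: archi_boundP; rewrite divr_ge0 ?(ltW e0)// mulr_ge0.
have hn : `|h| * (8 / (x + n%:R)) <= e.
  have xn0 : 0 < x + n%:R by rewrite ltr_pwDl.
  rewrite mulrA ler_pdivrMr// mulrC.
  move: nb; rewrite ltr_pdivrMr// => nb.
  apply: (le_trans (ltW nb)); rewrite mulrC ler_pM2l// lerDr ltW//.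
have := lnGamma_quotient n x0 h1 h2; have := hl n; rewrite -/K.
move: (lnGamma _ - _) (digamma_seq x n) (sup S) => q dn l A B.
have -> : q - h * l = (q - h * dn) - h * (l - dn) by ring.
apply: (le_trans (ler_normB _ _)); rewrite normrM.
have := ler_wpM2l (normr_ge0 h) A.
move: hn; have -> : 8 / (x + n%:R) = 4 / (x + n%:R) + 4 / (x + n%:R) by rewrite -mulrDl; congr (_ / _); ring.
move: (4 / _) B => d; rewrite mulrDr; lra.
Qed.

Lemma is_derive_lnGamma x l K : 0 < x ->
  (forall h, `|h| <= 1 -> `|h| <= x / 2 ->
   `|lnGamma (x + h) - lnGamma x - h * l| <= h ^+ 2 * K) ->
  is_derive x 1 lnGamma l.
Proof.
move=> x0 H.
suff cv : h^-1 *: (lnGamma (h *: 1 + x) - lnGamma x) @[h --> 0^'] --> l.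
  apply: DeriveDef; first by apply/cvg_ex; exists l.
  by apply/cvg_lim.
apply/cvgrPdist_le => e e0.
have K0 : 0 < 1 + `|K| by rewrite ltr_pwDl.
have eK : 0 < e / (1 + `|K|) by rewrite divr_gt0.
have x20 : 0 < x / 2 by rewrite divr_gt0.
near=> h.
have h0 : h != 0 by near: h; exact: nbhs_dnbhs_neq.
have h1 : `|h| <= 1 by near: h; apply: dnbhs0_le.
have h2 : `|h| <= x / 2 by near: h; apply: dnbhs0_le.
have h3 : `|h| <= e / (1 + `|K|) by near: h; apply: dnbhs0_le.
rewrite [h *: 1]mulr1 [h + x]addrC distrC.
have HH := H h h1 h2.
have hn0 : 0 < `|h| by rewrite normr_gt0.
have -> : h^-1 *: (lnGamma (x + h) - lnGamma x) - l =
   h^-1 * (lnGamma (x + h) - lnGamma x - h * l).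
  by rewrite mulrBr mulKf.
rewrite normrM normfV mulrC ler_pdivrMr//; apply: (le_trans HH).
move: h3; rewrite ler_pdivlMr// => h3.
rewrite -real_normK ?num_real// expr2 -mulrA mulrC ler_pM2r//.
apply: (le_trans _ h3); rewrite ler_pM2l//.
by rewrite (le_trans (ler_norm _))// lerDr.
Unshelve. all: by end_near. Qed.

(** [Psi] is the derivative of [lnGamma], because [Gamma] is locally
    [expR \o lnGamma]; that derivative is the limit of [digamma_seq]. *)
Lemma Psi_approx x n : 0 < x -> `|Psi x - digamma_seq x n| <= 4 / (x + n%:R).
Proof.
move=> x0; have [l [hl dl]] := digamma_lim x0.
suff -> : Psi x = l by [].
have dlnG := is_derive_lnGamma x0 dl.
have dG : is_derive x 1 (fun y : R => expR (lnGamma y)) (Gamma x * l).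
  rewrite -(lnGammaK x0); exact: is_derive1_comp (is_derive_expR _) dlnG.
rewrite /Psi derive1E.
rewrite -(@near_eq_derive _ _ _ (fun y : R => expR (lnGamma y)) Gamma).
  by rewrite derive_val mulrC mulrA mulVf ?mul1r// gt_eqF// Gamma_gt0.
near=> y; apply: lnGammaK; near: y; exact: lt_nbhsr.
Unshelve. all: by end_near. Qed.
End gamma.

(** * Transfer of integrals from indicators to nonnegative functions *)

Section transfer.
Context {R : realType}.
Import HBNNSimple.

(** The values of a simple function are combined by finite additivity; the weight
    [Z] is carried along. *)
Lemma integral_mul_nnsfun_comp d (T : measurableType d) (m : {measure set T -> \bar R})
    (Z : T -> R) (X : T -> R) (g : {nnsfun R >-> R}) :
  measurable_fun setT Z -> measurable_fun setT X -> (forall w, 0 <= Z w) ->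
  (\int[m]_w (Z w * g (X w))%:E =
   \sum_(r \in range g) r%:E * \int[m]_w (Z w * \1_(g @^-1` [set r]) (X w))%:E)%E.
Proof.
move=> mZ mX Z0.
have mI r : measurable_fun setT (fun w => Z w * \1_(g @^-1` [set r]) (X w)).
  apply: measurable_funM => //.
  have mg : measurable_fun setT (\1_(g @^-1` [set r]) : R -> R) by exact: measurable_indic.
  exact: (measurableT_comp mg mX).
have pt w : (Z w * g (X w))%:E =
   (\sum_(r \in range g) (r * (Z w * \1_(g @^-1` [set r]) (X w)))%:E)%E.
  rewrite fimfunE mulr_fsumr fsumEFin//; congr (_%:E); apply: eq_fsbigr => r _.
  by rewrite mulrCA.
under eq_integral do rewrite pt.
rewrite ge0_integral_fsum//; last 2 first.
- by move=> r; apply/measurable_EFinP; apply: measurable_funM.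
- move=> r w _; rewrite lee_fin indicE; have [|_] := boolP (_ \in _).
    by rewrite inE/= => <-; rewrite mulr_ge0// mulr_ge0.
  by rewrite !mulr0.
apply: eq_fsbigr => r /[!inE] rg.
under eq_integral do rewrite EFinM.
rewrite ge0_integralZl//.
- by apply/measurable_EFinP.
- by move=> w _; rewrite lee_fin mulr_ge0.
- move: rg => -[x _ <-]; rewrite lee_fin//.
Qed.

(** Two weighted laws on the line that agree on Borel sets agree on nonnegative
    functions, by monotone approximation with simple functions. Applied to a
    single factor it extends independence, and applied to a random variable and
    its density it computes an expectation. *)
Lemma integral_transfer d1 d2 (T1 : measurableType d1) (T2 : measurableType d2)
    (m1 : {measure set T1 -> \bar R}) (m2 : {measure set T2 -> \bar R})
    (Z1 : T1 -> R) (Z2 : T2 -> R) (X1 : T1 -> R) (X2 : T2 -> R) (f : R -> R) :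
  measurable_fun setT Z1 -> measurable_fun setT X1 -> (forall w, 0 <= Z1 w) ->
  measurable_fun setT Z2 -> measurable_fun setT X2 -> (forall w, 0 <= Z2 w) ->
  (forall B : set R, measurable B ->
    (\int[m1]_w (Z1 w * \1_B (X1 w))%:E = \int[m2]_w (Z2 w * \1_B (X2 w))%:E)%E) ->
  measurable_fun setT f -> (forall x, 0 <= f x) ->
  (\int[m1]_w (Z1 w * f (X1 w))%:E = \int[m2]_w (Z2 w * f (X2 w))%:E)%E.
Proof.
move=> mZ1 mX1 Z10 mZ2 mX2 Z20 H mf f0.
have mEf : measurable_fun setT (EFin \o f) by exact/measurable_EFinP.
pose f_ := nnsfun_approx measurableT mEf.
have lim d (T : measurableType d) (m : {measure set T -> \bar R}) (Z X : T -> R) :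
  measurable_fun setT Z -> measurable_fun setT X -> (forall w, 0 <= Z w) ->
  (\int[m]_w (Z w * f (X w))%:E =
    limn (fun n => \int[m]_w (Z w * f_ n (X w))%:E))%E.
  move=> mZ mX Z0; rewrite -monotone_convergence//.
  - apply: eq_integral => w _; apply/esym/cvg_lim => //.
    under eq_fun do rewrite EFinM.
    rewrite EFinM; apply: cvgeZl => //.
    by apply: (cvg_nnsfun_approx measurableT mEf) => //= x _; rewrite lee_fin.
  - move=> n; apply/measurable_EFinP; apply: measurable_funM => //.
    by apply: measurableT_comp.
  - by move=> n w _; rewrite lee_fin mulr_ge0.
  - move=> w _ a b ab; rewrite lee_fin ler_wpM2l//.
    by have /lefP := nd_nnsfun_approx measurableT mEf ab; apply.
rewrite lim// [RHS]lim//; congr (limn _); apply/funext => n.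
rewrite !integral_mul_nnsfun_comp//; apply: eq_fsbigr => r _.
by rewrite H.
Qed.

End transfer.

(** * Expectation of a product of independent factors *)

Lemma measurable_RV_preimage {R : realType} d (T : measurableType d)
    (P : probability T R) (X : {RV P >-> R}) (B : set R) :
  measurable B -> measurable (X @^-1` B).
Proof. by move=> mB; rewrite -[_ @^-1` _]setTI; exact: measurable_funP. Qed.

Section indep.
Context {R : realType} d (T : measurableType d) (P : probability T R).
Context (I : choiceType) (D : set I) (xi : I -> {RV P >-> R}).
Hypothesis indep : mutually_independent D xi.

Lemma prod_indicE (s : seq I) (B : I -> set R) w :
  \prod_(i <- s) (\1_(B i) (xi i w) : R) =
  \1_(\bigcap_(i in [set` s]) (xi i @^-1` B i)) w.
Proof.
elim: s => [|i s IH].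
  by rewrite big_nil indicE mem_set// => i /=; rewrite in_nil.
rewrite big_cons IH !indicE -natrM mulnb; congr (nat_of_bool _)%:R.
apply/idP/idP.
  move=> /andP[]; rewrite !inE/= => Bi Bs; move=> j /=.
  by rewrite in_cons => /orP[/eqP ->//|]; apply: Bs.
rewrite inE/= => H; apply/andP; split; rewrite inE/=.
  by apply: H; rewrite /= mem_head.
by move=> j js; apply: H; rewrite /= in_cons (js : j \in s) orbT.
Qed.

Lemma probability_bigcap_seq (s : seq I) (B : I -> set R) :
  uniq s -> (forall i, i \in s -> D i) -> (forall i, measurable (B i)) ->
  P (\bigcap_(i in [set` s]) (xi i @^-1` B i)) =
  (\prod_(i <- s) P (xi i @^-1` B i))%E.
Proof.
move=> us sD mB.
have eqs : [set` [fset i in s]%fset] = [set` s].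
  by apply/seteqP; split => i /=; rewrite in_fset.
rewrite -eqs indep//; last by rewrite eqs => i; apply: sD.
apply: perm_big; apply: uniq_perm => // i.
by rewrite in_fset.
Qed.

Lemma measurable_prod_comp (s : seq I) (f : I -> R -> R) :
  (forall i, measurable_fun setT (f i)) ->
  measurable_fun setT (fun w => \prod_(i <- s) f i (xi i w)).
Proof.
move=> mf; elim: s => [|i s IH].
  by under eq_fun do rewrite big_nil; exact: measurable_cst.
under eq_fun do rewrite big_cons.
apply: measurable_funM => //.
by apply: measurableT_comp.
Qed.

(** Independence only speaks of indicators. The functions [f i] are introduced one
    at a time: the induction hypothesis, with [i] in the list of indicators,
    says that the law of [xi i] weighted by the other factors is a multiple of
    the law of [xi i], and [integral_transfer] replaces the indicator by [f i]. *)
Lemma indep_integral_indic (f : I -> R -> R) (e : I -> R) (s1 s2 : seq I) (B : I -> set R) :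
  (forall i, measurable_fun setT (f i)) -> (forall i x, 0 <= f i x) ->
  (forall i, i \in s1 -> (\int[P]_w (f i (xi i w))%:E = (e i)%:E)%E) ->
  uniq (s1 ++ s2) -> (forall i, i \in s1 ++ s2 -> D i) -> (forall i, measurable (B i)) ->
  (\int[P]_w (\prod_(i <- s1) f i (xi i w) * \prod_(i <- s2) \1_(B i) (xi i w))%:E =
   (\prod_(i <- s1) e i * \prod_(i <- s2) fine (P (xi i @^-1` B i)))%:E)%E.
Proof.
move=> mf f0; elim: s1 s2 B => [|i s1 IH] s2 B fe us sD mB.
  under eq_integral do rewrite big_nil mul1r prod_indicE.
  rewrite integral_indic//; last first.
    apply: fin_bigcap_measurable => // i _.
    exact: measurable_RV_preimage.
  rewrite setIT big_nil mul1r.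
  transitivity (\prod_(i <- s2) P (xi i @^-1` B i))%E.
    exact: probability_bigcap_seq.
  rewrite -prodEFin; apply: eq_bigr => i _; rewrite fineK//.
  by apply: fin_num_measure; exact: measurable_RV_preimage.
have e0 j : j \in i :: s1 -> 0 <= e j.
  by move=> js; rewrite -lee_fin -fe//; apply: integral_ge0 => w _; rewrite lee_fin.
move: us; rewrite /= mem_cat negb_or -andbA => /and3P[is1 is2 us].
pose p j := fine (P (xi j @^-1` B j)).
have p0 j : 0 <= p j by apply: fine_ge0; exact: measure_ge0.
pose c := \prod_(i <- s1) e i * \prod_(i <- s2) p i.
have c0 : 0 <= c.
  rewrite mulr_ge0//; last by apply: prodr_ge0.
  by rewrite big_seq; apply: prodr_ge0 => j js; apply: e0; rewrite in_cons js orbT.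
pose Z w := \prod_(i <- s1) f i (xi i w) * \prod_(i <- s2) \1_(B i) (xi i w).
have mZ : measurable_fun setT Z.
  apply: measurable_funM; first exact: measurable_prod_comp.
  by apply: (@measurable_prod_comp s2 (fun i => \1_(B i))) => j; exact: measurable_indic.
have Z0 w : 0 <= Z w.
  rewrite mulr_ge0//; first by apply: prodr_ge0.
  by apply: prodr_ge0.
transitivity (\int[P]_w (Z w * f i (xi i w))%:E)%E.
  by apply: eq_integral => w _; rewrite big_cons /Z; congr (_%:E); ring.
rewrite (@integral_transfer R _ _ _ _ P P Z (cst c) (xi i) (xi i) (f i))//.
- transitivity (\int[P]_w (c%:E * (f i (xi i w))%:E))%E; first by apply: eq_integral.
  rewrite ge0_integralZl//.
  + rewrite fe ?mem_head// -EFinM big_cons; congr (_%:E); rewrite /c; ring.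
  + by apply/measurable_EFinP; apply: measurableT_comp.
  + by move=> w _; rewrite lee_fin.
- move=> B0 mB0.
  (* [i] is not in [s2], so its set can be prescribed independently *)
  pose B' j := if j == i then B0 else B j.
  have B's2 j : j \in s2 -> B' j = B j.
    by rewrite /B'; case: eqP => // -> is2'; rewrite is2' in is2.
  have B'i : B' i = B0 by rewrite /B' eqxx.
  have := IH (i :: s2) B'.
  have -> : (\int[P]_w (\prod_(i0 <- s1) f i0 (xi i0 w) *
     (\prod_(i0 <- i :: s2) \1_(B' i0) (xi i0 w)))%:E = \int[P]_w (Z w * \1_B0 (xi i w))%:E)%E.
    apply: eq_integral => w _; rewrite big_cons B'i /Z; congr (_%:E).
    rewrite [X in _ * (_ * X)](_ : _ = \prod_(i <- s2) \1_(B i) (xi i w)).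
      ring.
    by apply: eq_big_seq => j js; rewrite B's2.
  move=> -> //.
  + transitivity (\int[P]_w (c%:E * (\1_B0 (xi i w))%:E))%E; last by apply: eq_integral.
    rewrite ge0_integralZl//.
    * have -> : (\int[P]_w (\1_B0 (xi i w))%:E = P (xi i @^-1` B0))%E.
        rewrite -[X in P X]setIT -integral_indic//.
        exact: measurable_RV_preimage.
      rewrite -[P _]fineK ?fin_num_measure// -?EFinM ?big_cons.
        rewrite B'i /c; congr (_%:E).
        have -> : \prod_(j <- s2) fine (P (xi j @^-1` B' j)) = \prod_(j <- s2) p j.
          by apply: eq_big_seq => j js; rewrite B's2.
        ring.
      exact: measurable_RV_preimage.
    * apply/measurable_EFinP; have mI : measurable_fun setT (\1_B0 : R -> R) by exact: measurable_indic.
      by apply: (measurableT_comp mI).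
  + by move=> j js; apply: fe; rewrite in_cons js orbT.
  + by rewrite uniq_catC /= uniq_catC mem_cat negb_or is2 is1.
  + move=> j; rewrite mem_cat in_cons => /or3P[js|/eqP ->|js]; apply: sD; rewrite ?mem_head// in_cons mem_cat js ?orbT//.
  + by move=> j; rewrite /B'; case: eqP.
Qed.

Lemma indep_integral (f : I -> R -> R) (e : I -> R) (s : seq I) :
  (forall i, measurable_fun setT (f i)) -> (forall i x, 0 <= f i x) ->
  (forall i, i \in s -> (\int[P]_w (f i (xi i w))%:E = (e i)%:E)%E) ->
  uniq s -> (forall i, i \in s -> D i) ->
  (\int[P]_w (\prod_(i <- s) f i (xi i w))%:E = (\prod_(i <- s) e i)%:E)%E.
Proof.
move=> mf f0 fe us sD.
have := @indep_integral_indic f e s [::] (fun=> setT) mf f0 fe.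
rewrite cats0 => /(_ us sD (fun=> measurableT)).
rewrite big_nil mulr1 => <-.
by apply: eq_integral => w _; rewrite big_nil mulr1.
Qed.

End indep.

Section normal_laplace.
Context {R : realType} d (T : measurableType d) (P : probability T R).

(** Multiplying the standard normal density by [exp (- c x^2)] gives [s] times the
    centred normal density of standard deviation [s = (1 + 2 c)^(-1/2)]. *)
Lemma normal_laplace (X : {RV P >-> R}) (c : R) : standard_normal X -> 0 <= c ->
  (\int[P]_w (expR (- (c * X w ^+ 2)))%:E = ((Num.sqrt (1 + 2 * c))^-1)%:E)%E.
Proof.
move=> nX c0.
pose f (x : R) := expR (- (c * x ^+ 2)).
have mf : measurable_fun setT f.
  apply: measurableT_comp => //; apply: measurableT_comp => //.
  by apply: measurable_funM => //; exact: measurable_funX.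
have := @integral_transfer R _ _ _ _ (@lebesgue_measure R) P (normal_pdf 0 1) (cst 1) id X f.
have s1 : 0 < Num.sqrt (1 + 2 * c) by rewrite sqrtr_gt0; lra.
pose s := (Num.sqrt (1 + 2 * c))^-1.
have s0 : 0 < s by rewrite invr_gt0.
have ss : s ^+ 2 = (1 + 2 * c)^-1 by rewrite exprVn sqr_sqrtr//; lra.
have -> : (\int[lebesgue_measure]_w (normal_pdf 0 1 w * f w)%:E =
   \int[lebesgue_measure]_w (s%:E * (normal_pdf 0 s w)%:E))%E.
  apply: eq_integral => x _; rewrite -EFinM; congr (_%:E).
  rewrite !normal_pdfE ?gt_eqF//.
  rewrite /normal_peak /normal_fun /f subr0 expr1n mul1r -mulrA -expRD.
  rewrite -mulrnAr sqrtrM ?sqr_ge0// sqrtr_sqr gtr0_norm// invfM.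
  rewrite [RHS]mulrA [s * _]mulrA divff ?gt_eqF// mul1r; congr (_ * expR _).
  rewrite ss; field; lra.
rewrite ge0_integralZl//; last 3 first.
- by apply/measurable_EFinP; exact: measurable_normal_pdf.
- by move=> x _; rewrite lee_fin normal_pdf_ge0.
- by rewrite lee_fin ltW.
rewrite integral_normal_pdf mule1 => ->//.
- by apply: eq_integral => w _; rewrite mul1r.
- exact: measurable_normal_pdf.
- by move=> x; rewrite normal_pdf_ge0.
- move=> B mB; have := nX B mB; rewrite /distribution /pushforward /normal_prob => h.
  under [RHS]eq_integral do rewrite mul1r.
  have -> : (\int[P]_w (\1_B (X w))%:E = P (X @^-1` B))%E.
    rewrite -[X in P X]setIT -integral_indic//.
    exact: measurable_RV_preimage.
  rewrite h [RHS]integral_mkcond; apply: eq_integral => x _.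
  rewrite patchE indicE; case: ifPn => xB; first by rewrite mulr1.
  by rewrite mulr0.
- by move=> x; exact: expR_ge0.
Qed.
End normal_laplace.

(** * Laplace transform of the quadratic form *)

Section gsum.
Context {R : realType}.

Definition ln1DV2 (v : R) : R := ln (1 + v ^- 2).

(** Minus twice the logarithm of the Laplace transform of the truncated
    quadratic form at [tilt x]. *)
Definition laplace_exponent (al be : R) (N : nat) (x : R) : R :=
  \sum_(0 <= i < N) \sum_(0 <= j < N) ln1DV2 ((al + i%:R) * (be + j%:R) / x).

(** This parametrisation makes the Laplace exponent a function of
    [x / (a_i c_j)] alone. *)
Definition tilt (x : R) : R := pi ^+ 4 * x ^+ 2 / 2.

Definition square (N : nat) : seq (nat * nat) :=
  [seq (i.+1, j.+1) | i <- iota 0 N, j <- iota 0 N].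

Lemma mem_square N ij : (ij \in square N) = (0 < ij.1 <= N)%N && (0 < ij.2 <= N)%N.
Proof.
apply/allpairsP/andP => [[[i j]] /= [iN jN ->]/=|[/andP[i0 iN] /andP[j0 jN]]].
  by move: iN jN; rewrite !mem_iota.
exists (ij.1.-1, ij.2.-1); rewrite /= !mem_iota !add0n; split.
- by rewrite /= prednK.
- by rewrite /= prednK.
- by rewrite !prednK//; case: (ij).
Qed.

Lemma uniq_square N : uniq (square N).
Proof.
apply: allpairs_uniq; rewrite ?iota_uniq//.
by move=> [i j] [i' j'] _ _ /= [-> ->].
Qed.

Lemma square_pos N : [set` square N] `<=` pos_pairs.
Proof. by move=> ij /=; rewrite mem_square => /andP[/andP[? _] /andP[? _]]. Qed.

Lemma big_square N (F : nat * nat -> R) :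
  \sum_(ij <- square N) F ij = \sum_(0 <= i < N) \sum_(0 <= j < N) F (i.+1, j.+1).
Proof. by rewrite big_allpairs_dep /index_iota subn0. Qed.

End gsum.

Section quadratic_form.
Context {R : realType} d (T : measurableType d) (P : probability T R).
Context (b delta : R) (xi : nat * nat -> {RV P >-> R}).
Hypotheses (b1 : -1 < b) (d1 : -1 < delta).
Hypothesis indep : mutually_independent pos_pairs xi.
Hypothesis normal : forall ij, pos_pairs ij -> standard_normal (xi ij).

Definition weight (ij : nat * nat) : R := ((ij.1%:R + b) * (ij.2%:R + delta)) ^- 2.
Definition VN N w : R := pi ^- 4 * \sum_(ij <- square N) weight ij * xi ij w ^+ 2.

Lemma weight_ge0 ij : 0 <= weight ij.
Proof. by rewrite invr_ge0 sqr_ge0. Qed.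

Let pi4 : 0 < (pi : R) ^- 4. Proof. by rewrite invr_gt0 exprn_gt0// pi_gt0. Qed.

Lemma VN_ge0 N w : 0 <= VN N w.
Proof.
by rewrite mulr_ge0 ?(ltW pi4)// sumr_ge0// => i _; rewrite mulr_ge0 ?weight_ge0 ?sqr_ge0.
Qed.

Lemma V2E w : V2 b delta xi w =
  ((pi ^- 4)%:E * \esum_(ij in pos_pairs) (weight ij * xi ij w ^+ 2)%:E)%E.
Proof. by []. Qed.

Lemma le_VN_V2 N w : ((VN N w)%:E <= V2 b delta xi w)%E.
Proof.
rewrite V2E /VN EFinM; apply: lee_wpmul2l; first by rewrite lee_fin ltW.
apply: esum_ge; exists [set` square N].
  by split; [exact: finite_seq|exact: square_pos].
rewrite -sumEFin fsbig_seq//; exact: uniq_square.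
Qed.

(** A finite set of pairs lies in a square, so the squares suffice in the
    supremum that defines the infinite sum. *)
Lemma V2_le q w : (forall N, VN N w <= q) -> (V2 b delta xi w <= q%:E)%E.
Proof.
move=> H; rewrite V2E -lee_pdivlMl// -EFinM; apply: ge_ereal_sup => _ [X [fX sX] <-].
have [s sE] := (finite_seqP X).1 fX.
pose N := \max_(ij <- s) maxn ij.1 ij.2.
apply: (@le_trans _ _ (\sum_(ij <- square N) (weight ij * xi ij w ^+ 2)%:E)%E).
  rewrite [leRHS]fsbig_seq ?uniq_square//; apply: lee_fsum_nneg_subset => //; last first.
    by move=> ij _; rewrite lee_fin mulr_ge0 ?weight_ge0 ?sqr_ge0.
  move=> ij /[!inE] Xij; rewrite /= mem_square.
  have [i0 j0] := sX _ Xij.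
  have : (maxn ij.1 ij.2 <= N)%N.
    by move: Xij; rewrite sE => /= ijs; apply: (@leq_bigmax_seq _ s xpredT (fun ij => maxn ij.1 ij.2)).
  by rewrite geq_max i0 j0.
rewrite sumEFin lee_fin ler_pdivlMl//.
exact: H.
Qed.

Lemma VN_homo w : {homo VN ^~ w : N M / (N <= M)%N >-> N <= M}.
Proof.
move=> N M NM; rewrite ler_pM2l// -lee_fin -!sumEFin [leLHS]fsbig_seq ?uniq_square// [leRHS]fsbig_seq ?uniq_square//.
apply: lee_fsum_nneg_subset => //.
- move=> ij; rewrite !inE /= !mem_square => /andP[/andP[-> a] /andP[-> c]].
  by rewrite (leq_trans a NM) (leq_trans c NM).
- by move=> ij _; rewrite lee_fin mulr_ge0 ?weight_ge0 ?sqr_ge0.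
Qed.

Lemma measurable_VN N : measurable_fun setT (VN N).
Proof.
apply: measurable_funM => //; apply: measurable_sum => ij.
by apply: measurable_funM => //; apply: measurable_funX.
Qed.

Lemma measurable_VN_le N q : measurable [set w | VN N w <= q].
Proof.
have -> : [set w | VN N w <= q] = setT `&` VN N @^-1` `]-oo, q].
  by rewrite setTI; apply/seteqP; split => w /=; rewrite in_itv.
exact: measurable_VN.
Qed.

Lemma V2_le_set q : [set w | (V2 b delta xi w <= q%:E)%E] =
  \bigcap_N [set w | VN N w <= q].
Proof.
apply/seteqP; split => w /= H.
  by move=> N _ /=; rewrite -lee_fin; apply: le_trans H; exact: le_VN_V2.
by apply: V2_le => N; apply: H.
Qed.

Lemma measurable_V2_le q : measurable [set w | (V2 b delta xi w <= q%:E)%E].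
Proof. rewrite V2_le_set; apply: bigcapT_measurable => N; exact: measurable_VN_le. Qed.

(** [V2] takes values in the extended reals; its sublevel sets are built from those of
    the real functions [VN]. *)
Lemma measurable_V2_lt r : measurable [set w | (V2 b delta xi w < r%:E)%E].
Proof.
have -> : [set w | (V2 b delta xi w < r%:E)%E] =
  \bigcup_n [set w | (V2 b delta xi w <= (r - n.+1%:R^-1)%:E)%E].
  apply/seteqP; split => w /=.
    have V0 : (0 <= V2 b delta xi w)%E by apply: le_trans (le_VN_V2 0 w); rewrite lee_fin VN_ge0.
    case E : (V2 b delta xi w) V0 => [v| |]// _; rewrite lte_fin => vr.
    have rv : 0 < r - v by lra.
    have [N _ /(_ N (leqnn N)) hN] := near_infty_natSinv_lt (PosNum rv).
    exists N => //=; rewrite E lee_fin lerBrDr -lerBrDl; exact: ltW.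
  move=> [n _ /=] /le_lt_trans; apply; rewrite lte_fin.
  by rewrite ltrBlDr ltrDl invr_gt0.
apply: bigcupT_measurable => n; exact: measurable_V2_le.
Qed.

Lemma laplace_VN N x : 0 < x ->
  (\int[P]_w (expR (- (tilt x * VN N w)))%:E =
   (expR (- (laplace_exponent (1 + b) (1 + delta) N x / 2)))%:E)%E.
Proof.
move=> x0.
have pi0 : (pi : R) != 0 by rewrite gt_eqF// pi_gt0.
pose c ij := x ^+ 2 / 2 * weight ij.
have c0 ij : 0 <= c ij by rewrite mulr_ge0 ?weight_ge0// divr_ge0 ?sqr_ge0.
pose f ij (y : R) := expR (- (c ij * y ^+ 2)).
have mf ij : measurable_fun setT (f ij).
  apply: measurableT_comp => //; apply: measurableT_comp => //.
  by apply: measurable_funM => //; exact: measurable_funX.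
have prodE w : expR (- (tilt x * VN N w)) = \prod_(ij <- square N) f ij (xi ij w).
  rewrite /f -expR_sum; congr expR.
  rewrite sumrN; congr (- _); rewrite /tilt /VN mulr_sumr mulr_sumr; apply: eq_bigr => ij _.
  by rewrite /c; move: (pi : R) pi0 => p p0; field.
under eq_integral do rewrite prodE.
rewrite (@indep_integral R _ T P _ pos_pairs xi indep f (fun ij => (Num.sqrt (1 + 2 * c ij))^-1))//.
- have e (a a' : R) : a + 1 + a' = 1 + a' + a by ring.
  pose F (ij : nat * nat) := ln1DV2 ((ij.1%:R + b) * (ij.2%:R + delta) / x).
  have -> : laplace_exponent (1 + b) (1 + delta) N x = \sum_(ij <- square N) F ij.
    rewrite big_square; apply: eq_bigr => i _; apply: eq_bigr => j _.
    by rewrite /F /= -!natr1 !e.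
  congr (_%:E); rewrite mulr_suml -sumrN expR_sum; apply: eq_bigr => ij _.
  rewrite expRN; congr (_^-1).
  have -> : 1 + 2 * c ij = 1 + ((ij.1%:R + b) * (ij.2%:R + delta) / x) ^- 2.
    have z2 (z : R) : 2 * (x ^+ 2 / 2 * z) = x ^+ 2 * z by field.
    by rewrite /c /weight expr_div_n invf_div z2.
  rewrite /F /ln1DV2; set y := 1 + _.
  have y0 : 0 < y by rewrite ltr_pwDl// invr_ge0 sqr_ge0.
  have yE : y = expR (ln y / 2) ^+ 2 by rewrite expr2 -expRD -splitr lnK.
  by rewrite {1}yE sqrtr_sqr gtr0_norm ?expR_gt0.
- by move=> ij y; exact: expR_ge0.
- move=> ij /square_pos ijD; apply: normal_laplace => //; exact: normal.
- exact: uniq_square.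
- exact: square_pos.
Qed.

Lemma measurable_exp_VN N (u : R) : measurable_fun setT (fun w => expR (- (u * VN N w))).
Proof.
apply: measurableT_comp => //; apply: measurableT_comp => //.
apply: measurable_funM => //; exact: measurable_VN.
Qed.

(** Exponential Markov inequality, together with [VN N <= V2]. *)
Lemma P_V2_lt_le N x r : 0 < x ->
  fine (P [set w | (V2 b delta xi w < r%:E)%E]) <=
  expR (tilt x * r - laplace_exponent (1 + b) (1 + delta) N x / 2).
Proof.
move=> x0; have t0 : 0 <= tilt x.
  by rewrite divr_ge0// mulr_ge0 ?sqr_ge0// exprn_ge0// ltW// pi_gt0.
rewrite -lee_fin fineK; last by rewrite fin_num_measure//; exact: measurable_V2_lt.
rewrite -[X in P X]setIT -integral_indic//; last exact: measurable_V2_lt.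
apply: (@le_trans _ _ (\int[P]_w ((expR (tilt x * r))%:E * (expR (- (tilt x * VN N w)))%:E))%E).
  apply: ge0_le_integral => //.
  - by apply/measurable_EFinP; apply: measurable_indic; exact: measurable_V2_lt.
  - apply: emeasurable_funM => //; apply/measurable_EFinP; exact: measurable_exp_VN.
  - move=> w _; rewrite -EFinM lee_fin -expRD -mulrBr indicE.
    have [|_] := boolP (_ \in _); last exact: expR_ge0.
    rewrite inE /= => Vr; rewrite -expR0 ler_expR mulr_ge0// subr_ge0.
    by apply/ltW; rewrite -lte_fin; apply: le_lt_trans Vr; exact: le_VN_V2.
rewrite ge0_integralZl//.
- by rewrite laplace_VN// -EFinM -expRD.
- by apply/measurable_EFinP; exact: measurable_exp_VN.
Qed.

(** Pointwise form of the lower bound. Between [rho] and [q] the left side is at most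
    [1]; below [rho] the larger parameter [up] dominates it, above [q] the
    smaller parameter [um] does. *)
Lemma chernoff_lower (u um up rho q v : R) : 0 <= um -> um <= u -> u <= up -> 0 <= v ->
  expR (u * rho - u * v) <=
  (v <= q)%R%:R + expR (up * rho - up * v) + expR (u * rho - (u - um) * q - um * v).
Proof.
move=> um0 umu uup v0; have [vr|rv] := leP v rho.
  apply: (@le_trans _ _ (expR (up * rho - up * v))).
    by rewrite ler_expR; nra.
  by rewrite -addrA addrCA lerDl addr_ge0 ?expR_ge0.
have [vq|qv] := leP v q.
  rewrite -addrA; apply: (@le_trans _ _ 1); last by rewrite lerDl addr_ge0 ?expR_ge0.
  by rewrite -expR0 ler_expR; nra.
apply: (@le_trans _ _ (expR (u * rho - (u - um) * q - um * v))).
  by rewrite ler_expR; nra.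
by rewrite add0r lerDr expR_ge0.
Qed.

Lemma tilt_ge0 x : 0 <= tilt x :> R.
Proof. by rewrite divr_ge0// mulr_ge0 ?sqr_ge0// exprn_ge0// ltW// pi_gt0. Qed.

Lemma ler_tilt x y : 0 <= x -> x <= y -> tilt x <= tilt y :> R.
Proof.
move=> x0 xy; rewrite /tilt ler_pM2r// ler_wpM2l//.
  by rewrite exprn_ge0// ltW// pi_gt0.
by rewrite lerXn2r// nnegrE; lra.
Qed.

Lemma measurable_exp_affine_VN N (k u : R) :
  measurable_fun setT (fun w => expR (k - u * VN N w)).
Proof.
apply: measurableT_comp => //; apply: measurable_funB => //.
apply: measurable_funM => //; exact: measurable_VN.
Qed.

Lemma laplace_affine_VN N x k : 0 < x ->
  (\int[P]_w (expR (k - tilt x * VN N w))%:E =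
   (expR (k - laplace_exponent (1 + b) (1 + delta) N x / 2))%:E)%E.
Proof.
move=> x0; under eq_integral do rewrite expRD EFinM.
rewrite ge0_integralZl//.
- by rewrite laplace_VN// -EFinM -expRD.
- by apply/measurable_EFinP; exact: measurable_exp_VN.
Qed.

(** The expectation of [chernoff_lower] at [v = VN N w]: all three exponential
    moments are values of the Laplace transform. *)
Lemma P_VN_le_ge N xm x xp rho q : 0 < xm -> xm <= x -> x <= xp ->
  expR (tilt x * rho - laplace_exponent (1 + b) (1 + delta) N x / 2)
  - expR (tilt xp * rho - laplace_exponent (1 + b) (1 + delta) N xp / 2)
  - expR (tilt x * rho - (tilt x - tilt xm) * q - laplace_exponent (1 + b) (1 + delta) N xm / 2)
  <= fine (P [set w | VN N w <= q]).
Proof.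
move=> xm0 xmx xxp; rewrite !lerBlDr -lee_fin !EFinD.
have x0 : 0 < x by lra.
have xp0 : 0 < xp by lra.
rewrite fineK; last by rewrite fin_num_measure//; exact: measurable_VN_le.
rewrite -(laplace_affine_VN N (tilt x * rho) x0) -(laplace_affine_VN N (tilt xp * rho) xp0).
rewrite -(laplace_affine_VN N (tilt x * rho - (tilt x - tilt xm) * q) xm0).
rewrite -[X in P X]setIT -integral_indic//; last exact: measurable_VN_le.
have mI : measurable_fun setT (fun w => (\1_[set w | VN N w <= q] w : R)%:E).
  by apply/measurable_EFinP; apply: measurable_indic; exact: measurable_VN_le.
have mE k u : measurable_fun setT (fun w => (expR (k - u * VN N w))%:E).
  by apply/measurable_EFinP; exact: measurable_exp_affine_VN.
rewrite -ge0_integralD//; try by move=> w _; rewrite lee_fin expR_ge0.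
rewrite -ge0_integralD//.
- apply: ge0_le_integral => //.
  + by apply: emeasurable_funD => //; apply: emeasurable_funD.
  + move=> w _; rewrite -!EFinD lee_fin indicE.
    have -> : (w \in [set w | VN N w <= q]) = (VN N w <= q).
      by apply/idP/idP; rewrite inE.
    rewrite [leRHS]addrAC; apply: chernoff_lower.
    * exact: tilt_ge0.
    * by apply: ler_tilt => //; exact: ltW.
    * by apply: ler_tilt => //; exact: ltW.
    * exact: VN_ge0.
- by move=> w _; rewrite -EFinD lee_fin addr_ge0.
- by apply: emeasurable_funD.
Qed.

(** The events [VN N <= q] decrease to [V2 <= q]; the gap between [q] and [r] absorbs the
    passage from a weak to a strict inequality. *)
Lemma P_V2_lt_ge p q r : q < r ->
  (\forall N \near \oo, p <= fine (P [set w | VN N w <= q])) ->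
  p <= fine (P [set w | (V2 b delta xi w < r%:E)%E]).
Proof.
move=> qr H.
apply: (@le_trans _ _ (fine (P [set w | (V2 b delta xi w <= q%:E)%E]))); last first.
  apply: fine_le; rewrite ?fin_num_measure//.
  - exact: measurable_V2_le.
  - exact: measurable_V2_lt.
  apply: le_measure; rewrite ?inE; [exact: measurable_V2_le|exact: measurable_V2_lt|].
  by move=> w /= /le_lt_trans; apply; rewrite lte_fin.
rewrite -lee_fin fineK ?fin_num_measure//; last exact: measurable_V2_le.
rewrite V2_le_set.
have cv := @nonincreasing_cvg_mu _ T R P (fun N => [set w | VN N w <= q]).
have {}cv : (P \o (fun N => [set w | VN N w <= q])) x @[x --> \oo] -->
    P (\bigcap_N [set w | VN N w <= q]).
  apply: cv.
  - apply: le_lt_trans (ltry 1); apply: probability_le1; exact: measurable_VN_le.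
  - by move=> N; exact: measurable_VN_le.
  - apply: bigcapT_measurable => N; exact: measurable_VN_le.
  - move=> N M NM; rewrite subsetEset => w /=; apply: le_trans; exact: VN_homo.
apply: (@closed_cvg _ _ _ _ _ (fun y : \bar R => (p%:E <= y)%E) _ _ _ cv).
- exact: closed_ereal_le_ereal.
- near=> N; rewrite /= -[P _]fineK ?fin_num_measure//; last exact: measurable_VN_le.
  by rewrite lee_fin; near: N.
Unshelve. all: by end_near. Qed.

End quadratic_form.

(** * Comparison of sums with primitives *)

Section monotone_calculus.
Context {R : realType}.
Implicit Types (f g F : R -> R).

Lemma is_derive_within f (df : R -> R) (a b : R) : 
  (forall x : R, a <= x <= b -> is_derive x 1 f (df x)) -> {within `[a, b], continuous f}.
Proof.
move=> df'; apply: derivable_within_continuous => x; rewrite in_itv/= => /df' h.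
exact: ex_derive.
Qed.

(** The functions compared below are singular at [0], so differentiability is only
    asked on the positive half-line. *)
Lemma MVT_pos f (df : R -> R) (a b : R) : 0 < a -> a <= b ->
  (forall x : R, 0 < x -> is_derive x 1 f (df x)) ->
  exists2 c, a <= c <= b & f b - f a = df c * (b - a).
Proof.
move=> a0 ab H.
have [||c] := @MVT_segment R f df a b ab.
- by move=> x; rewrite in_itv/= => /andP[ax xb]; apply: H; exact: lt_trans ax.
- by apply: is_derive_within => x /andP[ax xb]; apply: H; exact: lt_le_trans ax.
by rewrite in_itv/= => cab e; exists c.
Qed.

Lemma ndecr_pos f (df : R -> R) (a b : R) : 0 < a -> a <= b ->
  (forall x : R, 0 < x -> is_derive x 1 f (df x)) -> (forall x : R, 0 < x -> 0 <= df x) ->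
  f a <= f b.
Proof.
move=> a0 ab H H0; have [c /andP[ac cb] e] := MVT_pos a0 ab H.
rewrite -subr_ge0 e mulr_ge0 ?subr_ge0//; apply: H0; exact: lt_le_trans ac.
Qed.

Lemma cst_pos f (a b : R) : 0 < a -> 0 < b ->
  (forall x : R, 0 < x -> is_derive x 1 f 0) -> f a = f b.
Proof.
move=> a0 b0 H; wlog ab : a b a0 b0 / a <= b => [W|].
  by have [|/ltW] := leP a b; [exact: W|move=> ba; rewrite (W b a)].
have [c _] := MVT_pos a0 ab H; rewrite mul0r => e; lra.
Qed.

Lemma sum_ge_primitive g F (c : R) m n : 0 < c -> (m <= n)%N ->
  (forall x : R, 0 < x -> is_derive x 1 F (g x)) ->
  (forall x y : R, 0 < x -> x <= y -> g y <= g x) ->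
  F (c + n%:R) - F (c + m%:R) <= \sum_(m <= j < n) g (c + j%:R).
Proof.
move=> c0 mn dF mg; elim: n mn => [|n IH].
  by rewrite leqn0 => /eqP ->; rewrite big_geq// subrr.
rewrite leq_eqVlt => /orP[/eqP ->|]; first by rewrite big_geq// subrr.
rewrite ltnS => mn; rewrite big_nat_recr//=; have {}IH := IH mn.
have cn0 : 0 < c + n%:R by rewrite ltr_pwDl.
have cle : c + n%:R <= c + n.+1%:R by rewrite lerD2l ler_nat.
have [t /andP[t1 t2] e] := MVT_pos cn0 cle dF.
have : F (c + n.+1%:R) - F (c + n%:R) <= g (c + n%:R).
  rewrite e; have -> : c + n.+1%:R - (c + n%:R) = 1 by rewrite -natr1; ring.
  rewrite mulr1; exact: mg.
lra.
Qed.

Lemma sum_le_primitive g F (c : R) m n : 0 < c -> (m <= n)%N ->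
  (forall x : R, 0 < x -> is_derive x 1 F (g x)) ->
  (forall x y : R, 0 < x -> x <= y -> g y <= g x) ->
  \sum_(m <= j < n) g (c + j.+1%:R) <= F (c + n%:R) - F (c + m%:R).
Proof.
move=> c0 mn dF mg; elim: n mn => [|n IH].
  by rewrite leqn0 => /eqP ->; rewrite big_geq// subrr.
rewrite leq_eqVlt => /orP[/eqP ->|]; first by rewrite big_geq// subrr.
rewrite ltnS => mn; rewrite big_nat_recr//=; have {}IH := IH mn.
have cn0 : 0 < c + n%:R by rewrite ltr_pwDl.
have cle : c + n%:R <= c + n.+1%:R by rewrite lerD2l ler_nat.
have [t /andP[t1 t2] e] := MVT_pos cn0 cle dF.
have : g (c + n.+1%:R) <= F (c + n.+1%:R) - F (c + n%:R).
  rewrite e; have -> : c + n.+1%:R - (c + n%:R) = 1 by rewrite -natr1; ring.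
  rewrite mulr1; apply: mg => //; exact: lt_le_trans t1.
lra.
Qed.

(** Monotonicity carries [v] to infinity, where [C / x] vanishes. *)
Lemma ndecr_le_lim F (L C : R) v : 0 < v ->
  (forall x y : R, 0 < x -> x <= y -> F x <= F y) ->
  (forall x : R, 0 < x -> F x <= L + C / x) -> F v <= L.
Proof.
move=> v0 mF bF; apply/ler_addgt0Pr => e e0.
pose x := Num.max v (`|C| / e).
have vx : v <= x by rewrite le_max lexx.
have x0 : 0 < x by exact: lt_le_trans vx.
apply: (le_trans (mF _ _ v0 vx)); apply: (le_trans (bF _ x0)).
rewrite lerD2l ler_pdivrMr//; apply: (le_trans (ler_norm _)).
by rewrite mulrC -ler_pdivrMr// le_max lexx orbT.
Qed.

(** The next four lemmas restate the derivation rules with the functions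
    written pointwise and with multiplication in place of scaling, so that
    derivatives of explicit expressions can be assembled without conversions. *)
Lemma is_deriveD' f g (x a c : R) : is_derive x 1 f a -> is_derive x 1 g c ->
  is_derive x 1 (fun y => f y + g y) (a + c).
Proof. by move=> df dg; exact: is_deriveD. Qed.

Lemma is_deriveM' f g (x a c : R) : is_derive x 1 f a -> is_derive x 1 g c ->
  is_derive x 1 (fun y => f y * g y) (f x * c + a * g x).
Proof.
move=> df dg; have := @is_deriveM _ _ f g x 1 a c df dg.
by rewrite -[f x *: c]/(f x * c) -[g x *: a]/(g x * a) [g x * a]mulrC.
Qed.

Lemma is_deriveZ' f (k x a : R) : is_derive x 1 f a ->
  is_derive x 1 (fun y => k * f y) (k * a).
Proof. by move=> df; exact: is_deriveZ. Qed.

Lemma is_deriveV' (x : R) : 0 < x -> is_derive x 1 (fun y : R => y^-1) (- x ^- 2).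
Proof.
move=> x0; have := @is_deriveV _ (fun y : R => y) x 1 1 (lt0r_neq0 x0) (is_derive_id _ _).
by rewrite -[_ *: 1]/(_ * 1) mulr1.
Qed.

End monotone_calculus.

Section kernel_functions.
Context {R : realType}.
Implicit Types (v w x : R).

Lemma oneDsq_neq0 v : 1 + v ^+ 2 != 0.
Proof. by rewrite gt_eqF// ltr_pwDl// sqr_ge0. Qed.

Lemma ln1DV2E v : 0 < v -> ln1DV2 v = ln (1 + (v^-1) ^+ 2).
Proof. by move=> v0; rewrite /ln1DV2 exprVn. Qed.

Lemma is_derive_ln1DV2 v : 0 < v -> is_derive v 1 ln1DV2 (- 2 / (v * (1 + v ^+ 2))).
Proof.
move=> v0.
have w0 : 0 < v^-1 by rewrite invr_gt0.
have d1 := is_deriveV' v0.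
have d2 := is_deriveD' (is_derive_cst (1 : R) v 1) (is_deriveM' d1 d1).
have p0 : 0 < 1 + v^-1 * v^-1 by rewrite addr_gt0// mulr_gt0.
have := @is_derive1_comp R (@ln R) _ v _ _ (is_derive1_ln p0) d2.
have -> : (@ln R \o (fun y : R => cst 1 y + y^-1 * y^-1)) = ln1DV2.
  by apply/funext => y /=; rewrite /ln1DV2 -exprVn expr2.
have -> : (1 + v^-1 * v^-1)^-1 * (0 + (v^-1 * - v ^- 2 + - v ^- 2 * v^-1)) = - 2 / (v * (1 + v ^+ 2)).
  by field; rewrite oneDsq_neq0 (lt0r_neq0 v0).
by [].
Qed.

Lemma ln1DV2_ge0 v : 0 <= ln1DV2 v.
Proof. by apply: ln_ge0; rewrite lerDl invr_ge0 sqr_ge0. Qed.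

Lemma ln1DV2_decr v w : 0 < v -> v <= w -> ln1DV2 w <= ln1DV2 v.
Proof.
move=> v0 vw; have w0 : 0 < w by exact: lt_le_trans vw.
rewrite ler_ln ?posrE ?ltr_pwDl ?invr_ge0 ?sqr_ge0// lerD2l lef_pV2 ?posrE ?exprn_gt0//.
by rewrite lerXn2r// nnegrE ltW.
Qed.

Lemma ln1DV2_le v : 0 < v -> ln1DV2 v <= v ^- 2.
Proof.
move=> v0; apply: le_ln1Dx; apply: (@lt_le_trans _ _ 0); first by rewrite ltrN10.
by rewrite invr_ge0 sqr_ge0.
Qed.

(** [ln (1 + s^8) <= 8 ln (1 + s) <= 8 s], so the logarithmic singularity at [0] is
    absorbed by the power [v^(-1/4)]. *)
Lemma ln1DV2_le_root v s : 0 < v -> 0 < s -> v^-1 = s ^+ 4 -> ln1DV2 v <= 8 * s.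
Proof.
move=> v0 s0 vs; rewrite ln1DV2E// vs -exprM.
have s1 : 0 < 1 + s by lra.
apply: (@le_trans _ _ (ln ((1 + s) ^+ 8))).
  rewrite ler_ln ?posrE ?exprn_gt0 ?ltr_pwDl ?exprn_ge0 ?(ltW s0)//.
  have step n : 1 + s ^+ n.+1 <= (1 + s) ^+ n.+1.
    elim: n => [|n IH]; first by rewrite !expr1.
    rewrite exprS [(1 + s) ^+ _]exprS.
    have sn : 0 <= s ^+ n.+1 by rewrite exprn_ge0// ltW.
    apply: (@le_trans _ _ ((1 + s) * (1 + s ^+ n.+1))); first by nra.
    by rewrite ler_pM2l.
  exact: (step 7%N).
rewrite lnXn// -[leLHS]mulr_natl ler_wpM2l//; apply: le_ln1Dx; lra.
Qed.

(** The primitive [\int_0^v ln (1 + t^-2) dt]. *)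
Definition head_int v : R := v * ln1DV2 v + 2 * atan v.

Lemma is_derive_head_int v : 0 < v -> is_derive v 1 head_int (ln1DV2 v).
Proof.
move=> v0.
have := is_deriveD' (is_deriveM' (is_derive_id v 1) (is_derive_ln1DV2 v0)) (is_deriveZ' 2 (is_derive1_atan v)).
have -> : v * (- 2 / (v * (1 + v ^+ 2))) + 1 * ln1DV2 v + 2 * (1 + v ^+ 2)^-1 = ln1DV2 v.
  move: (ln1DV2 v) => f; by field; rewrite ?oneDsq_neq0 ?(lt0r_neq0 v0).
by [].
Qed.

Lemma atan_ge0 v : 0 <= v -> 0 <= atan v.
Proof. by move=> v0; rewrite -(@atan0 R) le_atan. Qed.

Lemma atan_le v : 0 < v -> atan v <= v.
Proof.
move=> v0; suff : 0 <= v - atan v by rewrite subr_ge0.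
have dF (x : R) : is_derive x 1 (fun y => y + (-1) * atan y) (1 + (-1) * (1 + x ^+ 2)^-1).
  exact: is_deriveD' (is_derive_id x 1) (is_deriveZ' _ (is_derive1_atan x)).
have [c _] := @MVT_segment R _ _ 0 v (ltW v0) (fun x _ => dF x)
  (@is_derive_within _ _ _ _ _ (fun x _ => dF x)).
rewrite atan0 mulr0 addr0 !subr0 mulN1r => ->.
rewrite mulr_ge0 ?(ltW v0)// mulN1r subr_ge0 invf_le1 ?lerDl ?sqr_ge0//.
by rewrite ltr_pwDl// sqr_ge0.
Qed.

Lemma atanDV v : 0 < v -> atan v + atan v^-1 = pi / 2.
Proof.
move=> v0.
have dF x : 0 < x -> is_derive x 1 (fun y => atan y + atan y^-1) 0.
  move=> x0.
  have := is_deriveD' (is_derive1_atan x) (is_derive1_comp (is_derive1_atan x^-1) (is_deriveV' x0)).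
  have -> : (1 + x ^+ 2)^-1 + (1 + x^-1 ^+ 2)^-1 * - x ^- 2 = 0.
    by field; rewrite ?oneDsq_neq0 ?(lt0r_neq0 x0)// addrC oneDsq_neq0.
  by [].
have -> := @cst_pos R (fun y => atan y + atan y^-1) v 1 v0 ltr01 dF.
by rewrite invr1 atan1; move: (pi : R) => p; field.
Qed.

(** The complementary integral from [v] to infinity, the total mass being [pi];
    see [tail_int_ge0]. *)
Definition tail_int v : R := pi - head_int v.

Lemma tail_intE v : 0 < v -> tail_int v = 2 * atan v^-1 - v * ln1DV2 v.
Proof.
move=> v0; rewrite /tail_int /head_int.
have := atanDV v0; move: (atan v) (atan v^-1) (ln1DV2 v) (pi : R) => a c f p; lra.
Qed.

Lemma head_int_ge0 v : 0 < v -> 0 <= head_int v.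
Proof.
by move=> v0; rewrite addr_ge0// mulr_ge0 ?ln1DV2_ge0 ?atan_ge0 ?(ltW v0).
Qed.

Lemma tail_int_le v : 0 < v -> tail_int v <= 2 / v.
Proof.
move=> v0; rewrite tail_intE//.
have w0 : 0 < v^-1 by rewrite invr_gt0.
have := atan_le w0; have := mulr_ge0 (ltW v0) (ln1DV2_ge0 v); move: (atan _) (v * _) => a c; lra.
Qed.

Lemma head_int_ndecr x y : 0 < x -> x <= y -> head_int x <= head_int y.
Proof.
move=> x0 xy; apply: (ndecr_pos x0 xy is_derive_head_int) => z z0; exact: ln1DV2_ge0.
Qed.

(** [head_int] increases, and it is at most [pi + 1 / x] at [x]. *)
Lemma tail_int_ge0 v : 0 < v -> 0 <= tail_int v.
Proof.
move=> v0; rewrite subr_ge0; apply: (@ndecr_le_lim _ head_int pi 1 _ v0).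
  exact: head_int_ndecr.
move=> x x0; rewrite /head_int mul1r; apply: (@le_trans _ _ (x * x ^- 2 + 2 * (pi / 2))).
  by rewrite lerD ?ler_pM2l ?ln1DV2_le// ltW// atan_ltpi2.
have -> : x * x ^- 2 = x^-1 by field; exact: lt0r_neq0.
by move: (pi : R) => p; rewrite le_eqVlt; apply/orP; left; apply/eqP; field; exact: lt0r_neq0.
Qed.

End kernel_functions.

(** * The inverse tangent integral *)

Section atan_primitive.
Context {R : realType}.
Implicit Types (v w x : R).
Local Notation mu := (@lebesgue_measure R).

Definition atan_ratio v : R := atan v / v.

Lemma continuous_atan_ratio v : 0 < v -> {for v, continuous atan_ratio}.
Proof.
move=> v0; apply: cvgM; first exact: continuous_atan.
by apply: cvgV; [exact: lt0r_neq0|exact: cvg_id].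
Qed.

Lemma atan_ratio_ge0 v : 0 < v -> 0 <= atan_ratio v.
Proof. by move=> v0; rewrite divr_ge0 ?atan_ge0// ltW. Qed.

Lemma atan_ratio_le1 v : 0 < v -> atan_ratio v <= 1.
Proof. by move=> v0; rewrite ler_pdivrMr// mul1r atan_le. Qed.

Lemma measurable_atan_ratio u : measurable_fun (`]0, u]%classic : set R) atan_ratio.
Proof.
have m : measurable_fun (`]0, +oo[%classic : set R) atan_ratio.
  apply: open_continuous_measurable_fun => // x; rewrite inE/= in_itv/= andbT.
  exact: continuous_atan_ratio.
apply: (measurable_funS _ _ m) => //.
by apply: subset_itvl.
Qed.

Lemma mu_oc w : 0 < w -> mu (`]0, w]%classic : set R) = w%:E.
Proof. by move=> w0; rewrite lebesgue_measure_itv/= lte_fin w0 oppr0 adde0. Qed.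

Lemma integrable_oc (f : R -> R) w : 0 < w -> measurable_fun (`]0, w]%classic : set R) f ->
  (forall x, 0 < x -> 0 <= f x <= 1) -> mu.-integrable (`]0, w]%classic : set R) (EFin \o f).
Proof.
move=> w0 mf f1; apply: measurable_bounded_integrable => //.
  by rewrite [X in (X < _)%E](mu_oc w0) ltry.
exists 1; split => // M M1 x /=; rewrite in_itv/= => /andP[x0 _].
by have /andP[a c] := f1 _ x0; rewrite ger0_norm// (le_trans c)// ltW.
Qed.

(** The inverse tangent integral. *)
Definition Ti2 w : R := \int[mu]_(t in `]0, w]) atan_ratio t.

Lemma is_derive_Ti2 v : 0 < v -> is_derive v 1 Ti2 (atan_ratio v).
Proof.
move=> v0; have vu : v < v + 1 by rewrite ltrDl.
have u0 : 0 < v + 1 by exact: lt_trans vu.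
have [] := @continuous_FTC1 R atan_ratio (BRight 0) v (v + 1) vu.
- apply: integrable_oc => //; first exact: measurable_atan_ratio.
  by move=> x x0; rewrite atan_ratio_ge0 ?atan_ratio_le1.
- by rewrite lte_fin.
- exact: continuous_atan_ratio.
by move=> dF eF; apply: DeriveDef; [exact: dF|rewrite -derive1E; exact: eF].
Qed.

Lemma Ti2_ge0 w : 0 <= Ti2 w.
Proof. by apply: Rintegral_ge0 => x; rewrite /= in_itv/= => /andP[x0 _]; exact: atan_ratio_ge0. Qed.

Lemma Ti2_le w : 0 < w -> Ti2 w <= w.
Proof.
move=> w0; have wE : \int[mu]_(t in `]0, w]) (cst (1 : R)) t = w.
  transitivity (fine (\int[mu]_(t in (`]0%R, w]%classic : set R)) (cst 1%E t))%E); first by [].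
  by rewrite integral_cst//= [X in (_ * X)%E](mu_oc w0) mul1e.
rewrite -[leRHS]wE; apply: le_Rintegral.
- exact: measurable_itv.
- apply: integrable_oc => //; first exact: measurable_atan_ratio.
  by move=> x x0; rewrite atan_ratio_ge0 ?atan_ratio_le1.
- by apply: integrable_oc => // x _; rewrite ler01 lexx.
- by move=> x; rewrite /= in_itv/= => /andP[x0 _]; exact: atan_ratio_le1.
Qed.

(** Both sides have the same derivative, since [atan v + atan (1 / v) = pi / 2], and
    they agree at [1]. *)
Lemma Ti2_inv v : 0 < v -> Ti2 v = Ti2 v^-1 + pi / 2 * ln v.
Proof.
move=> v0.
pose F := fun y : R => Ti2 y + ((-1) * Ti2 y^-1 + (- (pi / 2)) * ln y).
have dF (x : R) : 0 < x -> is_derive x 1 F 0.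
  move=> x0; have xi0 : 0 < x^-1 by rewrite invr_gt0.
  have d1 := is_derive1_comp (is_derive_Ti2 xi0) (is_deriveV' x0).
  have := is_deriveD' (is_derive_Ti2 x0) (is_deriveD' (is_deriveZ' (-1) d1) (is_deriveZ' (- (pi / 2)) (is_derive1_ln x0))).
  rewrite (_ : (_ + (_ + _)) = 0)//.
  rewrite /atan_ratio -(atanDV x0); move: (atan x) (atan x^-1) => a c.
  by field; exact: lt0r_neq0.
have := @cst_pos R F v 1 v0 ltr01 dF.
by rewrite /F invr1 ln1 mulr0 addr0; move: (Ti2 v) (Ti2 v^-1) (Ti2 1) (ln v) (pi : R) => a c d l p; lra.
Qed.

(** Summing a row over its initial segment produces [head_int] at arguments
    proportional to the row number; after the exchange of rows and columns it is
    the mean [head_mean] that is summed, and [int_head_mean] is its primitive.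
    Likewise [tail_ratio] is summed over the corner, with primitive
    [int_tail_ratio]. That [tail_int] and [head_int] add up to [pi] makes
    [int_head_mean + int_tail_ratio] the pure logarithm [pi * ln v], which is the
    source of the cancellation between the corner and the rows and columns. *)
Definition head_mean v : R := head_int v / v.
Definition int_head_mean v : R := head_int v + 2 * Ti2 v.
Definition tail_ratio v : R := tail_int v / v.
Definition int_tail_ratio v : R := pi * ln v - int_head_mean v.

Lemma head_meanE v : 0 < v -> head_mean v = ln1DV2 v + 2 * atan_ratio v.
Proof.
move=> v0; rewrite /head_mean /head_int /atan_ratio; move: (ln1DV2 v) (atan v) => f a.
by field; exact: lt0r_neq0.
Qed.

Lemma head_mean_le v : 0 < v -> head_mean v <= ln1DV2 v + 2.
Proof.
move=> v0; rewrite head_meanE//; have := atan_ratio_le1 v0; move: (ln1DV2 v) (atan_ratio v) => f a; lra.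
Qed.

Lemma is_derive_int_head_mean v : 0 < v -> is_derive v 1 int_head_mean (head_mean v).
Proof.
move=> v0; have := is_deriveD' (is_derive_head_int v0) (is_deriveZ' 2 (is_derive_Ti2 v0)).
by rewrite -head_meanE.
Qed.

Lemma is_derive_int_tail_ratio v : 0 < v -> is_derive v 1 int_tail_ratio (tail_ratio v).
Proof.
move=> v0; have := is_deriveD' (is_deriveZ' pi (is_derive1_ln v0)) (is_deriveZ' (-1) (is_derive_int_head_mean v0)).
have -> : pi / v + -1 * head_mean v = tail_ratio v.
  by rewrite /tail_ratio /tail_int /head_mean mulrBl mulN1r.
have -> : (fun y => pi * ln y + -1 * int_head_mean y) = int_tail_ratio; last by [].
by apply/funext => y; rewrite /int_tail_ratio mulN1r.
Qed.

Lemma head_mean_decr v w : 0 < v -> v <= w -> head_mean w <= head_mean v.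
Proof.
move=> v0 vw; rewrite -lerN2.
have dF x : 0 < x -> is_derive x 1 (fun y => (-1) * (head_int y * y^-1)) (2 * atan x / x ^+ 2).
  move=> x0; have := is_deriveZ' (-1) (is_deriveM' (is_derive_head_int x0) (is_deriveV' x0)).
  rewrite (_ : -1 * _ = 2 * atan x / x ^+ 2)//.
  rewrite /head_int; move: (ln1DV2 x) (atan x) => f a; field; exact: lt0r_neq0.
have := ndecr_pos v0 vw dF; rewrite !mulN1r; apply => x x0.
by rewrite divr_ge0 ?sqr_ge0// mulr_ge0// atan_ge0// ltW.
Qed.

Lemma tail_ratio_decr v w : 0 < v -> v <= w -> tail_ratio w <= tail_ratio v.
Proof.
move=> v0 vw; have w0 : 0 < w by exact: lt_le_trans vw.
apply: ler_pM; rewrite ?tail_int_ge0 ?invr_ge0 ?(ltW w0)//.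
  by rewrite lerD2l lerN2; exact: head_int_ndecr.
by rewrite lef_pV2 ?posrE.
Qed.

Lemma int_head_mean_ge0 v : 0 < v -> 0 <= int_head_mean v.
Proof. by move=> v0; rewrite addr_ge0 ?head_int_ge0// mulr_ge0// Ti2_ge0. Qed.

Lemma int_head_mean_le v : 0 < v -> int_head_mean v <= v * (ln1DV2 v + 4).
Proof.
move=> v0; rewrite /int_head_mean /head_int; have := Ti2_le v0; have := atan_le v0.
move: (Ti2 v) (atan v) (ln1DV2 v) => h a f; nra.
Qed.

Lemma int_head_mean_ndecr v w : 0 < v -> v <= w -> int_head_mean v <= int_head_mean w.
Proof.
move=> v0 vw; apply: (ndecr_pos v0 vw is_derive_int_head_mean) => x x0.
by rewrite divr_ge0 ?head_int_ge0// ltW.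
Qed.

(** The inversion formula of [Ti2] turns the logarithm in [int_tail_ratio] into a
    quantity with a limit at infinity. *)
Lemma int_tail_ratioE v : 0 < v -> int_tail_ratio v = tail_int v - pi - 2 * Ti2 v^-1.
Proof.
move=> v0; rewrite /int_tail_ratio /int_head_mean /tail_int (Ti2_inv v0).
by move: (ln v) (head_int v) (Ti2 v^-1) (pi : R) => l e h p; field.
Qed.

Lemma int_tail_ratio_ge v : 0 < v -> - pi - 2 / v <= int_tail_ratio v.
Proof.
move=> v0; rewrite int_tail_ratioE//; have vi0 : 0 < v^-1 by rewrite invr_gt0.
have := Ti2_le vi0; have := tail_int_ge0 v0.
move: (tail_int v) (Ti2 v^-1) (pi : R) (v^-1) => f h p w; lra.
Qed.

(** The function increases to its limit [- pi] at infinity; this limit is the term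
    [- pi * x] of the Laplace exponent. *)
Lemma int_tail_ratio_le v : 0 < v -> int_tail_ratio v <= - pi.
Proof.
move=> v0; apply: (@ndecr_le_lim _ int_tail_ratio (- pi) 2 _ v0).
  move=> x y x0 xy; apply: (ndecr_pos x0 xy is_derive_int_tail_ratio) => z z0.
  by rewrite divr_ge0 ?tail_int_ge0// ltW.
move=> x x0; rewrite int_tail_ratioE//; have := tail_int_le x0; have := Ti2_ge0 x^-1.
by move: (tail_int x) (Ti2 x^-1) (pi : R) (2 / x) => f h p w; lra.
Qed.

End atan_primitive.

Section scaled_sums.
Context {R : realType}.
Implicit Types (g F : R -> R) (k c : R).

Lemma is_derive_scale g F k : 0 < k ->
  (forall x : R, 0 < x -> is_derive x 1 F (g x)) ->
  forall x : R, 0 < x -> is_derive x 1 (fun y => k^-1 * F (k * y)) (g (k * x)).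
Proof.
move=> k0 dF x x0; have kx0 : 0 < k * x by rewrite mulr_gt0.
have := is_deriveZ' k^-1 (is_derive1_comp (dF _ kx0) (is_deriveZ' k (is_derive_id x 1))).
by rewrite mulr1 mulrCA mulVf ?mulr1// lt0r_neq0.
Qed.

Lemma scaled_sum_ge g F k c m n : 0 < k -> 0 < c -> (m <= n)%N ->
  (forall x : R, 0 < x -> is_derive x 1 F (g x)) ->
  (forall x y : R, 0 < x -> x <= y -> g y <= g x) ->
  k^-1 * (F (k * (c + n%:R)) - F (k * (c + m%:R))) <= \sum_(m <= j < n) g (k * (c + j%:R)).
Proof.
move=> k0 c0 mn dF mg.
have := sum_ge_primitive c0 mn (is_derive_scale k0 dF); rewrite -mulrBr; apply.
move=> x y x0 xy; apply: mg; first by rewrite mulr_gt0.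
by rewrite ler_pM2l.
Qed.

Lemma scaled_sum_le g F k c m n : 0 < k -> 0 < c -> (m <= n)%N ->
  (forall x : R, 0 < x -> is_derive x 1 F (g x)) ->
  (forall x y : R, 0 < x -> x <= y -> g y <= g x) ->
  \sum_(m <= j < n) g (k * (c + j.+1%:R)) <= k^-1 * (F (k * (c + n%:R)) - F (k * (c + m%:R))).
Proof.
move=> k0 c0 mn dF mg.
have := sum_le_primitive c0 mn (is_derive_scale k0 dF); rewrite -mulrBr; apply.
move=> x y x0 xy; apply: mg; first by rewrite mulr_gt0.
by rewrite ler_pM2l.
Qed.

End scaled_sums.

(** * Two-sided bounds for the Laplace exponent *)

Section gsum_bounds.
Context {R : realType}.
Implicit Types (al be x A : R).

Lemma divr_mulAC (p q x : R) : p / x * q = q / x * p.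
Proof. by rewrite mulrAC (mulrC p) mulrAC. Qed.

Lemma row_le be x A N : 0 < be -> 0 < x -> 0 < A ->
  \sum_(0 <= j < N.+1) ln1DV2 (A * (be + j%:R) / x) <= ln1DV2 (A * be / x) + x / A * pi.
Proof.
move=> be0 x0 A0; rewrite big_nat_recl//= addr0 lerD2l.
have k0 : 0 < A / x by rewrite divr_gt0.
have := scaled_sum_le k0 be0 (leq0n N) (@is_derive_head_int R) (@ln1DV2_decr R).
rewrite addr0 invf_div; under eq_bigr do rewrite mulrAC.
move=> /le_trans; apply; rewrite ler_pM2l ?divr_gt0//.
have := head_int_ge0 (mulr_gt0 k0 be0).
have := @tail_int_ge0 R (A / x * (be + N%:R)); rewrite /tail_int mulr_gt0 ?ltr_pwDl// => /(_ isT).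
move: (head_int _) (head_int _) (pi : R) => e1 e2 p; lra.
Qed.

Lemma tail_row_le be x A m N : 0 < be -> 0 < x -> 0 < A -> (m <= N)%N ->
  \sum_(m.+1 <= j < N.+1) ln1DV2 (A * (be + j%:R) / x) <= x / A * tail_int (A / x * (be + m%:R)).
Proof.
move=> be0 x0 A0 mN; rewrite big_add1/=.
have k0 : 0 < A / x by rewrite divr_gt0.
have := scaled_sum_le k0 be0 mN (@is_derive_head_int R) (@ln1DV2_decr R).
rewrite invf_div; under eq_bigr do rewrite mulrAC.
move=> /le_trans; apply; rewrite ler_pM2l ?divr_gt0//.
have := @tail_int_ge0 R (A / x * (be + N%:R)); rewrite /tail_int mulr_gt0 ?ltr_pwDl// => /(_ isT).
move: (head_int _) (head_int _) (pi : R) => e1 e2 p; lra.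
Qed.

Lemma row_ge be x A m N : 0 < be -> 0 < x -> 0 < A -> (m <= N)%N ->
  x / A * (tail_int (A / x * (be + m%:R)) - tail_int (A / x * (be + N%:R))) <=
  \sum_(m <= j < N) ln1DV2 (A * (be + j%:R) / x).
Proof.
move=> be0 x0 A0 mN.
have k0 : 0 < A / x by rewrite divr_gt0.
have := scaled_sum_ge k0 be0 mN (@is_derive_head_int R) (@ln1DV2_decr R).
rewrite invf_div; under eq_bigr do rewrite mulrAC.
apply: le_trans; rewrite /tail_int ler_pM2l ?divr_gt0//.
move: (head_int _) (head_int _) (pi : R) => e1 e2 p; lra.
Qed.

(** Full rows [i < n], the rest of the columns [j < n], and the corner. In the
    second term the factors are exchanged, so that a column is treated as a row. *)
Lemma laplace_exponent_split al be x n N : (n <= N)%N ->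
  laplace_exponent al be N x =
  \sum_(0 <= i < n) \sum_(0 <= j < N) ln1DV2 ((al + i%:R) * (be + j%:R) / x) +
  (\sum_(0 <= j < n) \sum_(n <= i < N) ln1DV2 ((be + j%:R) * (al + i%:R) / x) +
   \sum_(n <= i < N) \sum_(n <= j < N) ln1DV2 ((al + i%:R) * (be + j%:R) / x)).
Proof.
move=> nN; rewrite /laplace_exponent (@big_cat_nat _ _ _ n)//=; congr (_ + _).
under eq_bigr do rewrite (@big_cat_nat _ _ _ n)//=.
rewrite big_split/=; congr (_ + _).
rewrite exchange_big_nat; apply: eq_bigr => j _; apply: eq_bigr => i _.
by rewrite [_ * (al + _)]mulrC.
Qed.

(** The rows give [pi x / a_i] each. A column starts at the cutoff and gives
    [pi x / c_j] minus a multiple of [head_mean]; the corner gives [- pi x] minus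
    [x * int_tail_ratio] at its vertex. The functions [int_head_mean] from the columns and
    from the corner have opposite signs, and only its value near [0] is left. *)
Lemma laplace_exponent_le al be x m N : 0 < al -> 0 < be -> 0 < x -> (m <= N)%N ->
  laplace_exponent al be N.+1 x <=
    m.+1%:R * ln1DV2 (al * be / x) +
    pi * x * (\sum_(0 <= i < m.+1) (al + i%:R)^-1 + \sum_(0 <= j < m.+1) (be + j%:R)^-1 - 1)
    + x * (int_head_mean ((al + m%:R) * be / x) - pi * ln ((al + m%:R) * (be + m%:R) / x)).
Proof.
move=> al0 be0 x0 mN.
pose a := al + m%:R; pose c := be + m%:R.
have a0 : 0 < a by rewrite ltr_pwDl.
have c0 : 0 < c by rewrite ltr_pwDl.
have ai i : 0 < al + i%:R by rewrite ltr_pwDl.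
have bj j : 0 < be + j%:R by rewrite ltr_pwDl.
rewrite (@laplace_exponent_split _ _ _ m.+1)//.
have P1 : \sum_(0 <= i < m.+1) \sum_(0 <= j < N.+1) ln1DV2 ((al + i%:R) * (be + j%:R) / x) <=
  m.+1%:R * ln1DV2 (al * be / x) + pi * x * \sum_(0 <= i < m.+1) (al + i%:R)^-1.
  apply: (@le_trans _ _ (\sum_(0 <= i < m.+1) (ln1DV2 (al * be / x) + pi * x * (al + i%:R)^-1))).
    apply: ler_sum => i _; apply: (le_trans (row_le N be0 x0 (ai i))).
    rewrite lerD//.
      apply: ln1DV2_decr; first by rewrite divr_gt0// mulr_gt0.
      by rewrite ler_pM2r ?invr_gt0// ler_pM2r// lerDl.
    by rewrite mulrC mulrA.
  by rewrite big_split/= -mulr_sumr sumr_const_nat subn0 [m.+1%:R * _]mulr_natl.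
have P2 : \sum_(0 <= j < m.+1) \sum_(m.+1 <= i < N.+1) ln1DV2 ((be + j%:R) * (al + i%:R) / x) <=
  pi * x * \sum_(0 <= j < m.+1) (be + j%:R)^-1
   - x * (int_head_mean (a / x * (be + m.+1%:R)) - int_head_mean (a / x * be)).
  have k0 : 0 < a / x by rewrite divr_gt0.
  have := scaled_sum_ge k0 be0 (leq0n m.+1) (@is_derive_int_head_mean R) (@head_mean_decr R).
  rewrite addr0 invf_div => H.
  apply: (@le_trans _ _ (\sum_(0 <= j < m.+1) (pi * x * (be + j%:R)^-1 - a * head_mean (a / x * (be + j%:R))))).
    apply: ler_sum => j _; apply: (le_trans (tail_row_le al0 x0 (bj j) mN)).
    rewrite /tail_int /head_mean -/a.
    have -> : (be + j%:R) / x * a = a / x * (be + j%:R) by exact: divr_mulAC.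
    have aj0 : a / x * (be + j%:R) != 0 by rewrite lt0r_neq0// mulr_gt0.
    move: (head_int _) (pi : R) => e p; rewrite le_eqVlt; apply/orP; left; apply/eqP.
    have := bj j; move: (be + j%:R) => y y0; field.
    by rewrite !lt0r_neq0.
  rewrite sumrB -!mulr_sumr lerD2l lerN2.
  apply: (le_trans _ (ler_wpM2l (ltW a0) H)).
  by rewrite mulrA mulrCA divff ?mulr1// lt0r_neq0.
have P3 : \sum_(m.+1 <= i < N.+1) \sum_(m.+1 <= j < N.+1) ln1DV2 ((al + i%:R) * (be + j%:R) / x) <=
   x * (- pi - int_tail_ratio (c / x * a)).
  have k0 : 0 < c / x by rewrite divr_gt0.
  have := scaled_sum_le k0 al0 mN (@is_derive_int_tail_ratio R) (@tail_ratio_decr R).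
  rewrite invf_div => H.
  apply: (@le_trans _ _ (\sum_(m.+1 <= i < N.+1) (c * tail_ratio (c / x * (al + i%:R))))).
    apply: ler_sum => i _; apply: (le_trans (tail_row_le be0 x0 (ai i) mN)).
    rewrite /tail_ratio -/c.
    have -> : (al + i%:R) / x * c = c / x * (al + i%:R) by exact: divr_mulAC.
    move: (tail_int _) => e; rewrite le_eqVlt; apply/orP; left; apply/eqP.
    have := ai i; move: (al + i%:R) => y y0; field.
    by rewrite !lt0r_neq0.
  rewrite big_add1/= -mulr_sumr; apply: (le_trans (ler_wpM2l (ltW c0) H)).
  rewrite mulrA mulrCA divff ?mulr1 ?lt0r_neq0// ler_pM2l// lerD2r.
  by apply: int_tail_ratio_le; rewrite mulr_gt0.
apply: (le_trans (lerD P1 (lerD P2 P3))).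
have D1 : int_head_mean (c / x * a) <= int_head_mean (a / x * (be + m.+1%:R)).
  apply: int_head_mean_ndecr; first by rewrite mulr_gt0// divr_gt0.
  have -> : c / x * a = a / x * c by exact: divr_mulAC.
  by rewrite ler_pM2l ?divr_gt0// lerD2l ler_nat.
rewrite -/a -/c /int_tail_ratio.
have -> : a * c / x = c / x * a by rewrite mulrAC; exact: divr_mulAC.
have -> : a * be / x = a / x * be by rewrite mulrAC.
have := ler_wpM2l (ltW x0) D1.
move: (m.+1%:R : R) (\sum_(_ <= _ < _) _) (\sum_(_ <= _ < _) _) (int_head_mean (c / x * a)) (int_head_mean (a / x * (be + m.+1%:R))) (int_head_mean (a / x * be)) (ln _) (pi : R) (ln1DV2 _ ) => y s1 s2 d1 d2 d3 l p f.
lra.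
Qed.

(** The lower counterpart. Here the rows and columns are truncated at [N], which
    costs the terms with [N] in the denominator; they vanish as [N] grows. *)
Lemma laplace_exponent_ge al be x n N : 0 < al -> 0 < be -> 0 < x -> (0 < n <= N)%N ->
  pi * x * (\sum_(0 <= i < n) (al + i%:R)^-1 + \sum_(0 <= j < n) (be + j%:R)^-1 - 1)
  - pi * x * ln ((al + n%:R) * (be + n%:R) / x)
  - (n%:R * be + (al + n%:R)) * head_mean (al * be / x)
  - (4 * x ^+ 2 * (al ^- 2 + al^-1) / (be + N%:R) + 2 * x ^+ 2 * (be ^- 2 + be^-1) / (al + N%:R)
     + 2 * x ^+ 2 / ((be + n%:R) * (al + N%:R)))
  <= laplace_exponent al be N x.
Proof.
move=> al0 be0 x0 /andP[n0 nN].
pose a := al + n%:R; pose c := be + n%:R.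
have a0 : 0 < a by rewrite ltr_pwDl.
have c0 : 0 < c by rewrite ltr_pwDl.
have ai i : 0 < al + i%:R by rewrite ltr_pwDl.
have bj j : 0 < be + j%:R by rewrite ltr_pwDl.
have v0 : 0 < al * be / x by rewrite divr_gt0// mulr_gt0.
rewrite (@laplace_exponent_split _ _ _ n)//.
have P1 : pi * x * \sum_(0 <= i < n) (al + i%:R)^-1
   - 2 * x ^+ 2 * (al ^- 2 + al^-1) / (be + N%:R) - n%:R * be * head_mean (al * be / x) <=
   \sum_(0 <= i < n) \sum_(0 <= j < N) ln1DV2 ((al + i%:R) * (be + j%:R) / x).
  apply: (@le_trans _ _ (\sum_(0 <= i < n) (pi * x * (al + i%:R)^-1 -
      2 * x ^+ 2 / (be + N%:R) * (al + i%:R) ^- 2 - be * head_mean (al * be / x)))).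
    move: (head_mean _) => e0; rewrite !sumrB -!mulr_sumr; apply: lerB; last first.
      by rewrite sumr_const_nat subn0 -[e0 *+ n]mulr_natl mulrCA mulrA.
    rewrite lerD2l lerN2.
    rewrite [leRHS]mulrAC ler_wpM2l//.
      by rewrite divr_ge0 ?mulr_ge0 ?sqr_ge0// ltW.
    exact: sum_inv_sqr_le.
  apply: ler_sum => i _; apply: (le_trans _ (row_ge be0 x0 (ai i) (leq0n N))).
  rewrite addr0 {1}/tail_int.
  have A0 := ai i; have k0 : 0 < (al + i%:R) / x by rewrite divr_gt0.
  have e1 : x / (al + i%:R) * head_int ((al + i%:R) / x * be) = be * head_mean ((al + i%:R) / x * be).
    rewrite /head_mean; move: (head_int _) => e; field; by rewrite !lt0r_neq0.
  have e2 : be * head_mean ((al + i%:R) / x * be) <= be * head_mean (al * be / x).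
    rewrite ler_pM2l//; apply: head_mean_decr => //.
    by rewrite mulrAC ler_pM2r// ler_pM2r ?invr_gt0// lerDl.
  have e3 : x / (al + i%:R) * tail_int ((al + i%:R) / x * (be + N%:R)) <= 2 * x ^+ 2 / (be + N%:R) * (al + i%:R) ^- 2.
    have := tail_int_le (mulr_gt0 k0 (bj N)) => /(ler_wpM2l (ltW (divr_gt0 x0 A0))) /le_trans; apply.
    rewrite le_eqVlt; apply/orP; left; apply/eqP.
    have := bj N; move: (be + N%:R) (al + i%:R) A0 => y z z0 y0; field; by rewrite !lt0r_neq0.
  move: (tail_int _) e3 => P0 e3; move: e1 e2 e3; rewrite !mulrBr.
  move: (x / (al + i%:R) * head_int _) (x / (al + i%:R) * P0) (be * head_mean ((al + i%:R) / x * be)) (be * head_mean (al * be / x)) (2 * x ^+ 2 / _ * _) => E P b1 b2 q -> e2 e3.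
  have -> : x / (al + i%:R) * pi = pi * x * (al + i%:R)^-1 by rewrite mulrC mulrA.
  move: (pi * x * _) => w; lra.
have P2 : pi * x * \sum_(0 <= j < n) (be + j%:R)^-1 - a * head_mean (al * be / x)
   - x * int_head_mean (c / x * a) - 2 * x ^+ 2 * (be ^- 2 + be^-1) / (al + N%:R) <=
   \sum_(0 <= j < n) \sum_(n <= i < N) ln1DV2 ((be + j%:R) * (al + i%:R) / x).
  have k0 : 0 < a / x by rewrite divr_gt0.
  have S1 : \sum_(0 <= j < n) head_mean (a / x * (be + j%:R)) <= head_mean (al * be / x) + x / a * int_head_mean (c / x * a).
    move: n0 nN => {P1}; case En : n => [//|m] _ _.
    rewrite big_nat_recl//= addr0; apply: lerD.
      apply: head_mean_decr => //.
      by rewrite mulrAC ler_pM2r// ler_pM2r ?invr_gt0// lerDl.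
    have := scaled_sum_le k0 be0 (leq0n m) (@is_derive_int_head_mean R) (@head_mean_decr R).
    rewrite invf_div => /le_trans; apply; rewrite ler_pM2l ?divr_gt0// addr0.
    have d0 : 0 <= int_head_mean (a / x * be) by rewrite int_head_mean_ge0// mulr_gt0.
    have : int_head_mean (a / x * (be + m%:R)) <= int_head_mean (c / x * a).
      apply: int_head_mean_ndecr; first by rewrite mulr_gt0.
      have -> : c / x * a = a / x * c by exact: divr_mulAC.
      by rewrite ler_pM2l// lerD2l ler_nat En.
    move: (int_head_mean _) (int_head_mean _) (int_head_mean _) d0 => d1 d2 d3; lra.
  apply: (@le_trans _ _ (\sum_(0 <= j < n) (pi * x * (be + j%:R)^-1 - a * head_mean (a / x * (be + j%:R)) -
      2 * x ^+ 2 / (al + N%:R) * (be + j%:R) ^- 2))).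
    rewrite !sumrB -!mulr_sumr; apply: lerB.
      rewrite -addrA lerD2l -opprD lerN2.
      apply: (le_trans (ler_wpM2l (ltW a0) S1)).
      by rewrite mulrDr lerD2l mulrA mulrCA divff ?mulr1// lt0r_neq0.
    rewrite [leRHS]mulrAC ler_wpM2l//.
      by rewrite divr_ge0 ?mulr_ge0 ?sqr_ge0// ltW.
    exact: sum_inv_sqr_le.
  apply: ler_sum => j _; apply: (le_trans _ (row_ge al0 x0 (bj j) nN)).
  rewrite -/a {1}/tail_int.
  have A0 := bj j; have kj : 0 < (be + j%:R) / x by rewrite divr_gt0.
  have e1 : x / (be + j%:R) * head_int ((be + j%:R) / x * a) = a * head_mean (a / x * (be + j%:R)).
    have -> : (be + j%:R) / x * a = a / x * (be + j%:R) by exact: divr_mulAC.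
    rewrite /head_mean; move: (head_int _) => e; field; by rewrite !lt0r_neq0.
  have e3 : x / (be + j%:R) * tail_int ((be + j%:R) / x * (al + N%:R)) <= 2 * x ^+ 2 / (al + N%:R) * (be + j%:R) ^- 2.
    have := tail_int_le (mulr_gt0 kj (ai N)) => /(ler_wpM2l (ltW (divr_gt0 x0 A0))) /le_trans; apply.
    rewrite le_eqVlt; apply/orP; left; apply/eqP.
    have := ai N; move: (al + N%:R) (be + j%:R) A0 => y z z0 y0; field; by rewrite !lt0r_neq0.
  move: (tail_int _) e3 => P0 e3; move: e1 e3; rewrite !mulrBr.
  move: (x / (be + j%:R) * head_int _) (x / (be + j%:R) * P0) (a * head_mean _) (2 * x ^+ 2 / _ * _) => E P b1 q -> e3.
  have -> : x / (be + j%:R) * pi = pi * x * (be + j%:R)^-1 by rewrite mulrC mulrA.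
  move: (pi * x * _) => w; lra.
have P3 : - pi * x - 2 * x ^+ 2 / (c * (al + N%:R)) - x * int_tail_ratio (c / x * a)
   - 2 * x ^+ 2 * (al ^- 2 + al^-1) / (be + N%:R) <=
   \sum_(n <= i < N) \sum_(n <= j < N) ln1DV2 ((al + i%:R) * (be + j%:R) / x).
  have k0 : 0 < c / x by rewrite divr_gt0.
  have := scaled_sum_ge k0 al0 nN (@is_derive_int_tail_ratio R) (@tail_ratio_decr R).
  rewrite invf_div => H.
  have K1 := int_tail_ratio_ge (mulr_gt0 k0 (ai N)).
  apply: (@le_trans _ _ (\sum_(n <= i < N) (c * tail_ratio (c / x * (al + i%:R)) -
      2 * x ^+ 2 / (be + N%:R) * (al + i%:R) ^- 2))).
    rewrite sumrB -!mulr_sumr; apply: lerB.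
      apply: (le_trans _ (ler_wpM2l (ltW c0) H)).
      rewrite [leRHS]mulrA [X in _ <= X * _]mulrCA divff ?lt0r_neq0// mulr1.
      have := ler_wpM2l (ltW x0) K1; rewrite -/a.
      have -> : x * (- pi - 2 / (c / x * (al + N%:R))) = - pi * x - 2 * x ^+ 2 / (c * (al + N%:R)).
        have := ai N; move: (al + N%:R) (pi : R) => y p y0; field; by rewrite !lt0r_neq0.
      move: (int_tail_ratio _) (int_tail_ratio _) (- pi * x) (2 * _ / _) => k1 k2 p q; lra.
    rewrite [leRHS]mulrAC ler_wpM2l//.
      by rewrite divr_ge0 ?mulr_ge0 ?sqr_ge0// ltW.
    apply: (le_trans _ (sum_inv_sqr_le N al0)).
    rewrite [leRHS](@big_cat_nat _ _ _ n)//= lerDr sumr_ge0// => i _.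
    by rewrite invr_ge0 sqr_ge0.
  apply: ler_sum => i _; apply: (le_trans _ (row_ge be0 x0 (ai i) nN)).
  rewrite -/c mulrBr.
  have A0 := ai i; have ki : 0 < (al + i%:R) / x by rewrite divr_gt0.
  have e1 : x / (al + i%:R) * tail_int ((al + i%:R) / x * c) = c * tail_ratio (c / x * (al + i%:R)).
    have -> : (al + i%:R) / x * c = c / x * (al + i%:R) by exact: divr_mulAC.
    rewrite /tail_ratio; move: (tail_int _) => e; field; by rewrite !lt0r_neq0.
  rewrite e1 lerD2l lerN2.
  have := tail_int_le (mulr_gt0 ki (bj N)) => /(ler_wpM2l (ltW (divr_gt0 x0 A0))) /le_trans; apply.
  rewrite le_eqVlt; apply/orP; left; apply/eqP.
  have := bj N; move: (be + N%:R) (al + i%:R) A0 => y z z0 y0; field; by rewrite !lt0r_neq0.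
apply: (le_trans _ (lerD P1 (lerD P2 P3))).
rewrite -/a -/c /int_tail_ratio.
have -> : a * c / x = c / x * a by rewrite mulrAC; exact: divr_mulAC.
rewrite -[4]/(2 + 2)%:R natrD.
have -> : (2 + 2) * x ^+ 2 * (al ^- 2 + al^-1) / (be + N%:R) =
   2 * x ^+ 2 * (al ^- 2 + al^-1) / (be + N%:R) + 2 * x ^+ 2 * (al ^- 2 + al^-1) / (be + N%:R).
  by rewrite -mulrDl -!mulrDl.
move: (2 * x ^+ 2 * (al ^- 2 + _) / _) (2 * x ^+ 2 * (be ^- 2 + _) / _) (2 * x ^+ 2 / _) => t1 t2 t3.
move: (\sum_(_ <= _ < _) _) (\sum_(_ <= _ < _) _) (int_head_mean _) (ln _) (pi : R) (head_mean _ ) (n%:R : R) => s1 s2 d l p f y.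
lra.
Qed.

End gsum_bounds.

(** * Asymptotics of the Laplace exponent *)

Section gsum_asymptotics.
Context {R : realType}.
Implicit Types (al be x q : R).

Definition laplace_main al be x : R := pi * x * (ln x - Psi al - Psi be - 1).

Lemma harmonic_sum al n : 0 < al ->
  `|\sum_(0 <= i < n) (al + i%:R)^-1 - (ln (al + n%:R) - Psi al)| <= 4 / (al + n%:R).
Proof.
move=> al0; have := Psi_approx n al0; rewrite /digamma_seq.
move: (ln _) (Psi _) (\sum_(_ <= _ < _) _) => l p s.
by rewrite (_ : p - (l - s) = s - (l - p))//; ring.
Qed.

Lemma pi_lt4 : (pi : R) < 4.
Proof. by have := @pihalf_lt2 R; move: (pi : R) => p; lra. Qed.

(** The linear bookkeeping of the upper bound, with all transcendental quantities
    replaced by variables. *)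
Lemma laplace_exponent_up_arith (p x g s1 s2 d la lc lx p1 p2 ai ci F B Q q3 k1 k2 : R) :
  g <= F + p * x * (s1 + s2 - 1) + x * (d - p * (la + lc - lx)) ->
  p * x * (s1 + s2) <= p * x * ((la - p1 + 5 * ai) + (lc - p2 + 5 * ci)) ->
  p * x * ai <= 8 * Q -> p * x * ci <= 8 * Q -> Q <= q3 ->
  x * d <= B -> B <= k2 * q3 -> F <= k1 * q3 ->
  g - p * x * (lx - p1 - p2 - 1) <= (k1 + 80 + k2) * q3.
Proof. lra. Qed.

Lemma laplace_exponent_low_arith (p x g s1 s2 la lc lx p1 p2 ai ci e tl Q q3 k : R) :
  p * x * (s1 + s2 - 1) - p * x * (la + lc - lx) - e - tl <= g ->
  p * x * ((la - p1 - 4 * ai) + (lc - p2 - 4 * ci)) <= p * x * (s1 + s2) ->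
  p * x * ai <= 8 * Q -> p * x * ci <= 8 * Q -> Q <= q3 ->
  e <= k * q3 -> tl <= 1 -> 1 <= q3 ->
  p * x * (lx - p1 - p2 - 1) - g <= (64 + k + 1) * q3.
Proof. lra. Qed.

(** The cutoff is [m ~ sqrt x = q^2]. The digamma approximation is then precise to
    [O (x / m) = O (q^2)], and the first terms of the rows and columns, each of
    order at most [x^(1/4)] by [ln1DV2_le_root], contribute [O (q^3)]. The logarithms of [a],
    [c] and [x] combine to [ln x], whatever the exact cutoff. *)
Lemma laplace_exponent_asymp al be : 0 < al -> 0 < be -> exists2 C : R, 0 < C &
  forall x q : R, 16 <= x -> 0 < q -> x <= q ^+ 4 ->
  \forall N \near \oo, `|laplace_exponent al be N x - laplace_main al be x| <= C * q ^+ 3.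
Proof.
move=> al0 be0.
(* with [q] the fourth root of [x], this makes [x / (al * be) = (q / kp)^4] *)
pose kp := Num.sqrt (Num.sqrt (al * be)).
have ab0 : 0 < al * be by rewrite mulr_gt0.
have kp0 : 0 < kp by rewrite !sqrtr_gt0.
have kp4 : kp ^+ 4 = al * be.
  by rewrite (exprM _ 2 2) !sqr_sqrtr ?sqrtr_ge0// ltW.
pose CU := 16 / kp + 80 + (al + 1) * be * (8 / kp + 4).
pose CL := 64 + (be + al + 1) * (8 / kp + 2) + 1.
have ikp : 0 < kp^-1 by rewrite invr_gt0.
have CU0 : 0 < CU.
  rewrite /CU !addr_gt0 ?mulr_gt0 ?addr_gt0 ?mulr_gt0//.
have CL0 : 0 < CL.
  rewrite /CL !addr_gt0 ?mulr_gt0 ?addr_gt0 ?mulr_gt0//.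
exists (CU + CL); first by rewrite addr_gt0.
move=> x q' x16 q'0 xq'.
pose q := Num.sqrt (Num.sqrt x).
have x0 : 0 < x by lra.
have q0 : 0 < q by rewrite !sqrtr_gt0.
have q4 : q ^+ 4 = x.
  by rewrite (exprM _ 2 2) !sqr_sqrtr ?sqrtr_ge0// ltW.
have qq' : q <= q'.
  by move: xq'; rewrite -q4 ler_pXn2r// nnegrE ltW.
have q2 : 2 <= q.
  have : (2 : R) ^+ 4 <= q ^+ 4 by rewrite q4; lra.
  by rewrite ler_pXn2r// nnegrE ltW.
have q3 : (CU + CL) * q ^+ 3 <= (CU + CL) * q' ^+ 3.
  by apply: ler_wpM2l; [exact/ltW/addr_gt0|rewrite lerXn2r// nnegrE ltW].
pose m := Num.trunc (q ^+ 2).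
have /andP[mq qm] := truncn_itv (sqr_ge0 q); rewrite -/m in mq qm.
rewrite -natr1 in qm.
pose Q := q ^+ 2; have QE : Q = q ^+ 2 by [].
rewrite -QE in mq qm.
have xQ : x = Q ^+ 2 by rewrite -q4 QE -exprM.
have Q4 : 4 <= Q by rewrite QE; nra.
have m1 : (0 < m)%N by rewrite -(ltr0n R); lra.
pose a := al + m%:R; pose c := be + m%:R.
have aQ : Q / 2 <= a by rewrite /a; lra.
have cQ : Q / 2 <= c by rewrite /c; lra.
have aU : a <= (al + 1) * Q by rewrite /a; nra.
have a0 : 0 < a by lra.
have c0 : 0 < c by lra.
have ia : a^-1 <= 2 / Q.
  by rewrite -[2]invrK -invfM lef_pV2 ?posrE//; [rewrite mulrC|rewrite mulr_gt0//; lra].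
have ic : c^-1 <= 2 / Q.
  by rewrite -[2]invrK -invfM lef_pV2 ?posrE//; [rewrite mulrC|rewrite mulr_gt0//; lra].
have ia0 : 0 < a^-1 by rewrite invr_gt0.
have ic0 : 0 < c^-1 by rewrite invr_gt0.
have v0 : 0 < al * be / x by rewrite divr_gt0.
pose f0 := ln1DV2 (al * be / x).
have f0U : f0 <= 8 * (q / kp).
  apply: ln1DV2_le_root => //; first by rewrite divr_gt0.
  by rewrite invf_div expr_div_n q4 kp4.
have f00 : 0 <= f0 by apply: ln1DV2_ge0.
have pi4 := pi_lt4; have pi0 := @pi_gt0 R.
have pxQ : pi * x * (2 / Q) = 2 * pi * Q.
  by rewrite xQ; move: (pi : R) => p; field; lra.
have px0 : 0 < pi * x by rewrite mulr_gt0.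
have pxa : pi * x * a^-1 <= 8 * Q.
  by apply: (le_trans (ler_wpM2l (ltW px0) ia)); rewrite pxQ; move: (pi : R) pi4 pi0 => p; nra.
have pxc : pi * x * c^-1 <= 8 * Q.
  by apply: (le_trans (ler_wpM2l (ltW px0) ic)); rewrite pxQ; move: (pi : R) pi4 pi0 => p; nra.
have Qq : Q <= q ^+ 3 by rewrite QE exprS; nra.
have qkp : 0 < q / kp by rewrite divr_gt0.
have lnac : ln (a * c / x) = ln a + ln c - ln x.
  by rewrite ln_div ?posrE ?mulr_gt0// lnM ?posrE.
have qQ : q * Q = q ^+ 3 by rewrite QE -exprS.
have up N : (m <= N)%N -> laplace_exponent al be N.+1 x - laplace_main al be x <= CU * q ^+ 3.
  move=> mN.
  have H := laplace_exponent_le al0 be0 x0 mN; rewrite -/a -/c -/f0 lnac in H.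
  have stp (e : R) : 0 < e -> 0 < e + m%:R ->
      \sum_(0 <= i < m.+1) (e + i%:R)^-1 <= ln (e + m%:R) - Psi e + 5 * (e + m%:R)^-1.
    move=> e0 em0; have /ler_normlP[_ S] := harmonic_sum m.+1 e0.
    have em1 : - (e + m%:R) < 1 by rewrite ltrNl (lt_trans _ em0)// oppr_lt0.
    have L := ln_leD1 em0 em1.
    have E : e + m.+1%:R = e + m%:R + 1 by rewrite -natr1 addrA.
    rewrite E in S.
    have I : (e + m%:R + 1)^-1 <= (e + m%:R)^-1.
      by rewrite lef_pV2 ?posrE ?(addr_gt0 em0 ltr01) ?em0// lerDl.
    move: S L I; clear; move: (ln _) (ln _) (Psi _) (\sum_(_ <= _ < _) _) (_^-1) (_^-1) => ? ? ? ? ? ?.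
    by lra.
  have Sa := stp _ al0 a0; have Sc := stp _ be0 c0; rewrite -/a in Sa; rewrite -/c in Sc.
  have D1 : x * int_head_mean (a * be / x) <= a * be * (f0 + 4).
    have abx0 : 0 < a * be / x by rewrite divr_gt0// mulr_gt0.
    have fl : ln1DV2 (a * be / x) <= f0.
      apply: ln1DV2_decr => //; rewrite ler_pM2r ?invr_gt0// ler_pM2r//.
      by rewrite /a lerDl.
    apply: (le_trans (ler_wpM2l (ltW x0) (int_head_mean_le abx0))).
    rewrite mulrA [x * _]mulrC divfK ?lt0r_neq0// ler_pM2l ?mulr_gt0//.
    by rewrite lerD2r.
  have B1 : a * be * (f0 + 4) <= (al + 1) * be * (8 / kp + 4) * q ^+ 3.
    apply: (@le_trans _ _ ((al + 1) * Q * be * (8 * (q / kp) + 4))).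
      apply: ler_pM.
      - exact/ltW/mulr_gt0.
      - by apply: addr_ge0.
      - by rewrite ler_pM2r.
      - by rewrite lerD2r.
    have -> : (al + 1) * Q * be * (8 * (q / kp) + 4) = (al + 1) * be * (8 / kp * (q * Q) + 4 * Q) by ring.
    have -> : (al + 1) * be * (8 / kp + 4) * q ^+ 3 = (al + 1) * be * (8 / kp * q ^+ 3 + 4 * q ^+ 3) by ring.
    rewrite qQ; apply: ler_wpM2l; last by rewrite lerD2l ler_wpM2l.
    by rewrite mulr_ge0 ?addr_ge0 ?(ltW be0) ?(ltW al0).
  have B2 : (m.+1%:R : R) * f0 <= 16 / kp * q ^+ 3.
    apply: (@le_trans _ _ ((2 * Q) * (8 * (q / kp)))).
      by apply: ler_pM => //; rewrite -natr1; lra.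
    by rewrite -qQ le_eqVlt; apply/orP; left; apply/eqP; ring.
  have B3 := ler_wpM2l (ltW px0) (lerD Sa Sc).
  exact: (laplace_exponent_up_arith H B3 pxa pxc Qq D1 B1 B2).
have low N : (m <= N)%N -> 
   4 * x ^+ 2 * (al ^- 2 + al^-1) / (be + N%:R) + 2 * x ^+ 2 * (be ^- 2 + be^-1) / (al + N%:R)
     + 2 * x ^+ 2 / (c * (al + N%:R)) <= 1 ->
   laplace_main al be x - laplace_exponent al be N x <= CL * q ^+ 3.
  move=> mN.
  have m1N : (0 < m <= N)%N by rewrite m1.
  have := laplace_exponent_ge al0 be0 x0 m1N; rewrite -/a -/c lnac.
  move: (4 * x ^+ 2 * _ / _ + _ + _) => tl H tail.
  have stp (e : R) : 0 < e -> ln (e + m%:R) - Psi e - 4 * (e + m%:R)^-1 <= \sum_(0 <= i < m) (e + i%:R)^-1.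
    move=> e0; have /ler_normlP[S _] := harmonic_sum m e0.
    by move: S; clear; move: (ln _) (Psi _) (\sum_(_ <= _ < _) _) (_^-1) => ? ? ? ?; lra.
  have Sa := stp _ al0; have Sc := stp _ be0; rewrite -/a in Sa; rewrite -/c in Sc.
  have B1 : (m%:R * be + a) * head_mean (al * be / x) <= (be + al + 1) * (8 / kp + 2) * q ^+ 3.
    apply: (@le_trans _ _ ((be + al + 1) * Q * (8 * (q / kp) + 2))).
      apply: ler_pM.
      - by rewrite addr_ge0 ?(ltW a0)// mulr_ge0// ltW.
      - by rewrite divr_ge0 ?head_int_ge0// ltW.
      - by rewrite -addrA mulrDl; apply: lerD => //; rewrite mulrC ler_pM2l.
      - by apply: (le_trans (head_mean_le v0)); rewrite lerD2r.
    have -> : (be + al + 1) * Q * (8 * (q / kp) + 2) = (be + al + 1) * (8 / kp * (q * Q) + 2 * Q) by ring.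
    have -> : (be + al + 1) * (8 / kp + 2) * q ^+ 3 = (be + al + 1) * (8 / kp * q ^+ 3 + 2 * q ^+ 3) by ring.
    rewrite qQ; apply: ler_wpM2l; last by rewrite lerD2l ler_wpM2l.
    by rewrite !addr_ge0 ?(ltW be0) ?(ltW al0).
  have B3 := ler_wpM2l (ltW px0) (lerD Sa Sc).
  have q31 : 1 <= q ^+ 3 by apply: exprn_ege1; apply: le_trans q2; exact: ler1n.
  exact: (laplace_exponent_low_arith H B3 pxa pxc Qq B1 tail q31).
(* the truncation terms are at most [(T1 + T2 + T3 / c) / N] *)
pose T1 := 4 * x ^+ 2 * (al ^- 2 + al^-1).
pose T2 := 2 * x ^+ 2 * (be ^- 2 + be^-1).
pose T3 := 2 * x ^+ 2.
have sq e : 0 < e -> 0 <= e ^- 2 + e^-1 :> R.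
  by move=> e0; rewrite addr_ge0 ?invr_ge0 ?sqr_ge0// ltW.
have x2k (k : nat) : 0 <= k%:R * x ^+ 2 by rewrite mulr_ge0 ?sqr_ge0.
have T10 : 0 <= T1 by apply: mulr_ge0; [exact: x2k|exact: sq].
have T20 : 0 <= T2 by apply: mulr_ge0; [exact: x2k|exact: sq].
have T30 : 0 <= T3 by exact: x2k.
have tl N : (0 < N)%N -> T1 + T2 + T3 / c <= N%:R ->
   T1 / (be + N%:R) + T2 / (al + N%:R) + T3 / (c * (al + N%:R)) <= 1.
  move=> N0 TN; have N0' : 0 < (N%:R : R) by rewrite ltr0n.
  apply: (@le_trans _ _ ((T1 + T2 + T3 / c) / N%:R)); last by rewrite ler_pdivrMr// mul1r.
  rewrite (mulrDl (T1 + T2)) (mulrDl T1); apply: lerD; first apply: lerD.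
  - by rewrite ler_wpM2l// lef_pV2 ?posrE ?lerDr ?(ltW be0)// ltr_pwDl.
  - by rewrite ler_wpM2l// lef_pV2 ?posrE ?lerDr ?(ltW al0)// ltr_pwDl.
  - rewrite invfM mulrA; apply: ler_wpM2l; first by apply: mulr_ge0 => //; exact: ltW.
    by rewrite lef_pV2 ?posrE ?lerDr ?(ltW al0)// ltr_pwDl.
near=> N.
have N0 : (0 < N)%N by near: N; exact: nbhs_infty_gt.
have mN : (m < N)%N by near: N; exact: nbhs_infty_gt.
have TN : T1 + T2 + T3 / c <= N%:R by near: N; exact: nbhs_infty_ger.
apply: le_trans q3; have q30 : 0 <= q ^+ 3 by rewrite exprn_ge0// ltW.
have u : laplace_exponent al be N x - laplace_main al be x <= CU * q ^+ 3.
  by rewrite -(prednK N0); apply: up; rewrite -ltnS prednK.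
have l := low N (ltnW mN) (tl N N0 TN).
have eU := mulr_ge0 (ltW CU0) q30; have eL := mulr_ge0 (ltW CL0) q30.
move: u l eU eL; rewrite (mulrDl CU CL) ler_norml; clear.
move: (laplace_exponent _ _ _ _) (laplace_main _ _ _) (CU * _) (CL * _) => g1 g2 u1 u2 *; apply/andP; split; lra.
Unshelve. all: by end_near. Qed.

End gsum_asymptotics.

(** * Small ball probabilities *)

Section arithmetic.
Context {R : realType}.
Implicit Types (P X Y e x y : R).

(** Convexity at the saddle point. Passing from [X] to the larger parameter [X (1 + e)] costs
    a definite multiple of [X Y e^2] in the exponent, so the second
    exponential of [chernoff_lower] is negligible when [X Y e^2] is large compared with the error [E]. *)
Lemma gap_above (P X Y e l0 lp c GX GP E : R) : 0 < P -> 0 < X -> 0 < Y -> 0 < e ->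
  Y = l0 + c + 1 -> e <= (1 + e) * lp ->
  GX - P * X * (l0 + c) <= E -> P * (X * (1 + e)) * (l0 + lp + c) - GP <= E ->
  P / 4 * X * Y * (1 - e) * (1 + e) ^+ 2 - GP / 2 <=
  P / 4 * X * Y * (1 - e) - GX / 2 - P / 8 * X * Y * e ^+ 2 + E.
Proof.
move=> P0 X0 Y0 e0 YE lpE HX HP.
have PX : 0 < P * X by rewrite mulr_gt0.
have PXY : 0 < P * X * Y by rewrite mulr_gt0.
have h1 := ler_wpM2l (ltW PX) lpE.
have h2 : 0 <= P * X * Y * e ^+ 2 by rewrite mulr_ge0 ?sqr_ge0// ltW.
have h3 : 0 <= P * X * Y * e ^+ 3 by rewrite mulr_ge0 ?exprn_ge0// ltW.
have l0E : l0 = Y - c - 1 by rewrite YE; ring.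
by rewrite l0E in HX HP; lra.
Qed.

(** The same for the smaller parameter [X (1 - e)]. *)
Lemma gap_below (P X Y e l0 lm c GX GM E : R) : 0 < P -> 0 < X -> 0 < Y -> 0 < e -> e <= 1 / 2 ->
  Y = l0 + c + 1 -> - (1 - e) * lm <= e ->
  GX - P * X * (l0 + c) <= E -> P * (X * (1 - e)) * (l0 + lm + c) - GM <= E ->
  P / 4 * X * Y * (1 - e) - P / 4 * X * Y * (1 + e) * (2 * e - e ^+ 2) - GM / 2 <=
  P / 4 * X * Y * (1 - e) - GX / 2 - P / 8 * X * Y * e ^+ 2 + E.
Proof.
move=> P0 X0 Y0 e0 e1 YE lmE HX HM.
have PX : 0 < P * X by rewrite mulr_gt0.
have PXY : 0 < P * X * Y by rewrite mulr_gt0.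
have h1 := ler_wpM2l (ltW PX) lmE.
have h2 : 0 <= P * X * Y * e ^+ 2 * (1 / 2 - e).
  by rewrite mulr_ge0 ?subr_ge0// mulr_ge0 ?sqr_ge0// ltW.
have l0E : l0 = Y - c - 1 by rewrite YE; ring.
by rewrite l0E in HX HM; lra.
Qed.

Lemma exponent_bound (x y X Y e l : R) : 0 < x -> 5 <= y -> 0 < e -> e <= 1 / 8 -> 
  X = x * (1 + 2 * e) -> Y = y + l -> l <= 2 * e ->
  X * (Y - 2) + X * Y * e <= x * (y - 2) + 5 * e * (x * y).
Proof.
move=> x0 y5 e0 e1 -> -> le.
have -> : x * (1 + 2 * e) * (y + l - 2) + x * (1 + 2 * e) * (y + l) * e =
  x * ((1 + 2 * e) * ((y + l) * (1 + e) - 2)) by ring.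
have -> : x * (y - 2) + 5 * e * (x * y) = x * (y - 2 + 5 * e * y) by ring.
rewrite ler_pM2l//.
apply: (@le_trans _ _ ((1 + 2 * e) * ((y + 2 * e) * (1 + e) - 2))).
  by rewrite ler_pM2l ?lerD2r ?ler_pM2r ?lerD2l//; lra.
have h1 : 0 <= y * (1 - e) by apply: mulr_ge0; lra.
have h2 : 0 <= e * (1 / 8 - e) by apply: mulr_ge0; lra.
have h3 : 0 <= e * (2 * (y * (1 - e)) + 2 - 6 * e - 4 * e ^+ 2) by apply: mulr_ge0; lra.
lra.
Qed.

Lemma expRN2_le : expR (- 2) <= 1 / 4 :> R.
Proof.
have e1 : 2 <= expR 1 :> R by apply: le_trans (expR_ge1Dx 1); lra.
have -> : (- 2 : R) = - (1 + 1) by ring.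
by rewrite expRN expRD div1r lef_pV2 ?posrE ?mulr_gt0 ?expR_gt0//; nra.
Qed.

Lemma expRN1_le : expR (- 1) <= 1 / 2 :> R.
Proof.
have e1 : 2 <= expR 1 :> R by apply: le_trans (expR_ge1Dx 1); lra.
by rewrite expRN div1r lef_pV2 ?posrE ?expR_gt0.
Qed.

Lemma ln1D_ge (e : R) : 0 < e -> e <= (1 + e) * ln (1 + e).
Proof.
move=> e0; have e1 : 0 < 1 + e by lra.
have h : - (1 + e) < - e by lra.
have := ln_leD1 e1 h; rewrite addrK ln1.
have eE : (1 + e) * (e / (1 + e)) = e by field; lra.
rewrite -[X in _ -> X <= _]eE ler_pM2l// mulNr.
by move: (ln _) (e / _) => a c; lra.
Qed.

Lemma ln1B_ge (e : R) : 0 < e -> e < 1 -> - (1 - e) * ln (1 - e) <= e.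
Proof.
move=> e0 e1; have e1' : 0 < 1 - e by lra.
have h : - (1 - e) < e by lra.
have := ln_leD1 e1' h; rewrite subrK ln1.
have eE : (1 - e) * (e / (1 - e)) = e by field; lra.
rewrite -[X in _ -> _ <= X]eE mulNr -mulrN ler_pM2l//.
by move: (ln _) (e / _) => a c; lra.
Qed.

End arithmetic.

Section small_ball.
Context {R : realType} d (T : measurableType d) (P : probability T R).
Context (b delta : R) (xi : nat * nat -> {RV P >-> R}).
Hypotheses (b1 : -1 < b) (d1 : -1 < delta).
Hypothesis indep : mutually_independent pos_pairs xi.
Hypothesis normal : forall ij, pos_pairs ij -> standard_normal (xi ij).

Definition ball_prob r : R := fine (P [set w | (V2 b delta xi w < r%:E)%E]).
Let c0 : R := - Psi (1 + b) - Psi (1 + delta) - 1.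

Lemma laplace_mainE x : laplace_main (1 + b) (1 + delta) x = pi * x * (ln x + c0).
Proof. by rewrite /laplace_main /c0; congr (_ * _); rewrite !addrA. Qed.

Lemma ball_prob_le1 r : ball_prob r <= 1.
Proof.
rewrite -lee_fin fineK; first by apply: probability_le1; exact: measurable_V2_lt.
by rewrite fin_num_measure//; exact: measurable_V2_lt.
Qed.

(** The parameters of [chernoff_lower] are [X] and [X (1 +- e)], and the window
    [rho, q] has relative half-width [e] around the saddle value [Y / (2 pi^3 X)]. By the two
    gap lemmas each of the two correction terms is at most a quarter of the main one. *)
Lemma ball_prob_ge (X Y e r E : R) : 16 <= X * (1 - e) -> 0 < e -> e <= 1 / 8 -> 1 <= Y ->
  Y = ln X + c0 + 1 ->
  (forall z, X * (1 - e) <= z <= X * (1 + e) ->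
     \forall N \near \oo, `|laplace_exponent (1 + b) (1 + delta) N z - pi * z * (ln z + c0)| <= E) ->
  E + 2 <= pi / 8 * X * Y * e ^+ 2 ->
  Y * (1 + e) / (2 * pi ^+ 3 * X) < r ->
  expR (- (pi / 4) * X * (Y - 2) - pi / 4 * X * Y * e - E / 2 - 1) <= ball_prob r.
Proof.
move=> X16 e0 e1 Y1 YE HG HE qr.
have em : 0 < 1 - e by lra.
have X0 : 0 < X by rewrite -(pmulr_lgt0 _ em); lra.
have Xem : 0 < X * (1 - e) by rewrite mulr_gt0.
have Y0 : 0 < Y by lra.
have ep : 0 < 1 + e by lra.
have xm : X * (1 - e) <= X by rewrite ger_pMr//; lra.
have xp : X <= X * (1 + e) by rewrite ler_pMr//; lra.
apply: (P_V2_lt_ge qr); near=> N.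
set rho := Y * (1 - e) / (2 * pi ^+ 3 * X).
set q := Y * (1 + e) / (2 * pi ^+ 3 * X).
have pi0 := @pi_gt0 R.
have GX : `|laplace_exponent (1 + b) (1 + delta) N X - pi * X * (ln X + c0)| <= E.
  by near: N; apply: HG; rewrite xm xp.
have GP : `|laplace_exponent (1 + b) (1 + delta) N (X * (1 + e)) - pi * (X * (1 + e)) * (ln (X * (1 + e)) + c0)| <= E.
  by near: N; apply: HG; rewrite lexx (le_trans xm xp).
have GM : `|laplace_exponent (1 + b) (1 + delta) N (X * (1 - e)) - pi * (X * (1 - e)) * (ln (X * (1 - e)) + c0)| <= E.
  by near: N; apply: HG; rewrite lexx (le_trans xm xp).
apply: le_trans (P_VN_le_ge b delta indep normal N rho q Xem xm xp).
rewrite [ln (X * (1 + e))]lnM ?posrE// in GP.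
rewrite [ln (X * (1 - e))]lnM ?posrE// in GM.
have /ler_normlP[GX1 GX2] := GX.
have /ler_normlP[GP1 _] := GP.
have /ler_normlP[GM1 _] := GM.
rewrite opprB in GP1; rewrite opprB in GM1; rewrite opprB in GX1.
have t1 : tilt X * rho = pi / 4 * X * Y * (1 - e).
  rewrite /tilt /rho; move: (pi : R) pi0 => p p0; field.
  by rewrite !lt0r_neq0.
have t2 : tilt (X * (1 + e)) * rho = pi / 4 * X * Y * (1 - e) * (1 + e) ^+ 2.
  rewrite /tilt /rho; move: (pi : R) pi0 => p p0; field.
  by rewrite !lt0r_neq0.
have t3 : (tilt X - tilt (X * (1 - e))) * q = pi / 4 * X * Y * (1 + e) * (2 * e - e ^+ 2).
  rewrite /tilt /q; move: (pi : R) pi0 => p p0; field.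
  by rewrite !lt0r_neq0.
rewrite t1 t2 t3.
have A1 := gap_above pi0 X0 Y0 e0 YE (ln1D_ge e0) GX2 GP1.
have e12 : e <= 1 / 2 by lra.
have e1' : e < 1 by lra.
have A2 := gap_below pi0 X0 Y0 e0 e12 YE (ln1B_ge e0 e1') GX2 GM1.
set E0 := pi / 4 * X * Y * (1 - e) - laplace_exponent (1 + b) (1 + delta) N X / 2.
have B1 : expR (pi / 4 * X * Y * (1 - e) * (1 + e) ^+ 2 - laplace_exponent (1 + b) (1 + delta) N (X * (1 + e)) / 2)
   <= expR E0 * (1 / 4).
  apply: (@le_trans _ _ (expR (E0 - 2))).
    by rewrite ler_expR; apply: (le_trans A1); rewrite -/E0; move: HE; move: (pi / 8 * _ * _ * _) => h; lra.
  by rewrite expRD ler_pM2l ?expR_gt0// expRN2_le.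
have B2 : expR (pi / 4 * X * Y * (1 - e) - pi / 4 * X * Y * (1 + e) * (2 * e - e ^+ 2) -
     laplace_exponent (1 + b) (1 + delta) N (X * (1 - e)) / 2) <= expR E0 * (1 / 4).
  apply: (@le_trans _ _ (expR (E0 - 2))).
    by rewrite ler_expR; apply: (le_trans A2); rewrite -/E0; move: HE; move: (pi / 8 * _ * _ * _) => h; lra.
  by rewrite expRD ler_pM2l ?expR_gt0// expRN2_le.
apply: (@le_trans _ _ (expR E0 * (1 / 2))); last first.
  by move: B1 B2; move: (expR E0) (expR _) (expR _) => x1 x2 x3; lra.
apply: (@le_trans _ _ (expR (E0 - 1))).
  rewrite ler_expR lerD2r /E0.
  have lE : ln X + c0 = Y - 1 by rewrite YE; ring.
  rewrite lE in GX2.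
  move: GX2; move: (laplace_exponent _ _ _ _) (pi : R) => g p GX2; lra.
by rewrite expRD ler_pM2l ?expR_gt0// expRN1_le.
Unshelve. all: by end_near. Qed.

(** The window is [e = 1 / q = x^(-1/16)]. Any negative power of [x] works for which [x e^2] dominates the
    error [x^(3/4)] of the Laplace exponent; the loss is a relative error
    [O (e)] in the exponent. The lower bound uses the parameter [X = x (1 + 2 e)], so that the
    upper end of its window stays below [r]. *)
Lemma small_ball : exists2 C : R, 0 < C & exists2 Q0 : R, 8 <= Q0 &
  forall q x y r : R, Q0 <= q -> x = q ^+ 16 -> y = ln x + c0 + 1 -> 5 <= y ->
    r = y / (2 * pi ^+ 3 * x) ->
    0 < ball_prob r /\ `|8 * pi ^+ 2 * r * ln (ball_prob r) + y * (y - 2)| <= C * (y ^+ 2 / q).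
Proof.
have al0 : 0 < 1 + b by rewrite -ltrBlDl sub0r; exact: b1.
have be0 : 0 < 1 + delta by rewrite -ltrBlDl sub0r; exact: d1.
have [C C0 asy] := laplace_exponent_asymp al0 be0.
exists (16 * C + 7); first by lra.
(* this threshold makes [x e^2 / 4 = q^14 / 4] exceed [E + 2] with [E = 8 C q^12] *)
exists (32 * C + 8); first by lra.
move=> q x y r Qq xE yE y5 rE.
have pi0 := @pi_gt0 R; have pi2 := @pi_ge2 R.
have q8 : 8 <= q by lra.
have q0 : 0 < q by lra.
pose e := q^-1.
have e0 : 0 < e by rewrite invr_gt0.
have e1 : e <= 1 / 8 by rewrite div1r lef_pV2 ?posrE.
have qe : q * e = 1 by rewrite divff// gt_eqF.
have q1 n : 1 <= q ^+ n by apply: exprn_ege1; lra.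
have x16 : 16 <= x.
  rewrite xE (exprD _ 2 14); have := q1 14%N; move: (q ^+ 14) => z z1; nra.
have x0 : 0 < x by lra.
have q40 : 0 < 2 * q ^+ 4 by rewrite mulr_gt0// exprn_gt0.
pose E := 8 * C * q ^+ 12.
have E0 : 0 < E by rewrite !mulr_gt0// exprn_gt0.
have HG z : x <= z <= 16 * x ->
   \forall N \near \oo, `|laplace_exponent (1 + b) (1 + delta) N z - pi * z * (ln z + c0)| <= E.
  move=> /andP[z1 z2].
  have z16 : 16 <= z by lra.
  have zq : z <= (2 * q ^+ 4) ^+ 4.
    by rewrite exprMn -exprM -xE; move: z2; rewrite -[16]/(16%:R) => z2; lra.
  have := asy z (2 * q ^+ 4) z16 q40 zq; rewrite laplace_mainE.
  have -> : C * (2 * q ^+ 4) ^+ 3 = E by rewrite /E; ring.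
  by [].
have r0 : 0 < r by rewrite rE divr_gt0 ?mulr_gt0 ?exprn_gt0//; lra.
have coef : 8 * pi ^+ 2 * r = 4 * y / (pi * x).
  rewrite rE; move: (pi : R) pi0 => p p0; field; by rewrite !lt0r_neq0.
have coef0 : 0 < 4 * y / (pi * x) by rewrite divr_gt0 ?mulr_gt0//; lra.
have small : 4 * y / (pi * x) * (E / 2 + 1) <= (8 * C + 2) * (y ^+ 2 / q).
  have xq : x = q ^+ 12 * q ^+ 4 by rewrite xE -exprD.
  have q12 := q1 12%N; have q3 := q1 3%N.
  have E2 : E / 2 + 1 <= (4 * C + 1) * q ^+ 12 by rewrite /E; move: (q ^+ 12) q12 => z z1; lra.
  apply: (le_trans (ler_wpM2l (ltW coef0) E2)).
  have -> : 4 * y / (pi * x) * ((4 * C + 1) * q ^+ 12) = (4 * C + 1) * (4 / pi) * (y / q * (q ^+ 3)^-1).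
    rewrite xq; move: (pi : R) pi0 => p pp; field; by rewrite !lt0r_neq0.
  have -> : (8 * C + 2) * (y ^+ 2 / q) = (4 * C + 1) * 2 * (y / q * y) by ring.
  have yq0 : 0 < y / q by rewrite divr_gt0//; lra.
  apply: ler_pM.
  - by rewrite mulr_ge0 ?divr_ge0 ?(ltW pi0)//; lra.
  - by rewrite mulr_ge0 ?(ltW yq0)// invr_ge0 exprn_ge0// ltW.
  - rewrite ler_pM2l; last by lra.
    by rewrite ler_pdivrMr//; lra.
  - rewrite ler_pM2l//; apply: (@le_trans _ _ 1); last by lra.
    by rewrite invf_le1// exprn_gt0.
pose X := x * (1 + 2 * e).
pose l := ln (1 + 2 * e).
have e2 : 0 < 1 + 2 * e by lra.
have l1 : l <= 2 * e by apply: le_ln1Dx; lra.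
have l0 : 0 <= l by apply: ln_ge0; lra.
pose Y := y + l.
have YE : Y = ln X + c0 + 1.
  by rewrite /Y /X lnM ?posrE// yE -/l; move: (ln x) => lx; ring.
have ee : 0 <= e * (1 / 8 - e) by apply: mulr_ge0; lra.
have xX1 : x <= X * (1 - e) by rewrite /X -mulrA ler_pMr//; lra.
have xX2 : X * (1 + e) <= 16 * x.
  by rewrite /X -mulrA mulrC ler_pM2r//; lra.
have lower : expR (- (pi / 4) * X * (Y - 2) - pi / 4 * X * Y * e - E / 2 - 1) <= ball_prob r.
  apply: ball_prob_ge => //.
  - exact: le_trans x16 xX1.
  - by rewrite /Y; lra.
  - move=> z /andP[z1 z2]; apply: HG; by rewrite (le_trans xX1 z1) (le_trans z2 xX2).
  - have xe : x * e ^+ 2 = q ^+ 12 * q ^+ 2.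
      by rewrite xE /e (exprD q 14 2) (exprD q 12 2); field; rewrite lt0r_neq0.
    apply: (@le_trans _ _ (1 / 4 * (x * e ^+ 2))).
      have q12 := q1 12%N; rewrite xe /E; move: (q ^+ 12) q12 => z z1.
      have : (32 * C + 8) <= q ^+ 2 by rewrite expr2; nra.
      move: (q ^+ 2) => w hw; have z0 : 0 <= z by lra.
      have := ler_wpM2l z0 hw; lra.
    have -> : pi / 8 * X * Y * e ^+ 2 = pi / 8 * (X * Y * e ^+ 2) by rewrite !mulrA.
    apply: ler_pM; first by lra.
    - by apply: mulr_ge0; [exact: ltW|exact: sqr_ge0].
    - by lra.
    rewrite ler_pM2r ?exprn_gt0//.
    have Y1 : 1 <= Y by rewrite /Y; lra.
    have xX : x <= X by rewrite /X ler_pMr//; lra.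
    by apply: (le_trans xX); rewrite ler_pMr//; apply: lt_le_trans xX.
  - have X0 : 0 < X by rewrite /X mulr_gt0.
    have k0 : 0 < 2 * pi ^+ 3 :> R by rewrite mulr_gt0// exprn_gt0.
    rewrite rE ltr_pdivrMr ?mulr_gt0//.
    have -> : y / (2 * pi ^+ 3 * x) * (2 * pi ^+ 3 * X) = y * (1 + 2 * e).
      by rewrite /X; move: (pi : R) pi0 => p pp; field; rewrite !lt0r_neq0.
    rewrite /Y; apply: (@le_lt_trans _ _ ((y + 2 * e) * (1 + e))).
      by rewrite ler_pM2r ?lerD2l//; lra.
    have h1 : 0 <= e * (y - 5) by apply: mulr_ge0; lra.
    have h2 : 0 <= e * (1 / 8 - e) by apply: mulr_ge0; lra.
    lra.
have p0 : 0 < ball_prob r by apply: lt_le_trans lower; exact: expR_gt0.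
split => //.
have lnlow : - (pi / 4) * X * (Y - 2) - pi / 4 * X * Y * e - E / 2 - 1 <= ln (ball_prob r).
  by rewrite -ler_expR lnK.
have lnup : ln (ball_prob r) <= pi / 4 * x * y - pi / 2 * x * (y - 1) + E / 2.
  have : \forall N \near \oo, ln (ball_prob r) <= pi / 4 * x * y - pi / 2 * x * (y - 1) + E / 2.
    have hx : x <= x <= 16 * x by rewrite lexx; lra.
    near=> N.
    have /ler_normlP[G1 _] : `|laplace_exponent (1 + b) (1 + delta) N x - pi * x * (ln x + c0)| <= E.
      by near: N; exact: HG.
    have := P_V2_lt_le b delta indep normal N r x0; rewrite -/(ball_prob r).
    rewrite -{1}(lnK p0) ler_expR => /le_trans; apply.
    have -> : tilt x * r = pi / 4 * x * y.
      by rewrite /tilt rE; move: (pi : R) pi0 => p pp; field; rewrite !lt0r_neq0.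
    have lE : ln x + c0 = y - 1 by rewrite yE; ring.
    rewrite lE in G1; move: G1; move: (laplace_exponent _ _ _ _) (pi : R) => g p G1; lra.
  by case=> N _ /(_ N (leqnn N)).
rewrite coef.
have u := ler_wpM2l (ltW coef0) lnup.
have w := ler_wpM2l (ltW coef0) lnlow.
have ex := exponent_bound x0 y5 e0 e1 erefl erefl l1; rewrite -/X -/Y in ex.
have id1 : 4 * y / (pi * x) * (pi / 4 * x * y - pi / 2 * x * (y - 1) + E / 2) =
   - (y * (y - 2)) + (4 * y / (pi * x) * (E / 2 + 1) - 4 * y / (pi * x)).
  by move: (pi : R) pi0 => p pp; field; rewrite !lt0r_neq0.
have id2 (X' Y' : R) : 4 * y / (pi * x) * (- (pi / 4) * X' * (Y' - 2) - pi / 4 * X' * Y' * e - E / 2 - 1) =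
   - (y / x * (X' * (Y' - 2) + X' * Y' * e)) - 4 * y / (pi * x) * (E / 2 + 1).
  by move: (pi : R) pi0 => p pp; field; rewrite !lt0r_neq0.
have id3 : y / x * (x * (y - 2) + 5 * e * (x * y)) = y * (y - 2) + 5 * (y ^+ 2 / q).
  by rewrite /e; field; rewrite !lt0r_neq0.
have yx0 : 0 <= y / x by rewrite divr_ge0 ?(ltW x0)// (le_trans _ y5).
have := ler_wpM2l yx0 ex; rewrite id3 => ex'.
rewrite id1 in u; rewrite id2 in w.
move: u w ex' small; move: (4 * y / (pi * x) * ln _) (4 * y / (pi * x) * (E / 2 + 1)) (y / x * _) => u1 u2 u3.
have yq0 : 0 < y ^+ 2 / q by rewrite divr_gt0// exprn_gt0// (lt_le_trans _ y5).
have Cy : 0 < C * (y ^+ 2 / q) by rewrite mulr_gt0.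
move: (y ^+ 2 / q) yq0 Cy coef0; move: (4 * y / (pi * x)) (y * (y - 2)) => k v w Cw k0 w0.
by rewrite ler_norml => *; apply/andP; split; lra.
Unshelve. all: by end_near. Qed.

End small_ball.

(** * Polynomials with geometrically bounded coefficients *)

Section poly_bounds.
Context {R : realType}.
Implicit Types (p q : {poly R}) (B sg s t : R).

Lemma norm_horner_le p s sg n : 1 <= sg -> `|s| <= sg -> (size p <= n.+1)%N ->
  `|p.[s]| <= (\sum_(i < size p) `|p`_i|) * sg ^+ n.
Proof.
move=> sg1 ssg pn; rewrite horner_coef mulr_suml.
apply: (le_trans (ler_norm_sum _ _ _)); apply: ler_sum => i _.
rewrite normrM normrX ler_wpM2l//.
apply: (@le_trans _ _ (sg ^+ i)).
  by apply: lerXn2r => //; rewrite nnegrE//; exact: le_trans ler01 sg1.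
by apply: ler_weXn2l => //; rewrite -ltnS (leq_trans _ pn).
Qed.

(** The polynomial is dominated, coefficient by coefficient, by a truncated
    geometric series in [sg t]. The scale [sg] is the size of the parameter [s] and
    will grow to infinity, so it is tracked separately from the constant [B]. *)
Definition coef_bound S B sg p := (size p <= S)%N /\ forall j, `|p`_j| <= B * sg ^+ j.

Lemma coef_boundD S1 S2 B1 B2 sg p q : coef_bound S1 B1 sg p -> coef_bound S2 B2 sg q ->
  coef_bound (maxn S1 S2) (B1 + B2) sg (p + q).
Proof.
move=> [sp bp] [sq bq]; split.
  apply: (leq_trans (size_polyD _ _)); rewrite geq_max !leq_max sp sq orbT//.
move=> j; rewrite coefD mulrDl; apply: (le_trans (ler_normD _ _)); exact: lerD.
Qed.

Lemma coef_boundN S B sg p : coef_bound S B sg p -> coef_bound S B sg (- p).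
Proof. by move=> [sp bp]; split=> [|j]; rewrite ?size_polyN ?coefN ?normrN. Qed.

(** At most [S1] of the products in a convolution are nonzero, and each of them has
    the right power of [sg]. *)
Lemma coef_boundM S1 S2 B1 B2 sg p q : 0 <= B1 -> 0 <= B2 -> 0 <= sg ->
  coef_bound S1 B1 sg p -> coef_bound S2 B2 sg q ->
  coef_bound (S1 + S2) (S1%:R * B1 * B2) sg (p * q).
Proof.
move=> B10 B20 sg0 [sp bp] [sq bq]; split.
  apply: (leq_trans (size_polyMleq _ _)); apply: (leq_trans (leq_pred _)).
  exact: leq_add.
move=> j; rewrite coefM; apply: (le_trans (ler_norm_sum _ _ _)).
apply: (@le_trans _ _ (\sum_(i < j.+1) (i < S1)%N%:R * (B1 * B2 * sg ^+ j))).
  apply: ler_sum => i _; rewrite normrM; case: ltnP => iS.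
    rewrite mul1r; apply: (le_trans (ler_pM _ _ (bp i) (bq (j - i)%N))) => //.
    have -> : sg ^+ j = sg ^+ i * sg ^+ (j - i) by rewrite -exprD subnKC// -ltnS.
    by rewrite mulrACA.
  by rewrite nth_default ?normr0 ?mul0r// (leq_trans sp).
rewrite -mulr_suml -!mulrA; apply: ler_wpM2r.
  by rewrite !mulr_ge0// exprn_ge0.
rewrite -natr_sum ler_nat -(big_mkord xpredT (fun i => nat_of_bool (i < S1)%N)).
have -> n : (\sum_(0 <= i < n) (i < S1) = minn n S1)%N; last exact: geq_minr.
elim: n => [|n IH]; first by rewrite big_geq// min0n.
by rewrite big_nat_recr//= IH; case: ltnP => h; lia.
Qed.

Lemma coef_bound_deriv S B sg p : 0 <= B -> 0 <= sg -> coef_bound S B sg p ->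
  coef_bound S (S%:R * B * sg) sg p^`().
Proof.
move=> B0 sg0 [sp bp]; split.
  by apply: (leq_trans (size_poly _ _)); rewrite (leq_trans (leq_pred _)).
move=> j; rewrite coef_deriv -[X in `|X|]mulr_natl normrM normr_nat.
have [jS|Sj] := ltnP j S.
  rewrite -!mulrA -exprS; apply: ler_pM => //; rewrite ?ler_nat//.
by rewrite [p`_j.+1]nth_default ?(leq_trans sp)// ?leqW// normr0 mulr0 !mulr_ge0// exprn_ge0.
Qed.

Lemma horner_tail p n S B sg t : 0 <= B -> 0 <= sg -> 0 <= t -> sg * t <= 1 ->
  coef_bound S B sg p -> (forall j, (j < n)%N -> p`_j = 0) ->
  `|p.[t]| <= S%:R * B * (sg * t) ^+ n.
Proof.
move=> B0 sg0 t0 st1 [sp bp] p0; rewrite (horner_coef_wide t sp).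
have st0 : 0 <= sg * t by rewrite mulr_ge0.
apply: (le_trans (ler_norm_sum _ _ _)).
apply: (@le_trans _ _ (\sum_(i < S) B * (sg * t) ^+ n)); last first.
  by rewrite sumr_const card_ord -[leRHS]mulrA [leRHS]mulr_natl.
apply: ler_sum => i _; have [ni|ni] := ltnP i n.
  by rewrite p0// mul0r normr0 mulr_ge0// exprn_ge0.
rewrite normrM normrX (ger0_norm t0).
apply: (@le_trans _ _ (B * (sg * t) ^+ i)).
  by rewrite exprMn mulrA ler_wpM2r ?exprn_ge0.
by rewrite ler_wpM2l// ler_wiXn2l// st0 st1.
Qed.

Lemma coefXderiv p j : ('X * p^`())`_j = p`_j *+ j.
Proof. by rewrite coefXM; case: j => [|j] /=; rewrite ?mulr0n// coef_deriv. Qed.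

End poly_bounds.

Section pis_recursion.
Context {R : realType}.
Implicit Types (s : R).

Lemma pis2 : pis 2 = 'X :> {poly R}.
Proof. by rewrite pisS// pis1 subrr mul0r scale0r subr0. Qed.

(** In the recursion, a product of two factors of index at least [2] loses two
    degrees against the index, and a product with the factor [pis 1] loses one. *)
Lemma size_pis (m : nat) : (size (pis m : {poly R}) <= m.+1)%N /\ ((2 <= m)%N -> (size (pis m : {poly R}) <= m)%N).
Proof.
elim/ltn_ind: m => -[|[|[|m]]] IH.
- by rewrite pis0 size_poly1.
- by rewrite pis1 size_polyX.
- by rewrite pis2 size_polyX.
have H : (size (pis m.+3 : {poly R}) <= m.+3)%N; last by split => //; rewrite leqW.
rewrite pisS//; apply: (leq_trans (size_polyD _ _)); rewrite geq_max.
have [-> _] := IH m.+2 (leqnn _); rewrite size_polyN andTb.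
apply: (leq_trans (size_scale_leq _ _)).
rewrite big_nat; apply: (big_ind (fun p : {poly R} => (size p <= m.+3)%N)).
- by rewrite size_poly0.
- by move=> p q sp sq; apply: (leq_trans (size_polyD _ _)); rewrite geq_max sp.
move=> l /andP[l1 lm].
have [s1 s1'] := IH l lm.
have lm' : (m.+3 - l < m.+3)%N by rewrite ltn_subrL l1.
have [s2 s2'] := IH _ lm'.
apply: (leq_trans (size_polyMleq _ _)).
case: (leqP 2 l) => [/s1' h1|l2]; first by lia.
have l1' : l = 1%N by lia.
by rewrite l1' in s1 s2' *; have := s2' isT; lia.
Qed.

Lemma horner_pisS k s : (1 <= k)%N ->
  (pis k.+1).[s] = (pis k).[s] - (k%:R - 1) / (2 * k%:R) *
    \sum_(1 <= l < k.+1) (pis l).[s] * (pis (k.+1 - l)).[s] :> R.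
Proof.
move=> k1; rewrite pisS// hornerD hornerN hornerZ horner_sum.
by congr (_ - _ * _); apply: eq_bigr => l _; rewrite hornerM.
Qed.

(** The truncations of the formal solution [W = 1 + e Q], [Q = s + ln W], as
    polynomials in [e] for a fixed value of [s]. *)
Definition Wpoly K s : {poly R} := \poly_(m < K.+1) (pis m).[s].
Definition Qpoly K s : {poly R} := \poly_(j < K) (pis j.+1).[s].

Lemma WpolyE K s : Wpoly K s = 1 + 'X * Qpoly K s.
Proof.
apply/polyP => j; rewrite coefD coef1 coefXM !coef_poly; case: j => [|j] /=.
  by rewrite pis0 hornerC addr0.
by rewrite ltnS add0r.
Qed.

Lemma sum_pis K s j : (j < K)%N ->
  (Qpoly K s * Qpoly K s)`_j = \sum_(1 <= l < j.+2) (pis l).[s] * (pis (j.+2 - l)).[s].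
Proof.
move=> jK; rewrite coefM big_add1 /= big_mkord; apply: eq_bigr => i _.
have ij : (i <= j)%N by rewrite -ltnS.
rewrite !coef_poly (leq_ltn_trans ij jK) (leq_ltn_trans (leq_subr i j) jK).
by rewrite subSS subSn.
Qed.

(** Up to the order of truncation, [Q' = W' / W]. Doubled, the coefficient of
    [e^j] in [Q' (1 + e Q) = Q + e Q'] is the recursion defining [pis]. *)
Lemma Wpoly_ode K s j : (j.+1 < K)%N ->
  ((Qpoly K s)^`() * Wpoly K s - (Wpoly K s)^`())`_j = 0.
Proof.
move=> jK; have jK' := ltnW jK.
set Q := Qpoly K s.
set W := Wpoly K s.
have E : (Q^`() * W - W^`()) *+ 2 = Q^`() *+ 2 + 'X * (Q * Q)^`() - Q *+ 2 - ('X * Q^`()) *+ 2.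
  rewrite /W WpolyE -/Q derivD derivM derivX derivM -[1]/(1%:P) derivC.
  move: (Q^`()) => Q'; ring.
have : ((Q^`() * W - W^`()) *+ 2)`_j = 0.
  rewrite E !coefB coefD !coefMn !coefXderiv coef_deriv sum_pis// !coef_poly jK jK' (horner_pisS s (ltn0Sn j)).
  move: (\sum_(_ <= _ < _) _) (pis j.+1).[s] => S v.
  have j0 : (j.+1%:R : R) != 0 by rewrite pnatr_eq0.
  have mS (z : R) : z *+ j.+1 = z * j%:R + z by rewrite mulrSr mulr_natr.
  have m0 (z : R) : z *+ j = z * j%:R by rewrite mulr_natr.
  rewrite -natr1 mS (m0 S) (m0 v).
  rewrite -natr1 in j0; move: (j%:R : R) j0 => y y0; field.
  by rewrite y0.
by rewrite coefMn => /eqP; rewrite mulrn_eq0 /= => /eqP.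
Qed.

End pis_recursion.

(** * Expansion of the root of the implicit equation *)

Section expansion.
Context {R : realType}.
Implicit Types (s sg e w t : R).

Lemma Wpoly_bound K : exists2 B : R, 1 <= B & forall s sg, 1 <= sg -> `|s| <= sg ->
  coef_bound K.+1 B sg (Wpoly K s).
Proof.
pose c (m : nat) : R := \sum_(i < size (pis m : {poly R})) `|(pis m : {poly R})`_i|.
have c0 m : 0 <= c m by apply: sumr_ge0.
exists (1 + \sum_(m < K.+1) c m); first by rewrite lerDl sumr_ge0.
move=> s sg sg1 ssg; split; first exact: size_poly.
have sg0 : 0 <= sg by lra.
move=> j; rewrite coef_poly; case: ltnP => jK; last first.
  by rewrite normr0 mulr_ge0 ?exprn_ge0// addr_ge0// sumr_ge0.
apply: (le_trans (norm_horner_le sg1 ssg (size_pis j).1)).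
rewrite ler_wpM2r ?exprn_ge0//.
apply: (@le_trans _ _ (\sum_(m < K.+1) c m)); last by rewrite lerDr.
by rewrite (bigD1 (Ordinal jK))//= lerDl sumr_ge0.
Qed.

(** The truncated formal expansion of [w^2 - 2 e w]. *)
Definition Rpoly K s : {poly R} := Wpoly K s * Wpoly K s - ('X * Wpoly K s) *+ 2.

Lemma p_coefS k s : (2 <= k)%N ->
  p_coef k.+1 s = - (2 / (k%:R - 1)) * ((pis k.+1).[s] - (pis k).[s]).
Proof.
case: k => [|[|k]]// _; rewrite /p_coef /=; congr (- (_ / _) * _).
by rewrite -natr1; ring.
Qed.

(** The convolution in [W^2] is the one in the recursion of [pis], which expresses
    it through [pis m] and [pis m.-1]. *)
Lemma Rpoly_coef K s m : (0 < m <= K)%N -> (Rpoly K s)`_m = p_coef m s.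
Proof.
case: m => // m /andP[_ mK].
rewrite /Rpoly coefB coefMn coefXM coefM /= -(big_mkord xpredT (fun i => (Wpoly K s)`_i * (Wpoly K s)`_(m.+1 - i))).
rewrite big_ltn// big_nat_recr//= subn0 subnn.
have Wc i : (i <= m.+1)%N -> (Wpoly K s)`_i = (pis i).[s].
  by move=> im; rewrite coef_poly ltnS (leq_trans im mK).
rewrite !Wc// pis0 hornerC mul1r mulr1.
have -> : \sum_(1 <= i < m.+1) (Wpoly K s)`_i * (Wpoly K s)`_(m.+1 - i) =
   \sum_(1 <= i < m.+1) (pis i).[s] * (pis (m.+1 - i)).[s].
  rewrite !big_nat; apply: eq_bigr => i /andP[i1 im].
  by rewrite !Wc ?leq_subr// ltnW.
case: m mK Wc => [|[|m]] mK Wc.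
- by rewrite big_geq// pis0 pis1 hornerX hornerC /p_coef/=; ring.
- by rewrite big_nat1 subSS subn0 pis2 pis1 hornerX /p_coef/= expr2; ring.
rewrite p_coefS// (horner_pisS s (ltn0Sn m.+1)).
move: (\sum_(_ <= _ < _) _) (pis m.+2).[s] => S v.
have m10 : (m.+1%:R : R) != 0 by rewrite pnatr_eq0.
have m20 : (m.+2%:R : R) != 0 by rewrite pnatr_eq0.
have e2 : (m.+2%:R : R) = m.+1%:R + 1 by rewrite natr1.
rewrite e2 in m20 *; move: (m.+1%:R : R) m10 m20 => y y0 y1.
field; apply/andP; split => //; move: y0; by rewrite addrK.
Qed.

Lemma Rpoly_coef0 K s : (Rpoly K s)`_0 = 1.
Proof.
by rewrite /Rpoly coefB coefMn coefXM /= mul0rn subr0 coef0M coef_poly /= pis0 hornerC mulr1.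
Qed.

Lemma ln_lipschitz w v : 1 / 2 <= w -> 1 / 2 <= v -> `|ln w - ln v| <= 2 * `|w - v|.
Proof.
wlog vw : w v / v <= w => [W w2 v2|w2 v2].
  have [|/ltW wv] := leP v w; first by move=> ?; exact: W.
  by rewrite distrC (distrC w); exact: W.
have v0 : 0 < v by lra.
have w0 : 0 < w by lra.
have h : - v < w - v by lra.
have := ln_leD1 v0 h; rewrite addrCA subrr addr0 => H.
have lw : ln v <= ln w by rewrite ler_ln ?posrE.
rewrite !ger0_norm ?subr_ge0//.
have : (w - v) / v <= 2 * (w - v).
  by rewrite mulrC ler_wpM2r ?subr_ge0// -[leRHS]invrK lef_pV2 ?posrE ?invr_gt0//; lra.
by move: H; move: (ln w) (ln v) ((w - v) / v) => *; lra.
Qed.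

Lemma coef_bound_le S1 S2 B1 B2 sg (p : {poly R}) : 0 <= sg -> (S1 <= S2)%N -> B1 <= B2 ->
  coef_bound S1 B1 sg p -> coef_bound S2 B2 sg p.
Proof.
move=> sg0 S12 B12 [sp bp]; split; first exact: leq_trans S12.
by move=> j; apply: (le_trans (bp j)); rewrite ler_wpM2r// exprn_ge0.
Qed.

(** The chain of error bounds of [root_expansion], freed of its analytic content. *)
Lemma expansion_arith (a c p dw eg u v z z1 z2 : R) :
  a <= 4 * dw -> c <= v * z1 -> p <= z * z2 -> dw <= 2 * eg -> eg <= 2 * u * z1 ->
  0 <= u -> 0 <= v -> 0 <= z -> 0 <= z1 -> 0 <= z2 ->
  a + c + p <= (1 + 16 * u + v + z) * (z1 + z2).
Proof.
move=> h1 h2 h3 h4 h5 u0 v0 z0 z10 z20.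
have y1 := mulr_ge0 u0 z10; have y2 := mulr_ge0 v0 z10; have y3 := mulr_ge0 z0 z10.
have y4 := mulr_ge0 u0 z20; have y5 := mulr_ge0 v0 z20; have y6 := mulr_ge0 z0 z20.
lra.
Qed.

(** With [g t = Q t - s - ln (W t)], one has [g 0 = 0] and [g'] is small by
    [Wpoly_ode], so [W e] solves the implicit equation up to [e * g e]. The map
    [w |-> 1 + e (s + ln w)] contracts by [1 / 2] for small [e], hence [W e] is close to
    the root. One more term than needed is kept in [W]: its coefficient has degree at most [k] in [s],
    which gives the second part of the error, and the rest is [O ((sg e)^(k+2))]. *)
Lemma root_expansion k : (2 <= k)%N -> exists2 C : R, 0 < C & exists2 th : R, 0 < th &
  forall s sg e w, 1 <= sg -> `|s| <= sg -> 0 < e -> sg * e <= th ->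
    1 / 2 <= w -> w <= 2 -> w = 1 + e * (s + ln w) ->
    `|w ^+ 2 - 2 * e * w - (1 + \sum_(1 <= m < k.+1) p_coef m s * e ^+ m)| <=
    C * ((sg * e) ^+ k.+2 + sg ^+ k * e ^+ k.+1).
Proof.
move=> k2; pose K := k.+1.
have [B B1 HB] := Wpoly_bound K.
pose KR : R := K.+1%:R.
have KR1 : 1 <= KR by rewrite /KR ler1n.
have B0 : 0 <= B by lra.
have KRB : 1 <= KR * B by nra.
(* this keeps [W t] within [1 / 4] of [1], so that [ln (W t)] is defined *)
pose th := (4 * (KR * B))^-1.
have th0 : 0 < th by rewrite invr_gt0; nra.
have thE : KR * B * th = 1 / 4 by rewrite /th; field; lra.
have th4 : th <= 1 / 4.
  by rewrite -thE ler_pMl.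
pose BN := K%:R * (K%:R * B) * B + KR * B.
have BN0 : 0 <= BN by rewrite addr_ge0 ?mulr_ge0//; lra.
pose SN : R := (maxn (K + K.+1) K.+1)%:R.
have SN0 : 0 <= SN by rewrite ler0n.
pose BR := KR * B * B + (B + B).
have BR0 : 0 <= BR by rewrite !addr_ge0// !mulr_ge0//; lra.
pose SR := maxn (K.+1 + K.+1) K.+2.
pose cp : R := 2 / (k%:R - 1) * (\sum_(i < size (pis k.+1 : {poly R})) `|(pis k.+1 : {poly R})`_i| + \sum_(i < size (pis k : {poly R})) `|(pis k : {poly R})`_i|).
have k10 : 0 < (k%:R - 1 : R) by rewrite subr_gt0 ltr1n.
have cp0 : 0 <= cp by rewrite mulr_ge0 ?addr_ge0 ?sumr_ge0// divr_ge0// ltW.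
have SRB0 : 0 <= SR%:R * BR by rewrite mulr_ge0.
have SNB0 : 0 <= SN * BN by rewrite mulr_ge0.
exists (1 + 16 * (SN * BN) + SR%:R * BR + cp).
  by rewrite -!addrA ltr_pwDl// !addr_ge0// mulr_ge0.
exists th => // s sg e w sg1 ssg e0 sgth w1 w2 wE.
have sg0 : 0 <= sg by lra.
have sge0 : 0 <= sg * e by rewrite mulr_ge0// ltW.
have e4 : e <= 1 / 4 by nra.
have HW := HB s sg sg1 ssg.
set W := Wpoly K s in HW.
set Q := Qpoly K s.
have WQ : W = 1 + 'X * Q by exact: WpolyE.
have small t : 0 <= t -> t <= e -> sg * t <= th by move=> t0 te; apply: le_trans sgth; rewrite ler_wpM2l.
have HXQ : coef_bound K.+1 B sg ('X * Q).
  have XQE : 'X * Q = W - 1 by rewrite WQ addrAC subrr add0r.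
  have h0 j : ('X * Q)`_j = if j == 0%N then 0 else W`_j.
    by rewrite WQ coefD coef1 coefXM; case: j => // j; rewrite add0r.
  split.
    rewrite -[X in (_ <= X)%N]maxnn XQE; apply: (leq_trans (size_polyD _ _)).
    by rewrite maxnn geq_max HW.1 size_polyN size_poly1.
  move=> j; rewrite h0; case: ifP => _; last exact: HW.2.
  by rewrite normr0 mulr_ge0// exprn_ge0.
have W1 t : 0 <= t -> t <= e -> `|W.[t] - 1| <= 1 / 4.
  move=> t0 te; have st := small t t0 te.
  rewrite WQ hornerD hornerC addrAC subrr add0r.
  apply: (le_trans (horner_tail (n := 1) B0 sg0 t0 _ HXQ _)).
  - by apply: (le_trans st); lra.
  - by case=> // _; rewrite coefXM.
  by rewrite expr1 -thE ler_wpM2l//; lra.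
have Wge t : 0 <= t -> t <= e -> 3 / 4 <= W.[t].
  by move=> t0 te; have := W1 t t0 te; rewrite ler_norml => /andP[]; move: (W.[t]) => *; lra.
have Wle t : 0 <= t -> t <= e -> W.[t] <= 2.
  by move=> t0 te; have := W1 t t0 te; rewrite ler_norml => /andP[]; move: (W.[t]) => *; lra.
have HQ : coef_bound K (B * sg) sg Q.
  split; first exact: size_poly.
  move=> j; have := HW.2 j.+1; rewrite WQ coefD coef1 coefXM /= add0r => h.
  by rewrite -mulrA -exprS.
have Bsg0 : 0 <= B * sg by rewrite mulr_ge0.
have HN : coef_bound (maxn (K + K.+1) K.+1) (BN * sg ^+ 2) sg (Q^`() * W - W^`()).
  have h1 := coef_boundM (mulr_ge0 (mulr_ge0 (ler0n R K) Bsg0) sg0) B0 sg0 (coef_bound_deriv Bsg0 sg0 HQ) HW.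
  have h2 := coef_boundN (coef_bound_deriv B0 sg0 HW).
  apply: coef_bound_le (coef_boundD h1 h2) => //.
  have -> : BN * sg ^+ 2 = K%:R * (K%:R * B) * B * sg ^+ 2 + KR * B * sg ^+ 2 by exact: mulrDl.
  apply: lerD.
    by rewrite le_eqVlt; apply/orP; left; apply/eqP; ring.
  by rewrite ler_wpM2l ?mulr_ge0// ?ler0n// expr2 ler_peMl.
pose g t := Q.[t] - s - ln W.[t].
have dg t : 0 <= t -> t <= e -> is_derive t 1 g ((Q^`() * W - W^`()).[t] / W.[t]).
  move=> t0 te; have W0 : 0 < W.[t] by have := Wge t t0 te; lra.
  have h1 := is_derive_poly Q t.
  have h2 := is_derive1_comp (is_derive1_ln W0) (is_derive_poly W t).
  have h3 : is_derive t 1 (cst (- s)) (0 : R) by exact: is_derive_cst.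
  have := is_deriveB (is_deriveD h1 h3) h2.
  have -> : Q^`().[t] + 0 - W.[t]^-1 * W^`().[t] = (Q^`() * W - W^`()).[t] / W.[t].
    by rewrite hornerD hornerN hornerM; move: (W.[t]) W0 => y y0; field; lra.
  by [].
have g0 : g 0 = 0.
  rewrite /g !horner_coef0 /W /Q !coef_poly /= pis0 pis1 hornerC hornerX ln1; ring.
have [xi xie gE] : exists2 xi, xi \in `[0, e] & g e - g 0 = (Q^`() * W - W^`()).[xi] / W.[xi] * (e - 0).
  apply: (MVT_segment (ltW e0)).
    by move=> t; rewrite in_itv/= => /andP[t0 te]; apply: dg; exact: ltW.
  apply: derivable_within_continuous => t; rewrite in_itv/= => /andP[t0 te].
  by have h := dg t t0 te; exact: ex_derive.
move: xie; rewrite in_itv/= => /andP[xi0 xie].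
rewrite g0 !subr0 in gE.
have gB : `|e * g e| <= 2 * (SN * BN) * (sg * e) ^+ k.+2.
  have Wxi := Wge xi xi0 xie.
  have Nb := horner_tail (mulr_ge0 BN0 (sqr_ge0 sg)) sg0 xi0 (_ : sg * xi <= 1) HN (n := k).
  have {}Nb := Nb _ _.
  have : `|(Q^`() * W - W^`()).[xi]| <= SN * (BN * sg ^+ 2) * (sg * xi) ^+ k.
    apply: Nb.
      by apply: (le_trans (small xi xi0 xie)); lra.
    by move=> j jk; apply: Wpoly_ode.
  move=> Nb'.
  rewrite gE !normrM normfV (gtr0_norm e0) (gtr0_norm (_ : 0 < W.[xi])); last by lra.
  have iW : W.[xi]^-1 <= 2.
    by move: Wxi; clear; move: (W.[xi]) => v vW; rewrite -[leRHS]invrK lef_pV2 ?posrE ?invr_gt0//; lra.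
  have xik : (sg * xi) ^+ k <= (sg * e) ^+ k.
    by apply: lerXn2r; rewrite ?nnegrE ?mulr_ge0 ?(ltW e0)// ler_wpM2l.
  have -> : 2 * (SN * BN) * (sg * e) ^+ k.+2 = e * (SN * (BN * sg ^+ 2) * (sg * e) ^+ k * 2 * e).
    have h (S1 B2 z : R) : 2 * (S1 * B2) * (z * (sg * e) ^+ 2) = e * (S1 * (B2 * sg ^+ 2) * z * 2 * e) by ring.
    by have -> : (sg * e) ^+ k.+2 = (sg * e) ^+ k * (sg * e) ^+ 2 by rewrite -exprD addn2.
  rewrite ler_pM2l// ler_pM2r//; apply: ler_pM; rewrite ?invr_ge0//; first by lra.
  by apply: (le_trans Nb'); rewrite ler_wpM2l// mulr_ge0// mulr_ge0// sqr_ge0.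
have wW : `|w - W.[e]| <= 2 * `|e * g e|.
  have We := Wge e (ltW e0) (lexx e).
  have E : w - W.[e] = e * (ln w - ln W.[e]) - e * g e.
    by rewrite {1}wE {1}WQ hornerD hornerC hornerM hornerX /g; ring.
  have L : `|ln w - ln W.[e]| <= 2 * `|w - W.[e]| by apply: ln_lipschitz => //; lra.
  have : `|w - W.[e]| <= e * `|ln w - ln W.[e]| + `|e * g e|.
    by rewrite {1}E (le_trans (ler_normB _ _))// normrM (gtr0_norm e0).
  have := ler_wpM2l (ltW e0) L; have := ler_wpM2r (normr_ge0 (w - W.[e])) e4.
  clear; move: (`|w - W.[e]|) (`|ln w - _|) (`|e * g e|) => *; lra.
have F1 : `|(w ^+ 2 - 2 * e * w) - (W.[e] ^+ 2 - 2 * e * W.[e])| <= 4 * `|w - W.[e]|.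
  have We := Wge e (ltW e0) (lexx e); have We' := Wle e (ltW e0) (lexx e).
  have -> : (w ^+ 2 - 2 * e * w) - (W.[e] ^+ 2 - 2 * e * W.[e]) = (w + W.[e] - 2 * e) * (w - W.[e]) by ring.
  rewrite normrM ler_wpM2r// ger0_norm; lra.
have HR : coef_bound SR BR sg (Rpoly K s).
  have h1 := coef_boundM B0 B0 sg0 HW HW.
  have h2 : coef_bound K.+2 B sg ('X * W).
    split.
      by apply: (leq_trans (size_polyMleq _ _)); rewrite size_polyX addSn /= add1n ltnS HW.1.
    move=> j; rewrite coefXM; case: j => [|j] /=; first by rewrite normr0 mulr_ge0.
    apply: (le_trans (HW.2 j)); rewrite ler_wpM2l// exprS ler_peMl// exprn_ge0//.
  have h3 := coef_boundN (coef_boundD h2 h2); rewrite maxnn in h3.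
  by rewrite /Rpoly -/W mulr2n; exact: (coef_boundD h1 h3).
have REe : (Rpoly K s).[e] = W.[e] ^+ 2 - 2 * e * W.[e].
  by rewrite /Rpoly -/W hornerD hornerN hornerMn !hornerM hornerX; ring.
pose T := \poly_(m < K.+1) (Rpoly K s)`_m.
have TE : T.[e] = 1 + \sum_(1 <= m < K.+1) p_coef m s * e ^+ m.
  rewrite horner_poly -(big_mkord xpredT (fun m => (Rpoly K s)`_m * e ^+ m)) big_ltn//.
  rewrite Rpoly_coef0 expr0 mulr1; congr (_ + _); rewrite !big_nat; apply: eq_bigr => m mK.
  by rewrite Rpoly_coef.
have F2 : `|(Rpoly K s).[e] - T.[e]| <= SR%:R * BR * (sg * e) ^+ k.+2.
  rewrite -hornerN -hornerD; apply: horner_tail => //.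
  - exact: ltW.
  - by apply: (le_trans sgth); lra.
  - split.
      apply: (leq_trans (size_polyD _ _)); rewrite geq_max HR.1 size_polyN.
      by apply: (leq_trans (size_poly _ _)); rewrite /SR leq_max leq_addr.
    move=> j; rewrite coefB coef_poly; case: ifP => _; last by rewrite subr0; exact: HR.2.
    by rewrite subrr normr0 mulr_ge0// exprn_ge0.
  - by move=> j jk; rewrite coefB coef_poly jk subrr.
have F3 : `|p_coef K s * e ^+ K| <= cp * (sg ^+ k * e ^+ k.+1).
  rewrite normrM normrX (gtr0_norm e0) mulrA ler_wpM2r ?exprn_ge0 ?(ltW e0)//.
  rewrite p_coefS// normrM normrN (ger0_norm (_ : 0 <= 2 / (k%:R - 1))); last by rewrite divr_ge0// ltW.
  rewrite /cp -[leRHS]mulrA; apply: ler_wpM2l; first by rewrite divr_ge0// ltW.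
  rewrite mulrDl (le_trans (ler_normB _ _))// lerD//.
    apply: norm_horner_le => //; apply: (size_pis _).2; exact: ltnW.
  apply: norm_horner_le => //; apply: (leq_trans ((size_pis _).2 k2)); exact: leqnSn.
have sumE : \sum_(1 <= m < K.+1) p_coef m s * e ^+ m = \sum_(1 <= m < k.+1) p_coef m s * e ^+ m + p_coef K s * e ^+ K.
  by rewrite big_nat_recr.
rewrite sumE addrA in TE.
move: F1 F2 F3 wW gB; rewrite REe TE.
have z1 : 0 <= (sg * e) ^+ k.+2 by rewrite exprn_ge0.
have z2 : 0 <= sg ^+ k * e ^+ k.+1 by rewrite mulr_ge0 ?exprn_ge0// ltW.
move: (\sum_(1 <= m < k.+1) _) (p_coef K s * e ^+ K) => S pk.
set a1 := w ^+ 2 - _; set a2 := W.[e] ^+ 2 - _.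
set Z1 := (sg * e) ^+ k.+2 in z1 *; set Z2 := sg ^+ k * e ^+ k.+1 in z2 *.
move=> F1 F2 F3 wW gB.
have -> : a1 - (1 + S) = (a1 - a2) + (a2 - (1 + S + pk)) + pk by ring.
apply: (le_trans (ler_normD _ _)).
apply: (@le_trans _ _ (`|a1 - a2| + `|a2 - (1 + S + pk)| + `|pk|)).
  by rewrite lerD2r; exact: ler_normD.
exact: (expansion_arith F1 F2 F3 wW gB SNB0 SRB0 cp0 z1 z2).
Qed.

End expansion.

(** * From the saddle point to the expansion in the logarithm *)

Section assembly.
Context {R : realType}.

Lemma sqrt4K (x : R) : 0 <= x -> Num.sqrt (Num.sqrt x) ^+ 4 = x.
Proof. by move=> x0; rewrite (exprM _ 2 2) !sqr_sqrtr ?sqrtr_ge0. Qed.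

Lemma ln_le_root (l : R) : 0 < l -> ln l <= 4 * Num.sqrt (Num.sqrt l).
Proof.
move=> l0; set z := Num.sqrt (Num.sqrt l).
have z0 : 0 < z by rewrite !sqrtr_gt0.
have -> : l = z ^+ 4 by rewrite sqrt4K// ltW.
rewrite lnXn// -[leLHS]mulr_natl ler_pM2l//.
exact/ltW/ln_sublinear.
Qed.

Lemma expRN_le_pow (l : R) (n : nat) : 0 < l -> 16 ^+ n.+1 * n.+1`!%:R <= l ->
  expR (- (l / 16)) <= l ^- n.
Proof.
move=> l0 hl; rewrite expRN lef_pV2 ?posrE ?expR_gt0 ?exprn_gt0//.
have l160 : 0 <= l / 16 by rewrite divr_ge0// ltW.
apply: (@le_trans _ _ ((l / 16) ^+ n.+1 / n.+1`!%:R)); last first.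
  by apply: (le_trans _ (expR_ge1Dxn n l160)); rewrite lerDr.
have F0 : 0 < (n.+1`!%:R : R) by rewrite ltr0n fact_gt0.
rewrite ler_pdivlMr// expr_div_n ler_pdivlMr ?exprn_gt0// [leRHS]exprSr -mulrA.
by rewrite ler_pM2l ?exprn_gt0// mulrC.
Qed.

(** The intermediate value theorem on [[l / 2, 2 l]]. Solving for [y], and only then
    defining [x] by [r = y / (2 pi^3 x)], produces the saddle point for a given [r]. *)
Lemma implicit_root (l kp : R) : 4 <= l -> 2 * `|kp| <= l -> ln l + ln 2 + `|kp| <= l ->
  exists2 y, l / 2 <= y <= 2 * l & y = ln y + l + kp.
Proof.
move=> l4 lk lln.
have l0 : 0 < l by lra.
have ab : l / 2 <= 2 * l by lra.
pose f (y : R) := y + (-1) * ln y.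
have df (y : R) : 0 < y -> derivable f y 1.
  move=> y0; have h := is_deriveD (is_derive_id y (1 : R)) (is_deriveZ (-1) (is_derive1_ln y0)).
  exact: (@ex_derive _ _ _ _ _ _ _ h).
have cf : {within `[l / 2, 2 * l], continuous f}.
  apply: derivable_within_continuous => y; rewrite in_itv/= => /andP[y1 _].
  by apply: df; lra.
have /ler_normlP[k1 k2] := lexx `|kp|.
have fa : f (l / 2) <= l + kp.
  rewrite /f mulN1r; have : 0 <= ln (l / 2) by apply: ln_ge0; lra.
  by move: (ln _) => a; lra.
have fb : l + kp <= f (2 * l).
  rewrite /f mulN1r lnM ?posrE//; move: lln k2; move: (ln l) (ln 2) => a c; lra.
have [|c] := @IVT R f (l / 2) (2 * l) (l + kp) ab cf.
  by rewrite ge_min fa/= le_max fb orbT.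
rewrite in_itv/= => cI fc; exists c => //.
by move: fc; rewrite /f mulN1r; move: (ln c) => a; lra.
Qed.

(** The powers of [ln l] that occur are absorbed by [l] through the crude bound
    [ln l <= 4 l^(1/4)]. *)
Lemma ln_scale (l kp th : R) : 0 < th -> 256 <= l -> (8 / th) ^+ 4 <= l -> 2 * `|kp| <= l ->
  [/\ ln l ^+ 2 <= l, ln l + ln 2 + `|kp| <= l & 2 * ln l <= th * l].
Proof.
move=> th0 l256 lth lk.
have l0 : 0 < l by apply: lt_le_trans l256; rewrite ltr0n.
have := ln_le_root l0; have := sqrt4K (ltW l0).
have : 0 < Num.sqrt (Num.sqrt l) by rewrite !sqrtr_gt0.
have L0 : 0 <= ln l by apply: ln_ge0; apply: le_trans l256; rewrite ler1n.
move: (Num.sqrt _) (ln l) L0 => z L L0 z0 z4 Lz.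
have z4le : 4 <= z.
  have : (4 : R) ^+ 4 <= z ^+ 4 by rewrite z4; apply: le_trans l256; rewrite -natrX ler_nat.
  by rewrite ler_pXn2r// nnegrE ltW.
have zth : 8 / th <= z.
  by move: lth; rewrite -z4 ler_pXn2r// nnegrE ltW// divr_gt0.
split.
- apply: (@le_trans _ _ ((4 * z) ^+ 2)); first by rewrite ler_pXn2r// nnegrE mulr_ge0// ltW.
  rewrite -z4; have : 0 <= z ^+ 2 * (z ^+ 2 - 16) by apply: mulr_ge0; nra.
  lra.
- have ln2 : ln 2 <= (1 : R).
    have N11 : -1 < 1 :> R by lra.
    by have := ln_leD1 ltr01 N11; rewrite ln1 divr1 add0r.
  have zl : 4 * z <= z ^+ 4 / 4.
    have : 0 <= z * (z ^+ 3 - 16) by apply: mulr_ge0; [exact: ltW|nra].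
    by lra.
  move: Lz ln2 zl lk l256; rewrite z4; move: (ln 2) `|kp| => a c; clear; lra.
- have h8 : 8 <= th * z by rewrite mulrC -ler_pdivrMr.
  rewrite -z4 (_ : th * z ^+ 4 = (th * z) * z * z ^+ 2); last by ring.
  have zz : 1 <= z ^+ 2 by apply: exprn_ege1; lra.
  have h1 : 8 * z <= (th * z) * z by rewrite ler_pM2r.
  apply: (@le_trans _ _ (8 * z)); first by lra.
  by apply: (le_trans h1); rewrite ler_peMr// !mulr_ge0// ltW.
Qed.

Lemma ball_error_le (k : nat) (C1 l L q y A : R) : 0 < C1 -> 0 < l -> 1 <= L -> 0 < q ->
  0 <= y -> y <= 2 * l -> expR (l / 16) <= q -> 16 ^+ k.+2 * k.+2`!%:R <= l ->
  `|A + y * (y - 2)| <= C1 * (y ^+ 2 / q) ->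
  `|- A / l ^+ 2 - ((y / l) ^+ 2 - 2 * l^-1 * (y / l))| <= 4 * C1 * (L ^+ k / l ^+ k.+1).
Proof.
move=> C10 l0 L1 q0 y0 y2 ql lk HA.
rewrite (_ : _ - _ = - ((A + y * (y - 2)) / l ^+ 2)); last by field; rewrite lt0r_neq0.
rewrite normrN normrM [X in _ * X]gtr0_norm ?invr_gt0 ?exprn_gt0//.
rewrite ler_pdivrMr ?exprn_gt0//; apply: (le_trans HA).
have yl : y ^+ 2 <= 4 * l ^+ 2.
  rewrite (_ : 4 * l ^+ 2 = (2 * l) ^+ 2); last by ring.
  by rewrite ler_pXn2r ?nnegrE// (le_trans y0).
have qi : q^-1 <= L ^+ k / l ^+ k.+1.
  apply: (@le_trans _ _ (l ^- k.+1)).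
    apply: le_trans (expRN_le_pow l0 lk).
    by rewrite expRN lef_pV2 ?posrE ?expR_gt0.
  by rewrite ler_peMl ?invr_ge0 ?exprn_ge0 ?exprn_ege1// ltW.
rewrite (_ : 4 * C1 * _ * _ = C1 * (4 * l ^+ 2 * (L ^+ k / l ^+ k.+1))); last first.
  by move: (L ^+ k / _) => a; ring.
by rewrite ler_pM2l//; apply: ler_pM => //; rewrite ?sqr_ge0 ?invr_ge0 ?ltW.
Qed.

Lemma root_error_le (k : nat) (l L : R) : 0 < l -> 1 <= L -> L ^+ 2 <= l ->
  (2 * L * l^-1) ^+ k.+2 + (2 * L) ^+ k * l^-1 ^+ k.+1 <=
  (2 ^+ k.+2 + 2 ^+ k) * (L ^+ k / l ^+ k.+1).
Proof.
move=> l0 L1 L2.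
have L0 : 0 < L by apply: lt_le_trans L1.
rewrite (mulrDl (2 ^+ k.+2) (2 ^+ k)) lerD//; last by rewrite exprMn exprVn mulrA.
rewrite exprMn exprMn exprVn -mulrA ler_pM2l ?exprn_gt0//.
rewrite (_ : L ^+ k.+2 / l ^+ k.+2 = L ^+ k / l ^+ k.+1 * (L ^+ 2 / l)); last first.
  by rewrite (exprSr l k.+1) -(addn2 k) exprD invfM mulrACA.
rewrite ler_piMr//; first by rewrite divr_ge0// exprn_ge0// ltW.
by rewrite ler_pdivrMr// mul1r.
Qed.

End assembly.

Section main.
Context {R : realType} d (T : measurableType d) (P : probability T R).
Context (b delta : R) (xi : nat * nat -> {RV P >-> R}).
Hypotheses (b1 : -1 < b) (d1 : -1 < delta).
Hypothesis indep : mutually_independent pos_pairs xi.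
Hypothesis normal : forall ij, pos_pairs ij -> standard_normal (xi ij).

(** Here [y] is the root of [y = ln y + l + kp], [x = y / (2 pi^3 r)] and [q = x^(1/16)].
    Since [x >= 1 / r = exp l], the error of [small_ball] is exponentially small in [l],
    and the expansion comes from [root_expansion] with [w = y / l]. *)
Lemma small_ball_expansion k : (2 <= k)%N -> exists2 C : R, 0 < C & exists M : R,
  forall r, 0 < r -> r < 1 -> M <= - ln r ->
  `|8 * pi ^+ 2 * r / ln r ^+ 2 * `|ln (ball_prob b delta xi r)| -
    (1 + \sum_(1 <= m < k.+1) p_coef m (sbar b delta r) * `|ln r| ^- m)| <=
  C * (ln `|ln r| ^+ k / `|ln r| ^+ k.+1).
Proof.
move=> k2.
have [C1 C10 [Q0 Q8 HSB]] := small_ball b1 d1 indep normal.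
have [C2 C20 [th th0 HRE]] := @root_expansion R k k2.
have pi0 := @pi_gt0 R.
have p30 : 0 < 2 * pi ^+ 3 :> R by rewrite mulr_gt0// exprn_gt0.
pose kp : R := - Psi (1 + b) - Psi (1 + delta) - ln (2 * pi ^+ 3).
exists (4 * C1 + C2 * (2 ^+ k.+2 + 2 ^+ k)).
  by rewrite addr_gt0 ?mulr_gt0// addr_gt0 ?exprn_gt0.
(* The six thresholds, in order: [l] large, [|kp| < ln l], [2 ln l <= th l], [q]
   beyond the threshold of [small_ball], existence of the root, and [exp (- l / 16)]
   at most [l^(-(k+1))]. *)
exists (Num.max (Num.max (Num.max 256 (expR (`|kp| + 1))) (Num.max ((8 / th) ^+ 4) (16 * (Q0 ^+ 16))))
   (Num.max (2 * `|kp|) (16 ^+ k.+2 * k.+2`!%:R))).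
move=> r r0 r1; rewrite !ge_max => /andP[/andP[/andP[M1 M2] /andP[M3 M4]] /andP[M5 M6]].
have lnr0 : ln r < 0 by apply: ln_lt0; rewrite r0.
rewrite (ltr0_norm lnr0).
have -> : ln r ^+ 2 = (- ln r) ^+ 2 by rewrite sqrrN.
have sE : sbar b delta r = ln (- ln r) + kp.
  by rewrite /sbar (ltr0_norm lnr0) /kp !addrA.
rewrite sE.
have expl : expR (- ln r) = r^-1 by rewrite expRN lnK.
move: M1 M2 M3 M4 M5 M6 expl {sE}; set l := - ln r => M1 M2 M3 M4 M5 M6 expl.
have l0 : 0 < l by apply: lt_le_trans M1; rewrite ltr0n.
have [L2l Ll Lth] := ln_scale th0 M1 M3 M5.
pose L := ln l.
have L1 : `|kp| + 1 <= L by rewrite -(ler_expR) lnK.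
have L1' : 1 <= L by apply: le_trans L1; rewrite lerDr.
have l4 : 4 <= l by apply: le_trans M1; rewrite ler_nat.
have [y /andP[y1 y2] yE] := implicit_root l4 M5 Ll.
have y0 : 0 < y by apply: lt_le_trans y1; rewrite divr_gt0.
pose x := y / (2 * pi ^+ 3 * r).
have x0 : 0 < x by rewrite divr_gt0// mulr_gt0.
have rE : r = y / (2 * pi ^+ 3 * x).
  by rewrite /x; move: (pi : R) pi0 => p pp; field; rewrite !lt0r_neq0.
have yx : y = ln x + (- Psi (1 + b) - Psi (1 + delta) - 1) + 1.
  have lx : ln x = ln y - ln (2 * pi ^+ 3) + l.
    rewrite /x ln_div ?posrE ?mulr_gt0// lnM ?posrE// /l.
    by move: (ln y) (ln _) (ln _) => ? ? ?; ring.
  rewrite lx {1}yE /kp; move: (ln y) (ln _) (Psi _) (Psi _) => ? ? ? ?; ring.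
pose q := Num.sqrt (Num.sqrt (Num.sqrt (Num.sqrt x))).
have q0 : 0 < q by rewrite !sqrtr_gt0.
have q16 : q ^+ 16 = x.
  by rewrite (exprM _ 4 4) sqrt4K ?sqrtr_ge0// sqrt4K// ltW.
have xl : expR l <= x.
  rewrite expl /x invfM mulrA -[leLHS]mul1r ler_pM2r ?invr_gt0//.
  rewrite ler_pdivlMr// mul1r.
  have p4 : (pi : R) < 4 := pi_lt4.
  have p30' : (pi : R) ^+ 3 <= 4 ^+ 3 by apply: lerXn2r; rewrite ?nnegrE ltW.
  have h128 : 2 * (4 : R) ^+ 3 <= l / 2.
    by rewrite ler_pdivlMr//; apply: le_trans M1; rewrite -natrX -!natrM ler_nat.
  by apply: le_trans y1; apply: le_trans h128; rewrite ler_pM2l.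
have ql : expR (l / 16) <= q.
  have : expR (l / 16) ^+ 16 <= q ^+ 16.
    by rewrite q16 -expRM_natl mulrC divfK.
  by rewrite ler_pXn2r// nnegrE ?expR_ge0// ltW.
have qQ : Q0 <= q.
  have Q00 : 0 <= Q0 by apply: le_trans Q8.
  suff : Q0 ^+ 16 <= q ^+ 16 by rewrite ler_pXn2r// nnegrE ltW.
  rewrite q16; apply: le_trans xl; apply: (le_trans _ (expR_ge1Dx l)).
  apply: (@le_trans _ _ l); last by rewrite lerDr.
  by apply: le_trans M4; rewrite ler_peMl ?exprn_ge0// ler1n.
have y5 : 5 <= y.
  by apply: le_trans y1; rewrite ler_pdivlMr//; apply: le_trans M1; rewrite -natrM ler_nat.
have [p0 SB] := HSB q x y r qQ (esym q16) yx y5 rE.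
set p := ball_prob b delta xi r in p0 SB *.
have p1 : p <= 1 by exact: ball_prob_le1.
have lnp0 : ln p <= 0 by exact: ln_le0.
rewrite (ler0_norm lnp0).
pose e := l^-1.
have e0 : 0 < e by rewrite invr_gt0.
pose w := y / l.
have w1 : 1 / 2 <= w by rewrite ler_pdivlMr// mul1r mulrC.
have w2 : w <= 2 by rewrite ler_pdivrMr.
pose s := L + kp.
have wE : w = 1 + e * (s + ln w).
  rewrite /w ln_div ?posrE// {1}yE /s /e -/L.
  by move: (ln y) => a; field; rewrite lt0r_neq0.
pose sg := 2 * L.
have sg1 : 1 <= sg by apply: (le_trans L1'); rewrite ler_peMl ?(le_trans _ L1')// ler1n.
have ssg : `|s| <= sg.
  apply: (le_trans (ler_normD _ _)); rewrite /sg [leRHS]mulr_natl mulr2n lerD//.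
    by rewrite ger0_norm// (le_trans _ L1').
  by apply: le_trans L1; rewrite lerDl.
have sgth : sg * e <= th by rewrite /e ler_pdivrMr.
have RE := HRE s sg e w sg1 ssg e0 sgth w1 w2 wE.
have sumE : \sum_(1 <= m < k.+1) p_coef m s * l ^- m = \sum_(1 <= m < k.+1) p_coef m s * e ^+ m.
  by apply: eq_bigr => m _; rewrite /e exprVn.
rewrite -/L -/s sumE.
have t1 := ball_error_le C10 l0 L1' q0 (ltW y0) y2 ql M6 SB.
have t2 := root_error_le k l0 L1' L2l.
rewrite -(ler_pM2l C20) (mulrA C2 (2 ^+ k.+2 + 2 ^+ k)) in t2.
rewrite (_ : 8 * pi ^+ 2 * r / l ^+ 2 * - ln p = - (8 * pi ^+ 2 * r * ln p) / l ^+ 2); last first.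
  by rewrite mulrN mulrAC mulNr.
rewrite (mulrDl (4 * C1)); apply: (le_trans _ (lerD t1 (le_trans RE t2))).
set A := - _ / _; set B0 := w ^+ 2 - _; set S := 1 + _.
by rewrite (_ : A - S = (A - B0) + (B0 - S)); [exact: ler_normD|ring].
Qed.

End main.

Theorem corollary1 (R : realType) (d : measure_display) (T : measurableType d)
    (P : probability T R) (b delta : R) (xi : nat * nat -> {RV P >-> R}) :
  -1 < b -> -1 < delta ->
  mutually_independent pos_pairs xi ->
  (forall ij, pos_pairs ij -> standard_normal (xi ij)) ->
  (forall k : nat, (2 <= k)%N ->
     (fun r : R => 8 * pi ^+ 2 * r / ln r ^+ 2 *
        `|ln (fine (P [set w | (V2 b delta xi w < r%:E)%E]))|) =
     (fun r : R =>
        1 + \sum_(1 <= m < k.+1) p_coef m (sbar b delta r) * `|ln r| ^- m)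
     +O_ (0^'+) (fun r : R => ln `|ln r| ^+ k / `|ln r| ^+ k.+1)) /\
  (fun r : R => 8 * pi ^+ 2 * r / ln r ^+ 2 *
        `|ln (fine (P [set w | (V2 b delta xi w < r%:E)%E]))|) =
  (fun r : R =>
     1 + 2 * (sbar b delta r - 1) * `|ln r|^-1
       + sbar b delta r ^+ 2 * `|ln r| ^- 2)
  +O_ (0^'+) (fun r : R => ln `|ln r| ^+ 2 / `|ln r| ^+ 3).
Proof.
move=> b1 d1 indep normal.
have main k : (2 <= k)%N ->
     (fun r : R => 8 * pi ^+ 2 * r / ln r ^+ 2 *
        `|ln (fine (P [set w | (V2 b delta xi w < r%:E)%E]))|) =
     (fun r : R =>
        1 + \sum_(1 <= m < k.+1) p_coef m (sbar b delta r) * `|ln r| ^- m)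
     +O_ (0^'+) (fun r : R => ln `|ln r| ^+ k / `|ln r| ^+ k.+1).
  move=> k2; have [C C0 [M HM]] := small_ball_expansion b1 d1 indep normal k2.
  apply/eqaddOP; near=> K; near=> r.
  have r0 : 0 < r by near: r; exact: nbhs_right_gt.
  have r1 : r < 1 by near: r; exact: nbhs_right_lt.
  have rM : r < expR (- M) by near: r; apply: nbhs_right_lt; exact: expR_gt0.
  have Mr : M <= - ln r.
    by rewrite lerNr -(expRK (- M)) ler_ln ?posrE ?expR_gt0// ltW.
  apply: (le_trans (HM r r0 r1 Mr)).
  apply: (@le_trans _ _ (C * `|ln `|ln r| ^+ k / `|ln r| ^+ k.+1|)).
    by rewrite ler_pM2l// ler_norm.
  by rewrite ler_wpM2r//; near: K; exact: nbhs_pinfty_ge.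
split => //.
have := main 2%N isT.
rewrite (_ : (fun r : R => 1 + \sum_(1 <= m < 3) p_coef m (sbar b delta r) * `|ln r| ^- m) =
  (fun r : R => 1 + 2 * (sbar b delta r - 1) * `|ln r|^-1 + sbar b delta r ^+ 2 * `|ln r| ^- 2))//.
apply/funext => r; rewrite big_nat_recr//= big_nat1 /p_coef/= expr1 addrA.
by congr (_ + _ * _ + _); rewrite (mulrBr 2 _ 1) (mulr1 2).
Unshelve. all: by end_near. Qed.
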